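(* Let $F$ be an algebraically closed field of characteristic $5$, let $\underline{n}=(n_1,n_2)$ be a pair of positive integers, and let $L=M(2;\underline{n})$ be the Melikyan algebra over $F$. Let $L=\bigoplus_{g\in G}L_g$ be a grading of $L$ by a group $G$ such that the support of the grading generates $G$ and $G$ has no elements of order $5$. Then this grading is isomorphic to a standard $G$-grading on $L$.
   Context: Melikyan algebra. $F$ is an algebraically closed field of characteristic $5$, $\underline n=(n_1,n_2)$ is a pair of positive integers, $\tau(\underline n)=(5^{n_1}-1,5^{n_2}-1)$, $\varepsilon_1=(1,0)$, $\varepsilon_2=(0,1)$. $O(2;\underline n)$ is the commutative $F$-algebra with basis $\{x^{(a)} : 0\le a\le\tau(\underline n)\}$ ($a=(a_1,a_2)$ a pair of integers, inequalities componentwise) and product $x^{(a)}x^{(b)}=\binom{a_1+b_1}{a_1}\binom{a_2+b_2}{a_2}x^{(a+b)}$; the convention is $x^{(c)}=0$ unless $0\le c\le\tau(\underline n)$. $\partial_i$ ($i=1,2$) is the derivation $\partial_i(x^{(a)})=x^{(a-\varepsilon_i)}$. $W(2;\underline n)=\{f_1\partial_1+f_2\partial_2 : f_i\in O(2;\underline n)\}$ is the Lie algebra with $[f\partial_i,g\partial_j]=f(\partial_i g)\partial_j-g(\partial_j f)\partial_i$. Put $\operatorname{div}(f_1\partial_1+f_2\partial_2)=\partial_1(f_1)+\partial_2(f_2)$. $\widetilde W(2;\underline n)=O(2;\underline n)\tilde\partial_1\oplus O(2;\underline n)\tilde\partial_2$ is a copy of the vector space $W(2;\underline n)$, with $E=f_1\partial_1+f_2\partial_2\mapsto\widetilde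 E=f_1\tilde\partial_1+f_2\tilde\partial_2$. The Melikyan algebra is the Lie algebra $M(2;\underline n)=O(2;\underline n)\oplus W(2;\underline n)\oplus\widetilde W(2;\underline n)$ whose (antisymmetric) bracket extends that of $W(2;\underline n)$ and is given, for $D,E\in W(2;\underline n)$ and $f,f_i,g_i\in O(2;\underline n)$, by $[D,\widetilde E]=\widetilde{[D,E]}+2\operatorname{div}(D)\widetilde E$; $[D,f]=D(f)-2\operatorname{div}(D)f$; $[f,\widetilde E]=fE$; $[f_1,f_2]=2(f_1\partial_1(f_2)-f_2\partial_1(f_1))\tilde\partial_2+2(f_2\partial_2(f_1)-f_1\partial_2(f_2))\tilde\partial_1$; $[f_1\tilde\partial_1+f_2\tilde\partial_2,\,g_1\tilde\partial_1+g_2\tilde\partial_2]=f_1g_2-f_2g_1$. Gradings. A grading of an algebra $A$ by a group $G$ (a $G$-grading) is a vector space decomposition $A=\bigoplus_{g\in G}A_g$ with $[A_{g'},A_{g''}]\subset A_{g'g''}$ for all $g',g''\in G$; its support is $\{g\in G : A_g\ne0\}$. (For a simple Lie algebra the subgroup generated by the support of a grading by a group is well known to be abelian, so in the situation of the claim $G$ is abelian.) Two $G$-gradings $A=\bigoplus_{g}A_g$ and $A=\bigoplus_g A'_g$ are isomorphic if there is $\Psi\in\operatorname{Aut}A$ with $\Psi(A_g)=A'_g$ for all $g\in G$. Standard gradings. Write $\underline 1=(1,1)$. There is a $\mathbb Z^2$-grading $\overline\Gamma_M: M(2;\underline n)=\bigoplus_{c\in\mathbb Z^2}M_c$ with, for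 $a\in\mathbb Z^2$, $M_{3a}=\operatorname{Span}\{x^{(a+\varepsilon_i)}\partial_i : i=1,2\}$, $M_{3a+\underline 1}=\operatorname{Span}\{x^{(a+\varepsilon_i)}\tilde\partial_i : i=1,2\}$, $M_{3a-\underline 1}=\operatorname{Span}\{x^{(a)}\}$, and $M_c=0$ for all other $c$. Let $\phi_M:\mathbb Z^2\to\mathbb Z^2$ be the homomorphism with $\phi_M(1,0)=(3,0)$, $\phi_M(0,1)=(1,1)$. The standard $\mathbb Z^2$-grading is $\Gamma_M: M(2;\underline n)=\bigoplus_{a\in\mathbb Z^2}L_a$ with $L_a=M_{\phi_M(a)}$; write $\deg_{\Gamma_M}$ for the degree with respect to it. For an abelian group $G$ and a homomorphism $\varphi:\mathbb Z^2\to G$, the standard $G$-grading induced by $\varphi$ is $M(2;\underline n)=\bigoplus_{g\in G}M_g$, where $M_g=\operatorname{Span}\{y\in M(2;\underline n)\text{ homogeneous for }\Gamma_M : \varphi(\deg_{\Gamma_M}(y))=g\}$. A standard $G$-grading is a standard $G$-grading induced by some homomorphism $\varphi:\mathbb Z^2\to G$. *)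

(* Defs.v *)
From HB Require Import structures.
From mathcomp Require Import all_boot all_order all_algebra.

Set Implicit Arguments.
Unset Strict Implicit.
Unset Printing Implicit Defensive.

Import GRing.Theory.

Local Open Scope ring_scope.

(* groupType covers infinite and non-commutative groups. *)
Section Groups.
Variable G : groupType.

Definition is_subgroup (H : G -> Prop) : Prop :=
  [/\ H 1%g, (forall g h, H g -> H h -> H (g * h)%g)
    & (forall g, H g -> H (g^-1)%g)].

Definition generates (S : G -> Prop) : Prop :=
  forall H : G -> Prop, is_subgroup H -> (forall g, S g -> H g) ->
  forall g, H g.

Definition has_order (g : G) (m : nat) : Prop :=
  [/\ (0 < m)%N, (g ^+ m = 1)%g
    & forall k, (0 < k < m)%N -> (g ^+ k <> 1)%g].

End Groups.

Section Gradings.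
Variables (F : fieldType) (V : vectType F) (br : V -> V -> V) (G : groupType).

(* The first two clauses say that V is the (internal) direct sum of the A g:
   every vector is a finite sum of vectors taken from the A g, and the zero
   vector is so only in the trivial way.  G need not be finite. *)
Definition is_grading (A : G -> {vspace V}) : Prop :=
  [/\ forall x : V, exists s : seq G, exists v : G -> V,
        (forall g, v g \in A g) /\ x = \sum_(g <- s) v g,
      forall (s : seq G) (v : G -> V), uniq s -> (forall g, v g \in A g) ->
        \sum_(g <- s) v g = 0 -> forall g, g \in s -> v g = 0
    & forall (g h : G) (x y : V),
        x \in A g -> y \in A h -> br x y \in A (g * h)%g].

Definition supp (A : G -> {vspace V}) (g : G) : Prop := A g != 0%VS.

Definition is_automorphism (Psi : 'End(V)) : Prop :=
  bijective Psi /\ forall x y, Psi (br x y) = br (Psi x) (Psi y).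

Definition isomorphic_gradings (A B : G -> {vspace V}) : Prop :=
  exists Psi : 'End(V),
    is_automorphism Psi /\ forall g, (Psi @: A g)%VS = B g.

Definition in_span (P : V -> Prop) (x : V) : Prop :=
  exists2 s : seq V, (forall y, y \in s -> P y) & x \in <<s>>%VS.

End Gradings.

Section Melikyan.
Variables (F : fieldType) (n1 n2 : nat).

Definition exps : finType := ('I_(5 ^ n1) * 'I_(5 ^ n2))%type.

(* An element of O(2; n) is the family of its coordinates in the basis of the
   divided powers x^(a), 0 <= a <= tau(n).  The pointwise product of functions
   plays no role; the product is omul below. *)
Definition O2 : vectType F := {ffun exps -> F^o}.

Definition expZ (a : exps) : int * int := (Posz a.1, Posz a.2).

(* x^(c), which is 0 unless 0 <= c <= tau(n) *)
Definition xpow (c : int * int) : O2 := [ffun a => (expZ a == c)%:R].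

Definition eps1 : int * int := (1, 0).
Definition eps2 : int * int := (0, 1).

Definition omul (f g : O2) : O2 :=
  \sum_(a : exps) \sum_(b : exps)
    (f a * g b * ('C(a.1 + b.1, a.1) * 'C(a.2 + b.2, a.2))%:R)
      *: xpow (expZ a + expZ b).

Definition partial1 (f : O2) : O2 :=
  \sum_(a : exps) f a *: xpow (expZ a - eps1).
Definition partial2 (f : O2) : O2 :=
  \sum_(a : exps) f a *: xpow (expZ a - eps2).

(* The pair (f1, f2) stands for f1 d_1 + f2 d_2 in W(2; n), and also for
   its copy f1 d~_1 + f2 d~_2 in W~(2; n). *)
Definition W2 : vectType F := (O2 * O2)%type.

Definition act (D : W2) (f : O2) : O2 :=
  omul D.1 (partial1 f) + omul D.2 (partial2 f).

Definition wbr (D E : W2) : W2 :=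
  (act D E.1 - act E D.1, act D E.2 - act E D.2).

Definition divg (D : W2) : O2 := partial1 D.1 + partial2 D.2.

Definition oscale (f : O2) (E : W2) : W2 := (omul f E.1, omul f E.2).

(* O(2; n) (+) W(2; n) (+) W~(2; n), as nested pairs ((f, D), E~) *)
Definition Melikyan : vectType F := (O2 * W2 * W2)%type.

Definition inO (f : O2) : Melikyan := (f, 0, 0).
Definition inW (D : W2) : Melikyan := (0, D, 0).
Definition inWt (E : W2) : Melikyan := (0, 0, E).

(* [D, E~], in W~ *)
Definition br_W_Wt (D E : W2) : W2 := wbr D E + 2%:R *: oscale (divg D) E.

(* [D, f], in O *)
Definition br_W_O (D : W2) (f : O2) : O2 := act D f - 2%:R *: omul (divg D) f.

(* [f, g], in W~ *)
Definition br_O_O (f g : O2) : W2 :=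
  (2%:R *: (omul g (partial2 f) - omul f (partial2 g)),
   2%:R *: (omul f (partial1 g) - omul g (partial1 f))).

(* [E~, E'~], in O *)
Definition br_Wt_Wt (E E' : W2) : O2 := omul E.1 E'.2 - omul E.2 E'.1.

(* The antisymmetric bilinear extension of the brackets above together with
   [f, E~] = f E *)
Definition mbr (u v : Melikyan) : Melikyan :=
  let: (f, D, E) := u in
  let: (f', D', E') := v in
  (br_W_O D f' - br_W_O D' f + br_Wt_Wt E E',
   wbr D D' + oscale f E' - oscale f' E,
   br_W_Wt D E' - br_W_Wt D' E + br_O_O f f').

Definition one2 : int * int := (1, 1).
Definition dvd3 (c : int * int) : bool := (3 %| c.1)%Z && (3 %| c.2)%Z.
Definition quo3 (c : int * int) : int * int := ((c.1 %/ 3)%Z, (c.2 %/ 3)%Z).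

(* The component M_c: the three cases c = 3a, c = 3a + (1,1), c = 3a - (1,1)
   are mutually exclusive, and a is determined by c. *)
Definition Mbar (c : int * int) : {vspace Melikyan} :=
  if dvd3 c then
    let a := quo3 c in
    <<[:: inW (xpow (a + eps1), 0)%R; inW (0, xpow (a + eps2))%R]>>%VS
  else if dvd3 (c - one2) then
    let a := quo3 (c - one2) in
    <<[:: inWt (xpow (a + eps1), 0)%R; inWt (0, xpow (a + eps2))%R]>>%VS
  else if dvd3 (c + one2) then
    let a := quo3 (c + one2) in
    <<[:: inO (xpow a)]>>%VS
  else 0%VS.

(* The homomorphism with (1, 0) |-> (3, 0) and (0, 1) |-> (1, 1) *)
Definition phiM (a : int * int) : int * int :=
  ((3, 0) : int * int) *~ a.1 + ((1, 1) : int * int) *~ a.2.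

Definition GammaM (a : int * int) : {vspace Melikyan} := Mbar (phiM a).

Definition has_degree (y : Melikyan) (a : int * int) : Prop :=
  y != 0 /\ y \in GammaM a.

Definition is_induced_by (G : groupType) (phi : int * int -> G)
    (B : G -> {vspace Melikyan}) : Prop :=
  forall g x, x \in B g <->
    in_span (fun y => exists2 a, has_degree y a & phi a = g) x.

(* Standard gradings are only defined for abelian G. *)
Definition is_standard_grading (G : groupType)
    (B : G -> {vspace Melikyan}) : Prop :=
  (forall g h : G, (g * h = h * g)%g) /\
  exists phi : int * int -> G,
    (forall a b, phi (a + b) = (phi a * phi b)%g) /\ is_induced_by phi B.

End Melikyan.

Arguments mbr {F n1 n2} u v.

(* Main.v *)
Require Import Defs.
From HB Require Import structures.
From mathcomp Require Import all_boot all_order all_algebra.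
From mathcomp Require Import ring zify.
From Stdlib Require Import ClassicalEpsilon.
Set Implicit Arguments.
Unset Strict Implicit.
Unset Printing Implicit Defensive.
Import Order.TTheory GRing.Theory Num.Theory.
Local Open Scope ring_scope.

(* Since G has no 5-torsion, its F-valued characters separate points, and each character
   acts on L by an automorphism.  Every automorphism preserves the Z-filtration of L: the
   sandwich-like elements c with [c, y_1, ..., y_k, c] = 0 for all short words y are exactly
   those of the top component, and the top component together with d_1 and d_2 generates L
   downwards.  So the projections of the G-grading are filtered, and a filtered G-grading is
   conjugate to one commuting with the Z-grading: the obstruction in each degree i is a sum
   of leading terms of automorphisms trivial modulo degree i, which are extracted from
   commutators of characters with their graded parts.

   Next d_1 is made homogeneous.  If n_1 < n_2 this is automatic, as d_1 spans the vectors of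
   lowest degree with ad^(5^n_1) = 0; if n_1 = n_2 a linear substitution achieves it; if
   n_1 > n_2 the two variables are exchanged.  The same conjugation argument for a Z-grading
   refining the first one and separating all Z^2-degrees then makes all monomials
   homogeneous.  As d_1, d_2, 1 and the constants of the third summand satisfy enough
   brackets, the degrees of all monomials are determined by those of d_1 and 1.

   The support generates an abelian group since L is simple. *)

(** The automorphism group is not treated as an algebraic group: conjugacy of tori is replaced by a
    deformation argument, one degree at a time. Derivations need not exponentiate in characteristic
    5, so the corrections have to be leading terms of genuine automorphisms. These leading terms
    form a vector space because the torus of the Z-grading rescales degree [i] by [t ^ i] and [F] is
    algebraically closed; hence the part belonging to a single quotient [a / b] of degrees can be
    split off by characters. Two Z-gradings are needed. The filtration by total degree is stable
    under all automorphisms, but total degree does not separate monomials. Weights [a] and [a + 1]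
    with [a] large separate the Z^2-degrees and still compare total degrees first. For these weights
    [d_1] may enter the image of [d_2] but not conversely, which is why [d_1] must be homogeneous
    beforehand. *)

(** * Coordinates in the truncated divided power algebra *)

Section DividedPowers.
Variables (F : fieldType) (n1 n2 : nat).
Local Notation N1 := (5 ^ n1)%N.
Local Notation N2 := (5 ^ n2)%N.
Local Notation O := (O2 F n1 n2).

(* The coordinate at [x^(i, j)], extended by 0 to all pairs of naturals. *)
Definition cf (f : O) (i j : nat) : F :=
  if insub i is Some a then if insub j is Some b then f (a, b) else 0 else 0.

Lemma cf_ord (f : O) (a : exps n1 n2) : cf f a.1 a.2 = f a.
Proof. by case: a => a b; rewrite /cf !valK. Qed.

Lemma cf_out f i j : ~~ ((i < N1) && (j < N2))%N -> cf f i j = 0.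
Proof.
rewrite /cf; case: insubP => [a /= lta _|/negbTE->//].
by case: insubP => [b /= ltb _|//]; rewrite lta ltb.
Qed.

Lemma cf_ext f g : (forall i j, cf f i j = cf g i j) -> f = g.
Proof. by move=> e; apply/ffunP => a; rewrite -!cf_ord e. Qed.

Lemma cf_linear i j c f g : cf (c *: f + g) i j = c * cf f i j + cf g i j.
Proof.
rewrite /cf; case: insub => [a|]; last by rewrite mulr0 addr0.
by case: insub => [b|]; rewrite ?mulr0 ?addr0 // !ffunE.
Qed.

Lemma cf0 i j : cf 0 i j = 0.
Proof. by rewrite /cf; case: insub => [a|//]; case: insub => [b|//]; rewrite ffunE. Qed.
Lemma cfD f g i j : cf (f + g) i j = cf f i j + cf g i j.
Proof. by have := cf_linear i j 1 f g; rewrite scale1r mul1r. Qed.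
Lemma cfZ c f i j : cf (c *: f) i j = c * cf f i j.
Proof. by have := cf_linear i j c f 0; rewrite addr0 cf0 addr0. Qed.
Lemma cfN f i j : cf (- f) i j = - cf f i j.
Proof. by rewrite -scaleN1r cfZ mulN1r. Qed.
Lemma cfB f g i j : cf (f - g) i j = cf f i j - cf g i j.
Proof. by rewrite cfD cfN. Qed.
Lemma cf_sum I (r : seq I) (P : pred I) (G : I -> O) i j :
  cf (\sum_(k <- r | P k) G k) i j = \sum_(k <- r | P k) cf (G k) i j.
Proof. by rewrite (big_morph (fun f => cf f i j) (fun f g => cfD f g i j) (cf0 i j)). Qed.

Definition cfE := (cf0, cfD, cfN, cfZ, cf_sum).

Lemma cf_xpow c i j :
  cf (xpow F n1 n2 c) i j = [&& (i < N1)%N, (j < N2)%N & (Posz i, Posz j) == c]%:R.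
Proof.
rewrite /cf; case: insubP => [a /= -> ea|/negbTE->//].
by case: insubP => [b /= -> eb|/negbTE->//]; rewrite ffunE /expZ /= ea eb.
Qed.

Lemma sum_exps (H : nat -> nat -> F) :
  \sum_(a : exps n1 n2) H a.1 a.2 = \sum_(k < N1) \sum_(l < N2) H k l.
Proof. by rewrite pair_bigA. Qed.

Lemma sum_delta n (H : nat -> F) (j : nat) :
  \sum_(k < n) H k * ((k : nat) == j)%:R = if (j < n)%N then H j else 0.
Proof.
case: ltnP => lt.
  rewrite (bigD1 (Ordinal lt)) //= eqxx mulr1 big1 ?addr0 // => i ne.
  by have /negbTE-> : (i : nat) != j by []; rewrite mulr0.
by rewrite big1 // => i _; case: eqP => [e|_]; rewrite ?mulr0 //; have := ltn_ord i; lia.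
Qed.

Lemma cf_partial1 f i j : cf (partial1 f) i j = cf f i.+1 j.
Proof.
rewrite /partial1 !cfE.
under eq_bigr => a _ do rewrite cfZ cf_xpow -cf_ord.
rewrite (sum_exps (fun k l => cf f k l * [&& (i < N1)%N, (j < N2)%N & (Posz i, Posz j) == (Posz k - 1, Posz l - 0)]%:R)).
transitivity (\sum_(k < N1) (\sum_(l < N2) cf f k l * ((l : nat) == j)%:R) * ((k : nat) == i.+1)%:R).
  apply: eq_bigr => k _; rewrite big_distrl /=; apply: eq_bigr => l _.
  rewrite -mulrA -natrM mulnb; congr (_ * (nat_of_bool _)%:R).
  have := ltn_ord k; have := ltn_ord l; rewrite /eq_op /= => *.
  apply/idP/idP; rewrite -!(rwP andP) => *; repeat split; lia.
under eq_bigr => k _ do rewrite (sum_delta N2 (fun l => cf f k l)).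
rewrite (sum_delta N1 (fun k => if (j < N2)%N then cf f k j else 0)).
by case: (ltnP i.+1 N1) => h1; last rewrite cf_out ?ltnNge ?h1 //;
  case: ltnP => // h2; rewrite cf_out // negb_and -!leqNgt h2 orbT.
Qed.

Lemma cf_partial2 f i j : cf (partial2 f) i j = cf f i j.+1.
Proof.
rewrite /partial2 !cfE.
under eq_bigr => a _ do rewrite cfZ cf_xpow -cf_ord.
rewrite (sum_exps (fun k l => cf f k l * [&& (i < N1)%N, (j < N2)%N & (Posz i, Posz j) == (Posz k - 0, Posz l - 1)]%:R)).
transitivity (\sum_(k < N1) (\sum_(l < N2) cf f k l * ((l : nat) == j.+1)%:R) * ((k : nat) == i)%:R).
  apply: eq_bigr => k _; rewrite big_distrl /=; apply: eq_bigr => l _.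
  rewrite -mulrA -natrM mulnb; congr (_ * (nat_of_bool _)%:R).
  have := ltn_ord k; have := ltn_ord l; rewrite /eq_op /= => *.
  apply/idP/idP; rewrite -!(rwP andP) => *; repeat split; lia.
under eq_bigr => k _ do rewrite (sum_delta N2 (fun l => cf f k l)).
rewrite (sum_delta N1 (fun k => if (j.+1 < N2)%N then cf f k j.+1 else 0)).
by case: (ltnP i N1) => h1; last rewrite cf_out ?ltnNge ?h1 //;
  case: ltnP => // h2; rewrite cf_out // negb_and -!leqNgt h2 orbT.
Qed.

Lemma cf_omul f g i j : cf (omul f g) i j =
  if (i < N1)%N && (j < N2)%N then
    \sum_(k < i.+1) \sum_(l < j.+1)
       'C(i, k)%:R * 'C(j, l)%:R * cf f k l * cf g (i - k) (j - l)
  else 0.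
Proof.
case: ifP => [/andP[lti ltj]|out]; last by rewrite cf_out // out.
rewrite /omul cf_sum; under eq_bigr => a _.
  rewrite cf_sum; under eq_bigr => b _ do rewrite cfZ cf_xpow -!cf_ord.
  rewrite (sum_exps (fun k l => cf f a.1 a.2 * cf g k l * ('C(a.1 + k, a.1) * 'C(a.2 + l, a.2))%:R
     * [&& (i < N1)%N, (j < N2)%N & (Posz i, Posz j) == (Posz a.1 + Posz k, Posz a.2 + Posz l)]%:R)).
  over.
rewrite (sum_exps (fun a1 a2 => \sum_(k < N1) \sum_(l < N2) cf f a1 a2 * cf g k l * ('C(a1 + k, a1) * 'C(a2 + l, a2))%:R
     * [&& (i < N1)%N, (j < N2)%N & (Posz i, Posz j) == (Posz a1 + Posz k, Posz a2 + Posz l)]%:R)).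
rewrite lti ltj /=.
rewrite (big_ord_widen N1 (fun k => \sum_(l < j.+1)
       'C(i, k)%:R * 'C(j, l)%:R * cf f k l * cf g (i - k) (j - l))) // [RHS]big_mkcond /=.
apply: eq_bigr => a _.
rewrite (big_ord_widen N2 (fun l =>
       'C(i, a)%:R * 'C(j, l)%:R * cf f a l * cf g (i - a) (j - l))) // [in RHS]big_mkcond /=.
transitivity (\sum_(b < N2) if (a < i.+1)%N && (b < j.+1)%N then 'C(i, a)%:R * 'C(j, b)%:R * cf f a b * cf g (i - a) (j - b) else 0);
  last first.
  by case: ifP => _ /=; last rewrite big1.
apply: eq_bigr => b _.
case: ifP => [/andP[la lb]|out]; last first.
  rewrite big1 // => k _; rewrite big1 // => l _.
  suff /negbTE -> : (Posz i, Posz j) != (Posz a + Posz k, Posz b + Posz l) by rewrite mulr0.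
  by apply/negP => /eqP[]; lia.
transitivity (\sum_(k < N1) (\sum_(l < N2) (cf f a b * cf g k l * ('C(a + k, a) * 'C(b + l, b))%:R) * ((l : nat) == (j - b)%N)%:R) * ((k : nat) == (i - a)%N)%:R).
  apply: eq_bigr => k _; rewrite big_distrl /=; apply: eq_bigr => l _.
  rewrite -[RHS]mulrA -natrM mulnb; congr (_ * (nat_of_bool _)%:R).
  rewrite /eq_op /=; apply/idP/idP; rewrite -!(rwP andP) => *; repeat split; lia.
under eq_bigr => k _ do rewrite (sum_delta N2 (fun l => cf f a b * cf g k l * ('C(a + k, a) * 'C(b + l, b))%:R)).
rewrite (sum_delta N1 (fun k => if (j - b < N2)%N then cf f a b * cf g k (j - b) * ('C(a + k, a) * 'C(b + (j - b), b))%:R else 0)).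
have -> : (i - a < N1)%N by lia.
have -> : (j - b < N2)%N by lia.
rewrite !subnKC // natrM; ring.
Qed.

End DividedPowers.

(** Since [k * 'C(p ^ n, k) = p ^ n * 'C(p ^ n - 1, k - 1)], a binomial coefficient prime to [p]
    would force [p ^ n] to divide [k]. *)
Lemma prime_dvd_bin_pow p n k : prime p -> (0 < k < p ^ n)%N -> (p %| 'C(p ^ n, k))%N.
Proof.
move=> pr_p /andP[k_gt0 ltk]; apply: contraLR ltk => ndv; rewrite -leqNgt.
apply: dvdn_leq => //; have co : coprime (p ^ n) 'C(p ^ n, k).
  by rewrite coprimeXl // prime_coprime.
rewrite -(Gauss_dvdl _ co); case: k k_gt0 {ndv co} => // k _.
by rewrite -mul_bin_diag dvdn_mulr.
Qed.

(** Pascal's rule arranged as a Leibniz rule for binomial convolutions; it serves both the product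
    and the shear substitution. *)
Lemma sum_bin_shift (R : comPzRingType) (H : nat -> nat -> R) i :
  \sum_(k < i.+2) 'C(i.+1, k)%:R * H k (i.+1 - k)%N =
  \sum_(k < i.+1) 'C(i, k)%:R * H k.+1 (i - k)%N +
  \sum_(k < i.+1) 'C(i, k)%:R * H k (i - k).+1.
Proof.
rewrite big_ord_recl /=; under eq_bigr => k _ do
  rewrite /bump /= add1n binS natrD mulrDl subSS.
rewrite big_split /= addrA addrC; congr (_ + _).
transitivity (\sum_(k < i.+2) 'C(i, k)%:R * H k (i.+1 - k)%N).
  by rewrite [RHS]big_ord_recl /= !bin0.
rewrite big_ord_recr /= bin_small // mul0r addr0.
by apply: eq_bigr => k _; rewrite subSn // -ltnS.
Qed.

(** * Leibniz rules and ring axioms for divided powers *)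

Section Algebra.
Variables (F : fieldType) (n1 n2 : nat).
Hypothesis char5 : 5%N \in [pchar F].
Local Notation N1 := (5 ^ n1)%N.
Local Notation N2 := (5 ^ n2)%N.
Local Notation O := (O2 F n1 n2).

Lemma bin_pow_eq0 n k : (0 < k < 5 ^ n)%N -> 'C(5 ^ n, k)%:R = 0 :> F.
Proof.
by move=> ltk; apply/eqP; rewrite -(dvdn_pcharf char5) prime_dvd_bin_pow.
Qed.

(** The product before truncation. Index shifts are derivations of it in any characteristic, so
    characteristic 5 matters only at the truncation bound. *)
Definition conv (f g : nat -> nat -> F) i j : F :=
  \sum_(k < i.+1) \sum_(l < j.+1)
       'C(i, k)%:R * 'C(j, l)%:R * f k l * g (i - k)%N (j - l)%N.

Lemma conv_row f g i j : conv f g i j = \sum_(k < i.+1) 'C(i, k)%:R *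
  (\sum_(l < j.+1) 'C(j, l)%:R * f k l * g (i - k)%N (j - l)%N).
Proof.
apply: eq_bigr => k _; rewrite big_distrr; apply: eq_bigr => l _ /=; ring.
Qed.

Lemma conv_col f g i j : conv f g i j = \sum_(l < j.+1) 'C(j, l)%:R *
  (\sum_(k < i.+1) 'C(i, k)%:R * f k l * g (i - k)%N (j - l)%N).
Proof.
rewrite /conv exchange_big; apply: eq_bigr => k _ /=.
rewrite big_distrr; apply: eq_bigr => l _ /=; ring.
Qed.

Lemma convS1 f g i j : conv f g i.+1 j =
  conv (fun k => f k.+1) g i j + conv f (fun k => g k.+1) i j.
Proof.
by rewrite !conv_row (sum_bin_shift (fun k m =>
  \sum_(l < j.+1) 'C(j, l)%:R * f k l * g m (j - l)%N)).
Qed.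

Lemma convS2 f g i j : conv f g i j.+1 =
  conv (fun k l => f k l.+1) g i j + conv f (fun k l => g k l.+1) i j.
Proof.
by rewrite !conv_col (sum_bin_shift (fun l m =>
  \sum_(k < i.+1) 'C(i, k)%:R * f k l * g (i - k)%N m)).
Qed.

Lemma cf_omul_conv (f g : O) i j : cf (omul f g) i j =
  if (i < N1)%N && (j < N2)%N then conv (cf f) (cf g) i j else 0.
Proof. exact: cf_omul. Qed.

(** Just beyond the bound, the two extreme terms contain a coordinate with exponent [N1], which is
    0, and the others a binomial coefficient divisible by 5. *)
Lemma conv_bound1 (f g : O) j : conv (cf f) (cf g) N1 j = 0.
Proof.
rewrite /conv big1 // => k _; rewrite big1 // => l _.
have [->|k0] := eqVneq (k : nat) 0%N.
  by rewrite subn0 (cf_out g) ?mulr0 // negb_and ltnn.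
have [->|kN] := eqVneq (k : nat) N1.
  by rewrite (cf_out f) ?mulr0 ?mul0r // negb_and ltnn.
by rewrite bin_pow_eq0 ?mul0r // lt0n k0 ltn_neqAle kN -ltnS ltn_ord.
Qed.

Lemma conv_bound2 (f g : O) i : conv (cf f) (cf g) i N2 = 0.
Proof.
rewrite /conv big1 // => k _; rewrite big1 // => l _.
have [->|l0] := eqVneq (l : nat) 0%N.
  by rewrite subn0 (cf_out g) ?mulr0 // negb_and ltnn orbT.
have [->|lN] := eqVneq (l : nat) N2.
  by rewrite (cf_out f) ?mulr0 ?mul0r // negb_and ltnn orbT.
by rewrite (bin_pow_eq0 (k := l)) ?mulr0 ?mul0r // lt0n l0 ltn_neqAle lN -ltnS ltn_ord.
Qed.

Lemma eq_conv f f' g g' i j : f =2 f' -> g =2 g' -> conv f g i j = conv f' g' i j.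
Proof.
by move=> ef eg; apply: eq_bigr => k _; apply: eq_bigr => l _; rewrite ef eg.
Qed.

Lemma partial1_omul (f g : O) :
  partial1 (omul f g) = omul (partial1 f) g + omul f (partial1 g).
Proof.
apply: cf_ext => i j; rewrite cfD cf_partial1 !cf_omul_conv.
rewrite !(eq_conv i j (g' := cf g) (f' := fun k => cf f k.+1) (f := cf (partial1 f)) (g := cf g)) //;
  last by move=> k l; rewrite cf_partial1.
rewrite !(eq_conv i j (f' := cf f) (g' := fun k => cf g k.+1) (g := cf (partial1 g)) (f := cf f)) //;
  last by move=> k l; rewrite cf_partial1.
case: (ltnP j N2) => ltj; rewrite ?andbF ?addr0 // !andbT.
case: (ltnP i.+1 N1) => lti; first by rewrite (ltnW lti) convS1.
case: ltnP => lti'; last by rewrite addr0.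
(* In the last row the left side is 0 by truncation, and the right side is the coefficient just
   beyond the bound. *)
by rewrite -convS1; rewrite (_ : i.+1 = N1) ?conv_bound1 //; apply/eqP; rewrite eqn_leq lti lti'.
Qed.

Lemma partial2_omul (f g : O) :
  partial2 (omul f g) = omul (partial2 f) g + omul f (partial2 g).
Proof.
apply: cf_ext => i j; rewrite cfD cf_partial2 !cf_omul_conv.
rewrite !(eq_conv i j (g' := cf g) (f' := fun k l => cf f k l.+1) (f := cf (partial2 f)) (g := cf g)) //;
  last by move=> k l; rewrite cf_partial2.
rewrite !(eq_conv i j (f' := cf f) (g' := fun k l => cf g k l.+1) (g := cf (partial2 g)) (f := cf f)) //;
  last by move=> k l; rewrite cf_partial2.
case: (ltnP i N1) => lti; rewrite /= ?addr0 //.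
case: (ltnP j.+1 N2) => ltj; first by rewrite (ltnW ltj) convS2.
case: ltnP => ltj'; last by rewrite addr0.
by rewrite -convS2; rewrite (_ : j.+1 = N2) ?conv_bound2 //; apply/eqP; rewrite eqn_leq ltj ltj'.
Qed.

Lemma cf00_omul (f g : O) : cf (omul f g) 0 0 = cf f 0 0 * cf g 0 0.
Proof.
by rewrite cf_omul !expn_gt0 /= !big_ord1 bin0 !mul1r subn0.
Qed.

Lemma omulC (f g : O) : omul f g = omul g f.
Proof.
apply: cf_ext => i j; rewrite !cf_omul; case: ifP => // _.
rewrite (reindex_inj rev_ord_inj) /=; apply: eq_bigr => k _.
rewrite (reindex_inj rev_ord_inj) /=; apply: eq_bigr => l _.
have lek : (k <= i)%N by rewrite -ltnS.
have lel : (l <= j)%N by rewrite -ltnS.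
by rewrite !subSS !bin_sub // !subKn // -!mulrA; congr (_ * (_ * _)); rewrite mulrC.
Qed.

Lemma omulDl (f g h : O) : omul (f + g) h = omul f h + omul g h.
Proof.
apply: cf_ext => i j; rewrite cfD !cf_omul; case: ifP => _; last by rewrite addr0.
rewrite -big_split; apply: eq_bigr => k _ /=; rewrite -big_split.
by apply: eq_bigr => l _ /=; rewrite cfD; ring.
Qed.

Lemma omulZl c (f g : O) : omul (c *: f) g = c *: omul f g.
Proof.
apply: cf_ext => i j; rewrite cfZ !cf_omul; case: ifP => _; last by rewrite mulr0.
rewrite big_distrr; apply: eq_bigr => k _ /=; rewrite big_distrr.
by apply: eq_bigr => l _ /=; rewrite cfZ; ring.
Qed.

Lemma omulDr (f g h : O) : omul h (f + g) = omul h f + omul h g.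
Proof. by rewrite omulC omulDl !(omulC _ h). Qed.
Lemma omulZr c (f g : O) : omul f (c *: g) = c *: omul f g.
Proof. by rewrite omulC omulZl omulC. Qed.
Lemma omul0l (f : O) : omul 0 f = 0.
Proof. by have := omulZl 0 0 f; rewrite !scale0r. Qed.
Lemma omul0r (f : O) : omul f 0 = 0.
Proof. by rewrite omulC omul0l. Qed.
Lemma omulNl (f g : O) : omul (- f) g = - omul f g.
Proof. by rewrite -scaleN1r omulZl scaleN1r. Qed.
Lemma omulNr (f g : O) : omul f (- g) = - omul f g.
Proof. by rewrite omulC omulNl omulC. Qed.

Lemma partial1D (f g : O) : partial1 (f + g) = partial1 f + partial1 g.
Proof. by apply: cf_ext => i j; rewrite !(cfE, cf_partial1). Qed.
Lemma partial2D (f g : O) : partial2 (f + g) = partial2 f + partial2 g.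
Proof. by apply: cf_ext => i j; rewrite !(cfE, cf_partial2). Qed.
Lemma partial1Z c (f : O) : partial1 (c *: f) = c *: partial1 f.
Proof. by apply: cf_ext => i j; rewrite !(cfE, cf_partial1). Qed.
Lemma partial2Z c (f : O) : partial2 (c *: f) = c *: partial2 f.
Proof. by apply: cf_ext => i j; rewrite !(cfE, cf_partial2). Qed.
Lemma partial1N (f : O) : partial1 (- f) = - partial1 f.
Proof. by rewrite -scaleN1r partial1Z scaleN1r. Qed.
Lemma partial2N (f : O) : partial2 (- f) = - partial2 f.
Proof. by rewrite -scaleN1r partial2Z scaleN1r. Qed.
Lemma partial10 : partial1 (0 : O) = 0.
Proof. by have := partial1Z 0 0; rewrite !scale0r. Qed.
Lemma partial20 : partial2 (0 : O) = 0.
Proof. by have := partial2Z 0 0; rewrite !scale0r. Qed.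
Lemma partial12 (f : O) : partial1 (partial2 f) = partial2 (partial1 f).
Proof. by apply: cf_ext => i j; rewrite !(cf_partial1, cf_partial2). Qed.

(* Multiplicative identities are checked on all iterated derivatives at once: the
   coordinate at [(i, j)] is the constant term of [d_1^i d_2^j]. *)
Lemma omulA (f g h : O) : omul f (omul g h) = omul (omul f g) h.
Proof.
apply: cf_ext => i; elim: i f g h => [|i IH] f g h j; last first.
  by rewrite -!cf_partial1 !(partial1_omul, omulDl, omulDr) !cfD !IH addrA.
elim: j f g h => [|j IH] f g h; first by rewrite !cf00_omul mulrA.
by rewrite -!cf_partial2 !(partial2_omul, omulDl, omulDr) !cfD !IH addrA.
Qed.

Definition mon (i j : nat) : O := xpow F n1 n2 (Posz i, Posz j).

Lemma cf_mon a b i j : cf (mon a b) i j = [&& (i < N1)%N, (j < N2)%N, i == a & j == b]%:R.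
Proof. by rewrite cf_xpow. Qed.

Lemma partial1_mon i j : partial1 (mon i.+1 j) = if (i.+1 < N1)%N then mon i j else 0.
Proof.
apply: cf_ext => k l; rewrite cf_partial1; case: ltnP => h; rewrite ?cf0 !cf_mon; last first.
  by case: eqP => [[->]|]; rewrite ?andbF ?ltnNge ?h //.
rewrite eqSS; case: (eqVneq k i) => [->|]; rewrite /= ?andbF //.
by rewrite h (ltnW h).
Qed.

Lemma partial2_mon i j : partial2 (mon i j.+1) = if (j.+1 < N2)%N then mon i j else 0.
Proof.
apply: cf_ext => k l; rewrite cf_partial2; case: ltnP => h; rewrite ?cf0 !cf_mon; last first.
  by case: (l.+1 =P j.+1) => [[->]|]; rewrite ?andbF // (ltnNge j.+1) h andbF.
rewrite eqSS; case: (eqVneq l j) => [->|]; rewrite /= ?andbF //.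
by rewrite h (ltnW h).
Qed.

Lemma partial1_mon0 j : partial1 (mon 0 j) = 0.
Proof. by apply: cf_ext => k l; rewrite cf_partial1 cf_mon cf0 /= !andbF. Qed.
Lemma partial2_mon0 i : partial2 (mon i 0) = 0.
Proof. by apply: cf_ext => k l; rewrite cf_partial2 cf_mon cf0 !andbF. Qed.

Lemma omul1 (f : O) : omul (mon 0 0) f = f.
Proof.
apply: cf_ext => i; elim: i f => [|i IH] f j; last first.
  by rewrite -!cf_partial1 partial1_omul partial1_mon0 omul0l add0r IH.
elim: j f => [|j IH] f; first by rewrite cf00_omul cf_mon !expn_gt0 mul1r.
by rewrite -!cf_partial2 partial2_omul partial2_mon0 omul0l add0r IH.
Qed.

End Algebra.

(* The bracket formulas make sense over every commutative ring with two commuting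
   derivations, and define a Lie algebra as soon as 5 = 0. *)
Section DifferentialRing.
Variables (R : comPzRingType) (d1 d2 : R -> R).
Hypothesis five : 5%:R = 0 :> R.
Hypotheses (d1D : {morph d1 : x y / x + y}) (d2D : {morph d2 : x y / x + y}).
Hypothesis d1M : forall x y, d1 (x * y) = d1 x * y + x * d1 y.
Hypothesis d2M : forall x y, d2 (x * y) = d2 x * y + x * d2 y.
Hypothesis d12 : forall x, d1 (d2 x) = d2 (d1 x).

Let T : Type := (R * (R * R) * (R * R))%type.

Definition dr_act (D : R * R) (f : R) := D.1 * d1 f + D.2 * d2 f.
Definition dr_div (D : R * R) := d1 D.1 + d2 D.2.
Definition dr_br (u v : T) : T :=
  let: (f, D, E) := u in let: (g, D', E') := v in
  ((dr_act D g - (dr_div D * g) *+ 2) - (dr_act D' f - (dr_div D' * f) *+ 2)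
     + (E.1 * E'.2 - E.2 * E'.1),
   ((dr_act D D'.1 - dr_act D' D.1) + f * E'.1 - g * E.1,
    (dr_act D D'.2 - dr_act D' D.2) + f * E'.2 - g * E.2),
   ((dr_act D E'.1 - dr_act E' D.1 + (dr_div D * E'.1) *+ 2)
      - (dr_act D' E.1 - dr_act E D'.1 + (dr_div D' * E.1) *+ 2)
      + (g * d2 f - f * d2 g) *+ 2,
    (dr_act D E'.2 - dr_act E' D.2 + (dr_div D * E'.2) *+ 2)
      - (dr_act D' E.2 - dr_act E D'.2 + (dr_div D' * E.2) *+ 2)
      + (f * d1 g - g * d1 f) *+ 2)).
Definition dr_add (u v : T) : T :=
  (u.1.1 + v.1.1, (u.1.2.1 + v.1.2.1, u.1.2.2 + v.1.2.2), (u.2.1 + v.2.1, u.2.2 + v.2.2)).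

Let d1N x : d1 (- x) = - d1 x.
Proof.
have d10 : d1 0 = 0 by apply: (addrI (d1 0)); rewrite -d1D !addr0.
by apply: (addrI (d1 x)); rewrite -d1D !subrr.
Qed.
Let d2N x : d2 (- x) = - d2 x.
Proof.
have d20 : d2 0 = 0 by apply: (addrI (d2 0)); rewrite -d2D !addr0.
by apply: (addrI (d2 x)); rewrite -d2D !subrr.
Qed.
Let d1M2 x : d1 (x *+ 2) = d1 x *+ 2. Proof. by rewrite !mulr2n d1D. Qed.
Let d2M2 x : d2 (x *+ 2) = d2 x *+ 2. Proof. by rewrite !mulr2n d2D. Qed.

(** Each derivative of a sum is expanded in a small goal of its own, so that the derivation rules
    are never tried on the whole Jacobi expression. *)
Ltac expand := repeat match goal with |- context [?d (?x + ?y)] =>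
  (first [constr_eq d d1 | constr_eq d d2]);
  let h := fresh in eassert (h : d (x + y) = _);
  [rewrite !(d1D, d2D, d1N, d2N, d1M2, d2M2, d1M, d2M, d12); reflexivity
  | rewrite h; clear h] end.

(* Over the integers the Jacobi sum is 5 times the expressions displayed below. *)
Lemma dr_jacobi u v w :
  dr_add (dr_add (dr_br u (dr_br v w)) (dr_br v (dr_br w u))) (dr_br w (dr_br u v))
  = (0, (0, 0), (0, 0)).
Proof.
have z5 (x : R) : x *+ 5 = 0 by rewrite -mulr_natr five mulr0.
move: u v w => [[a0 [a1 a2]] [a3 a4]] [[b0 [b1 b2]] [b3 b4]] [[c0 [c1 c2]] [c3 c4]].
rewrite /dr_br /dr_add /dr_act /dr_div /=.
congr (_, (_, _), (_, _)); expand.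
- rewrite -[RHS](z5 (a0 * d2 b0 * c4 + a0 * d1 b0 * c3 - a0 * b3 * d1 c0 - a0 * b4 * d2 c0
    - d2 a0 * b0 * c4 + d2 a0 * b4 * c0 - d1 a0 * b0 * c3 + d1 a0 * b3 * c0
    - d1 a1 * b3 * c4 + d1 a1 * b4 * c3 - d2 a2 * b3 * c4 + d2 a2 * b4 * c3
    + a3 * b0 * d1 c0 - a3 * d1 b0 * c0 + a3 * d1 b1 * c4 + a3 * d2 b2 * c4
    - a3 * b4 * d1 c1 - a3 * b4 * d2 c2 + a4 * b0 * d2 c0 - a4 * d2 b0 * c0
    - a4 * d1 b1 * c3 - a4 * d2 b2 * c3 + a4 * b3 * d1 c1 + a4 * b3 * d2 c2)).
  ring.
- ring.
- ring.
- rewrite -[RHS](z5 (- (a0 * d2 b0 * d1 c1) *+ 2 - (a0 * d2 b0 * d2 c2) *+ 2 + (a0 * d1 b1 * d2 c0) *+ 2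
    + (a0 * d2 b2 * d2 c0) *+ 2 + (d2 a0 * b0 * d1 c1) *+ 2
    + (d2 a0 * b0 * d2 c2) *+ 2 - (d2 a0 * d1 b1 * c0) *+ 2
    - (d2 a0 * d2 b2 * c0) *+ 2 + d2 a0 * b3 * c4 - d2 a0 * b4 * c3
    - (d1 a1 * b0 * d2 c0) *+ 2 + (d1 a1 * d2 b0 * c0) *+ 2
    - (d2 a2 * b0 * d2 c0) *+ 2 + (d2 a2 * d2 b0 * c0) *+ 2 - a3 * d2 b0 * c4
    + a3 * b4 * d2 c0 + a4 * d2 b0 * c3 - a4 * b3 * d2 c0)).
  ring.
- rewrite -[RHS](z5 ((a0 * d1 b0 * d1 c1) *+ 2 + (a0 * d1 b0 * d2 c2) *+ 2 - (a0 * d1 b1 * d1 c0) *+ 2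
    - (a0 * d2 b2 * d1 c0) *+ 2 - (d1 a0 * b0 * d1 c1) *+ 2
    - (d1 a0 * b0 * d2 c2) *+ 2 + (d1 a0 * d1 b1 * c0) *+ 2
    + (d1 a0 * d2 b2 * c0) *+ 2 - d1 a0 * b3 * c4 + d1 a0 * b4 * c3
    + (d1 a1 * b0 * d1 c0) *+ 2 - (d1 a1 * d1 b0 * c0) *+ 2
    + (d2 a2 * b0 * d1 c0) *+ 2 - (d2 a2 * d1 b0 * c0) *+ 2 + a3 * d1 b0 * c4
    - a3 * b4 * d1 c0 - a4 * d1 b0 * c3 + a4 * b3 * d1 c0)).
  ring.
Qed.

Lemma dr_brC u v : dr_br v u = let w := dr_br u v in
  (- w.1.1, (- w.1.2.1, - w.1.2.2), (- w.2.1, - w.2.2)).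
Proof.
move: u v => [[a0 [a1 a2]] [a3 a4]] [[b0 [b1 b2]] [b3 b4]].
by rewrite /dr_br /dr_act /dr_div /=; congr (_, (_, _), (_, _)); ring.
Qed.

Lemma dr_brDl u v w : dr_br (dr_add u v) w = dr_add (dr_br u w) (dr_br v w).
Proof.
move: u v w => [[a0 [a1 a2]] [a3 a4]] [[b0 [b1 b2]] [b3 b4]] [[c0 [c1 c2]] [c3 c4]].
rewrite /dr_br /dr_add /dr_act /dr_div /= !(d1D, d2D).
by congr (_, (_, _), (_, _)); ring.
Qed.

Definition dr_scale (k : R) (u : T) : T :=
  (k * u.1.1, (k * u.1.2.1, k * u.1.2.2), (k * u.2.1, k * u.2.2)).

(** Field scalars will enter as constants of the differential ring, which gives linearity over the
    ground field. *)
Lemma dr_brZl k u v : d1 k = 0 -> d2 k = 0 -> dr_br (dr_scale k u) v = dr_scale k (dr_br u v).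
Proof.
move=> k1 k2; move: u v => [[a0 [a1 a2]] [a3 a4]] [[b0 [b1 b2]] [b3 b4]].
rewrite /dr_br /dr_scale /dr_act /dr_div /= !(d1M, d2M, k1, k2, mul0r, add0r).
by congr (_, (_, _), (_, _)); ring.
Qed.

End DifferentialRing.

(** * Transport of the bracket along changes of variables *)

Section Transport.
Variables (R S : comPzRingType) (d1 d2 : R -> R) (e1 e2 : S -> S) (h : R -> S).
Hypotheses (e1D : {morph e1 : x y / x + y}) (e2D : {morph e2 : x y / x + y}).
Hypotheses (e1N : {morph e1 : x / - x}) (e2N : {morph e2 : x / - x}).
Hypotheses (hD : {morph h : x y / x + y}) (hN : {morph h : x / - x}).
Hypothesis hM : {morph h : x y / x * y}.

Let hM2 x : h (x *+ 2) = h x *+ 2. Proof. by rewrite !mulr2n hD. Qed.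

Definition dr_swap (u : R * (R * R) * (R * R)) : S * (S * S) * (S * S) :=
  (- h u.1.1, (h u.1.2.2, h u.1.2.1), (- h u.2.2, - h u.2.1)).

Lemma dr_swap_br u v : (forall x, e1 (h x) = h (d2 x)) -> (forall x, e2 (h x) = h (d1 x)) ->
  dr_swap (dr_br d1 d2 u v) = dr_br e1 e2 (dr_swap u) (dr_swap v).
Proof.
move=> h1 h2; move: u v => [[f [p q]] [r s]] [[f' [p' q']] [r' s']].
rewrite /dr_br /dr_swap /dr_act /dr_div /=.
by congr (_, (_, _), (_, _)); rewrite !(e1N, e2N, h1, h2, hD, hN, hM, hM2); ring.
Qed.

(** If [e2 (h x) = h (d2 x) + k * h (d1 x)], the field [p d1 + q d2] is carried to
    [(h p - k h q) e1 + h q e2], whence the correction in the first slot. *)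
Definition dr_shear (k : S) (u : R * (R * R) * (R * R)) : S * (S * S) * (S * S) :=
  (h u.1.1, (h u.1.2.1 - k * h u.1.2.2, h u.1.2.2), (h u.2.1 - k * h u.2.2, h u.2.2)).

Lemma dr_shear_br k u v : (forall x, e1 (k * x) = k * e1 x) -> (forall x, e2 (k * x) = k * e2 x) ->
  (forall x, e1 (h x) = h (d1 x)) -> (forall x, e2 (h x) = h (d2 x) + k * h (d1 x)) ->
  dr_shear k (dr_br d1 d2 u v) = dr_br e1 e2 (dr_shear k u) (dr_shear k v).
Proof.
move=> k1 k2 h1 h2; move: u v => [[f [p q]] [r s]] [[f' [p' q']] [r' s']].
rewrite /dr_br /dr_shear /dr_act /dr_div /=.
by congr (_, (_, _), (_, _));
  rewrite !(e1D, e2D, e1N, e2N, k1, k2, h1, h2, hD, hN, hM, hM2); ring.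
Qed.

End Transport.

Lemma seq_min (r : seq int) d : d \in r -> exists2 m, m \in r & forall e, e \in r -> m <= e.
Proof.
elim: r d => // a [|b r] IH d _; first by exists a; rewrite ?mem_head // => e; rewrite inE => /eqP->.
have [m mr hm] := IH b (mem_head _ _).
case: (leP a m) => le; [exists a; rewrite ?mem_head|exists m; rewrite ?(in_cons a) ?mr ?orbT] => //.
  by move=> e /predU1P[->//|/hm]; apply: le_trans.
by move=> e /predU1P[->|/hm//]; apply: ltW.
Qed.

Lemma sum_pick (U : nmodType) (I : eqType) (s : seq I) (H : I -> U) e : uniq s ->
  (forall f, f != e -> H f = 0) -> (e \notin s -> H e = 0) -> \sum_(f <- s) H f = H e.
Proof.
move=> us z out; case: (boolP (e \in s)) => [m|/[dup] n /out->].
  by rewrite (bigD1_seq e) //= big1 ?addr0.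
by rewrite big_seq big1 // => f m; apply: z; apply: contraNneq n => <-.
Qed.

(** * Graded algebras, filtrations and leading terms *)

Section GradedAlgebra.
Variables (F : fieldType) (V : vectType F) (br : V -> V -> V).

Record bilinear_br : Prop := BilinearBr {
  brDl : forall x y z, br (x + y) z = br x z + br y z;
  brDr : forall x y z, br z (x + y) = br z x + br z y;
  brZl : forall c x y, br (c *: x) y = c *: br x y;
  brZr : forall c x y, br x (c *: y) = c *: br x y }.

(** The operation [op] is arbitrary so that the [G]-grading and the integer weight gradings obey the
    same lemmas; [s] is a finite list outside which the projections vanish. *)
Record grading_by (I : eqType) (op : I -> I -> I) (s : seq I) (P : I -> 'End(V)) :
    Prop := GradingBy {
  grad_uniq : uniq s;
  grad_out : forall g, g \notin s -> P g = 0;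
  grad_sum : forall x, \sum_(g <- s) P g x = x;
  grad_proj : forall g h x, P g (P h x) = if g == h then P h x else 0;
  grad_br : forall g h x y, P g x = x -> P h y = y -> P (op g h) (br x y) = br x y }.

Definition br_morph (u : 'End(V)) := forall x y, u (br x y) = br (u x) (u y).
(** The inverse is carried along as a linear map, because conjugates of projections are formed
    throughout. *)
Definition aut_pair (u u' : 'End(V)) : Prop :=
  [/\ cancel u u', cancel u' u & br_morph u].

Lemma aut_pair_inv u u' : aut_pair u u' -> aut_pair u' u.
Proof. by case=> c c' m; split=> // x y; apply: (can_inj c); rewrite m !c'. Qed.

Lemma aut_pair_comp u u' v v' :
  aut_pair u u' -> aut_pair v v' -> aut_pair (u \o v)%VF (v' \o u')%VF.
Proof.
move=> [c c' m] [k k' n]; split=> x.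
- by rewrite !comp_lfunE c k.
- by rewrite !comp_lfunE k' c'.
- by move=> y; rewrite !comp_lfunE n m.
Qed.

Lemma aut_pair1 : aut_pair \1 \1.
Proof. by split=> x; rewrite ?id_lfunE // => y; rewrite !id_lfunE. Qed.

Lemma aut_pairP u u' : aut_pair u u' -> is_automorphism br u.
Proof. by case=> c c' m; split=> //; exists u'. Qed.

Hypothesis hb : bilinear_br.

Lemma br0l x : br 0 x = 0.
Proof. by have := brZl hb 0 0 x; rewrite !scale0r. Qed.
Lemma br0r x : br x 0 = 0.
Proof. by have := brZr hb 0 x 0; rewrite !scale0r. Qed.
Lemma brNl x y : br (- x) y = - br x y.
Proof. by rewrite -scaleN1r (brZl hb) scaleN1r. Qed.
Lemma br_suml I (r : seq I) (Q : pred I) (f : I -> V) y :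
  br (\sum_(i <- r | Q i) f i) y = \sum_(i <- r | Q i) br (f i) y.
Proof. exact: (big_morph (fun x => br x y) (fun a b => brDl hb a b y) (br0l y)). Qed.
Lemma br_sumr I (r : seq I) (Q : pred I) (f : I -> V) x :
  br x (\sum_(i <- r | Q i) f i) = \sum_(i <- r | Q i) br x (f i).
Proof. exact: (big_morph (br x) (fun a b => brDr hb a b x) (br0r x)). Qed.

Section Grading.
Variables (I : eqType) (op : I -> I -> I) (s : seq I) (P : I -> 'End(V)).
Hypothesis gr : grading_by op s P.

Lemma grad_id g x : P g (P g x) = P g x.
Proof. by rewrite (grad_proj gr) eqxx. Qed.

Lemma grad_other g h x : g != h -> P h x = x -> P g x = 0.
Proof. by move=> /negbTE ne <-; rewrite (grad_proj gr) ne. Qed.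

Lemma grad_mem g x : P g x != 0 -> g \in s.
Proof. by apply: contraNT => out; rewrite (grad_out gr out) zero_lfunE. Qed.

Lemma grad_eq0 x : (forall g, P g x = 0) -> x = 0.
Proof. by move=> h; rewrite -[x](grad_sum gr) big1. Qed.

Lemma grad_eq x y : (forall g, P g x = P g y) -> x = y.
Proof.
by move=> e; apply/eqP; rewrite -subr_eq0; apply/eqP/grad_eq0 => g; rewrite linearB /= e subrr.
Qed.

Lemma lfun_grad_ext (u v : 'End(V)) :
  (forall g x, P g x = x -> u x = v x) -> u = v.
Proof.
move=> e; apply/lfunP => x; rewrite -[x](grad_sum gr) !linear_sum.
by apply: eq_bigr => g _; apply: (e g); apply: grad_id.
Qed.

Lemma br_morph_grad (u : 'End(V)) :
  (forall g h x y, P g x = x -> P h y = y -> u (br x y) = br (u x) (u y)) -> br_morph u.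
Proof.
move=> e x y; rewrite -[x](grad_sum gr) -[y](grad_sum gr).
rewrite br_suml !linear_sum br_suml; apply: eq_bigr => g _.
rewrite br_sumr !linear_sum br_sumr; apply: eq_bigr => h _.
by apply: (e g h); apply: grad_id.
Qed.

Lemma grad_conj u u' : aut_pair u u' ->
  grading_by op s (fun g => (u \o P g \o u')%VF).
Proof.
move=> [c c' m]; have m' : br_morph u' by case: (aut_pair_inv (And3 c c' m)).
split; first exact: (grad_uniq gr).
- by move=> g out; rewrite (grad_out gr out) comp_lfun0r comp_lfun0l.
- move=> x; under eq_bigr => g _ do rewrite !comp_lfunE.
  by rewrite -(linear_sum u) (grad_sum gr) /= c'.
- move=> g h x; rewrite !comp_lfunE c (grad_proj gr).
  by case: ifP => // _; rewrite linear0.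
- move=> g h x y; rewrite !comp_lfunE => ex ey.
  have ex' : P g (u' x) = u' x by rewrite -[in RHS]ex c.
  have ey' : P h (u' y) = u' y by rewrite -[in RHS]ey c.
  by rewrite m' (grad_br gr ex' ey') m !c'.
Qed.

End Grading.

Section IntGrading.
Variables (ds : seq int) (pi : int -> 'End(V)).
Hypothesis zg : grading_by +%R ds pi.

Definition fil (v : int) (x : V) : Prop := forall d, d < v -> pi d x = 0.

Lemma fil_le v w x : v <= w -> fil w x -> fil v x.
Proof. by move=> le h d lt; apply: h; apply: lt_le_trans le. Qed.
Lemma filD v x y : fil v x -> fil v y -> fil v (x + y).
Proof. by move=> hx hy d lt; rewrite linearD /= hx ?hy ?addr0. Qed.
Lemma filZ v c x : fil v x -> fil v (c *: x).
Proof. by move=> hx d lt; rewrite linearZ /= hx ?scaler0. Qed.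
Lemma fil0 v : fil v 0.
Proof. by move=> d _; rewrite linear0. Qed.
Lemma fil_sum v J (r : seq J) (Q : pred J) (f : J -> V) :
  (forall j, Q j -> fil v (f j)) -> fil v (\sum_(j <- r | Q j) f j).
Proof. by move=> h; elim/big_rec: _ => [|j x Qj]; [apply: fil0|apply: filD; apply: h]. Qed.
Lemma fil_hom d v x : pi d x = x -> v <= d -> fil v x.
Proof.
by move=> ex le e lt; apply: (grad_other zg _ ex); rewrite lt_eqF // (lt_le_trans lt).
Qed.

Lemma grad_brs d x y : pi d (br x y) = \sum_(e <- ds) pi d (br (pi e x) (pi (d - e) y)).
Proof.
rewrite -{1}[x](grad_sum zg) br_suml linear_sum; apply: eq_bigr => e _.
rewrite -{1}[y](grad_sum zg) br_sumr linear_sum /=.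
have z f : f != d - e -> pi d (br (pi e x) (pi f y)) = 0.
  move=> ne; apply: (grad_other zg (h := e + f)).
    by apply: contra ne => /eqP->; rewrite addrAC subrr add0r.
  by apply: (grad_br zg); apply: (grad_id zg).
apply: (sum_pick (grad_uniq zg)) => // out.
by rewrite (grad_out zg out) zero_lfunE br0r linear0.
Qed.

Lemma fil_br v w x y : fil v x -> fil w y -> fil (v + w) (br x y).
Proof.
move=> hx hy d lt; rewrite grad_brs big1 // => e _.
case: (ltP e v) => [/hx->|le]; first by rewrite br0l linear0.
by rewrite hy ?br0r ?linear0 //; move: lt le; lia.
Qed.

Lemma lead_br v w x y : fil v x -> fil w y ->
  pi (v + w) (br x y) = br (pi v x) (pi w y).
Proof.
move=> hx hy; rewrite grad_brs.
have e' : v + w - v = w by rewrite addrAC subrr add0r.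
have z e : e != v -> pi (v + w) (br (pi e x) (pi (v + w - e) y)) = 0.
  move=> ne; case: (ltP e v) => [/hx->|le]; first by rewrite br0l linear0.
  by rewrite hy ?br0r ?linear0 //; move: le ne; lia.
rewrite (sum_pick (grad_uniq zg) (e := v)) // ?e'.
  by rewrite (grad_br zg) // (grad_id zg).
by move=> out; rewrite (grad_out zg out) zero_lfunE br0l linear0.
Qed.

Lemma lead_exists x : x != 0 -> exists v, fil v x /\ pi v x != 0.
Proof.
move=> nz; have [d nd] : exists d, pi d x != 0.
  have /hasP[d _ nd] : has (fun d => pi d x != 0) ds; last by exists d.
  apply: contraNT nz => /hasPn h; apply/eqP/(grad_eq0 zg) => d.
  case: (boolP (d \in ds)) => [/h/negPn/eqP//|/(grad_out zg)->].
  by rewrite zero_lfunE.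
have : d \in [seq e <- ds | pi e x != 0] by rewrite mem_filter nd (grad_mem zg nd).
case/seq_min => m; rewrite mem_filter => /andP[nm _] hm.
exists m; split=> // e lt; apply/eqP; apply: contraTT lt => ne.
by rewrite -leNgt hm // mem_filter ne (grad_mem zg ne).
Qed.

End IntGrading.
End GradedAlgebra.

(** * Characters with values in the field *)

Section Characters.
Variables (F : fieldType) (G : groupType).

Definition is_char (chi : G -> F) : Prop :=
  chi 1%g = 1 /\ forall g h, chi (g * h)%g = chi g * chi h.

Lemma char_neq0 chi g : is_char chi -> chi g != 0.
Proof.
move=> [c1 cM]; apply: contraTneq (oner_neq0 F) => e.
by rewrite negbK -c1 -(mulgV g) cM e mul0r.
Qed.

Lemma charV chi g : is_char chi -> chi (g^-1)%g = (chi g)^-1.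
Proof.
move=> hc; have [c1 cM] := hc; apply: (mulfI (char_neq0 g hc)).
by rewrite -cM mulgV c1 divff ?char_neq0.
Qed.

Lemma char1 : is_char (fun => 1). Proof. by split=> // g h; rewrite mulr1. Qed.
Lemma charM chi psi : is_char chi -> is_char psi -> is_char (fun g => chi g * psi g).
Proof.
by move=> [c1 cM] [p1 pM]; split=> [|g h]; rewrite ?c1 ?p1 ?mulr1 // cM pM mulrACA.
Qed.
Definition inv_char (chi : G -> F) g := (chi g)^-1.

Definition chars_separate := forall k : G, k != 1%g -> exists chi, is_char chi /\ chi k != 1.

(** Dedekind's independence argument. For [psi] with [psi k != psi k0], the sum for [chi * psi]
    minus [psi k0] times the sum for [chi] has no term at [k0], and its term at [k] is multiplied by
    the nonzero scalar [psi k - psi k0]. [U] is a mere predicate since it will be applied to leading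
    terms of automorphisms. *)
Lemma char_split (M : lmodType F) (U : M -> Prop) (K : seq G) (v : G -> M) :
  chars_separate ->
  U 0 -> (forall x y, U x -> U y -> U (x + y)) -> (forall c x, U x -> U (c *: x)) ->
  uniq K -> (forall chi, is_char chi -> U (\sum_(k <- K) chi k *: v k)) ->
  forall k, k \in K -> U (v k).
Proof.
move=> sep U0 UD UZ; elim: K v => // k0 K IH v /andP[k0K uK] hU.
have hK k : k \in K -> U (v k).
  move=> kK; have ne : k != k0 by apply: contraNneq k0K => <-.
  have [|psi [hp pne]] := sep (k * k0^-1)%g.
    by apply: contra ne => /eqP e; rewrite -(mul1g k0) -e mulgVK.
  have [p1 pM] := hp.
  have pn : psi k - psi k0 != 0.
    apply: contra pne; rewrite subr_eq0 pM charV // => /eqP->.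
    by rewrite divff ?char_neq0.
    rewrite -[v k]scale1r -(mulVf pn) -scalerA; apply: (UZ).
  apply: (IH (fun k => (psi k - psi k0) *: v k)) => // chi hc.
  have h1 := hU _ (charM hc hp); have h2 := UZ (- psi k0) _ (hU _ hc).
  have := UD _ _ h1 h2; rewrite scaler_sumr -big_split /= big_cons /=.
  rewrite !scalerA mulNr [psi k0 * _]mulrC -scalerDl subrr scale0r add0r.
  congr U; apply: eq_bigr => j _; rewrite !scalerA -scalerDl; congr (_ *: _); ring.
move=> k; rewrite inE => /predU1P[->|]; last exact: (hK).
have := hU _ char1; rewrite big_cons scale1r => h.
rewrite -[v k0](addrK (\sum_(j <- K) 1 *: v j)); apply: (UD) => //.
rewrite -scaleN1r; apply: (UZ); rewrite big_seq.
by elim/big_rec: _ => // j x jK Ux; apply: (UD) => //; rewrite scale1r; apply: (hK).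
Qed.

End Characters.

(** * Conjugating a filtered grading into a homogeneous one *)

Section Cohomology.
Variables (F : closedFieldType) (V : vectType F) (br : V -> V -> V).
Hypothesis hb : bilinear_br br.
Variables (ds : seq int) (pi : int -> 'End(V)).
Hypothesis zg : grading_by br +%R ds pi.

(** [comp j T] is the part of [T] that raises degrees by [j]; the lock keeps unification from
    unfolding the sum. *)
Fact comp_key : unit. Proof. exact: tt. Qed.
Definition comp (j : int) (T : 'End(V)) : 'End(V) :=
  locked_with comp_key (\sum_(d <- ds) (pi (d + j) \o (T \o pi d))%VF).

Lemma comp_hom j T d x : pi d x = x -> comp j T x = pi (d + j) (T x).
Proof.
move=> ex; rewrite /comp locked_withE sum_lfunE (sum_pick (grad_uniq zg) (e := d)).
- by rewrite !comp_lfunE ex.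
- by move=> f ne; rewrite !comp_lfunE (grad_other zg ne ex) !linear0.
- by move=> out; rewrite !comp_lfunE (grad_out zg out) zero_lfunE !linear0.
Qed.

Lemma comp_deg j T d x : pi d x = x -> pi (d + j) (comp j T x) = comp j T x.
Proof. by move=> ex; rewrite (comp_hom _ _ ex) (grad_id zg). Qed.

Lemma compZ j c T : comp j (c *: T) = c *: comp j T.
Proof.
apply: (lfun_grad_ext zg) => d x ex.
by rewrite scale_lfunE !(comp_hom _ _ ex) scale_lfunE linearZ.
Qed.

Lemma comp_sum j K (r : seq K) (T : K -> 'End(V)) :
  comp j (\sum_(k <- r) T k) = \sum_(k <- r) comp j (T k).
Proof.
apply: (lfun_grad_ext zg) => d x ex.
rewrite [RHS]sum_lfunE (comp_hom _ _ ex) sum_lfunE linear_sum.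
by apply: eq_bigr => k _; rewrite (comp_hom _ _ ex).
Qed.

(* [T] preserves the filtration and has no component of degree [1, ..., i - 1]. *)
Definition sparse (i : int) (T : 'End(V)) : Prop :=
  forall d x e, pi d x = x -> e < d + i -> e != d -> pi e (T x) = 0.

Definition homog (T : 'End(V)) : Prop := forall d x, pi d x = x -> pi d (T x) = T x.

Lemma homog_sparse i T : homog T -> sparse i T.
Proof. by move=> h d x e ex _ ne; apply: (grad_other zg ne); apply: h. Qed.
Lemma homog_comp0 T : homog T -> comp 0 T = T.
Proof.
by move=> h; apply: (lfun_grad_ext zg) => d x ex; rewrite (comp_hom _ _ ex) addr0 h.
Qed.
Lemma homog_compi i T : 0 < i -> homog T -> comp i T = 0.
Proof.
move=> i0 h; apply: (lfun_grad_ext zg) => d x ex; rewrite (comp_hom _ _ ex) zero_lfunE.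
by apply: (grad_other zg (h := d)); [lia|apply: h].
Qed.
Lemma comp0_homog T : homog (comp 0 T).
Proof. by move=> d x ex; have := comp_deg 0 T ex; rewrite addr0. Qed.
Lemma homog1 : homog \1. Proof. by move=> d x; rewrite id_lfunE. Qed.
Lemma homog_mul S T : homog S -> homog T -> homog (S \o T)%VF.
Proof. by move=> hS hT d x ex; rewrite comp_lfunE; apply/hS/hT. Qed.

Lemma sparse_sum i K (r : seq K) (T : K -> 'End(V)) :
  (forall k, sparse i (T k)) -> sparse i (\sum_(k <- r) T k).
Proof.
move=> h d x e ex lt ne; rewrite sum_lfunE linear_sum big1 // => k _.
exact: (h k d x e).
Qed.
Lemma sparseZ i c T : sparse i T -> sparse i (c *: T).
Proof. by move=> h d x e ex lt ne; rewrite scale_lfunE linearZ /= (h d) ?scaler0. Qed.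

Lemma sparseS i T : sparse i T -> comp i T = 0 -> sparse (i + 1) T.
Proof.
move=> h c d x e ex lt ne; case: (eqVneq e (d + i)) => [->|ne'].
  by rewrite -(comp_hom _ _ ex) c zero_lfunE.
by apply: (h d) => //; move: lt ne'; lia.
Qed.

Section Level.
Variable i : int.
Hypothesis i_gt0 : 0 < i.

Lemma sparse_fil T v x : sparse i T -> fil pi v x -> fil pi v (T x).
Proof.
move=> h hx; rewrite -[x](grad_sum zg) linear_sum; apply: fil_sum => d _.
case: (ltP d v) => [/hx->|le]; first by rewrite linear0; apply: fil0.
by move=> e lt; apply: (h d); rewrite ?(grad_id zg) //; move: lt le i_gt0; lia.
Qed.

Lemma sparse_dec T d x : sparse i T -> pi d x = x -> exists2 r,
  fil pi (d + i + 1) r & T x = comp 0 T x + comp i T x + r.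
Proof.
move=> h ex; exists (T x - (comp 0 T x + comp i T x)); last by rewrite addrC subrK.
move=> e lt; rewrite !(comp_hom _ _ ex) linearB linearD /= !(grad_proj zg) addr0.
case: (eqVneq e d) => [->|ne].
  by rewrite (_ : d == d + i = false) ?addr0 ?subrr //; move: i_gt0; lia.
case: (eqVneq e (d + i)) => [->|ne']; first by rewrite add0r subrr.
by rewrite addr0 subr0 (h d) //; move: lt ne'; lia.
Qed.

(** Maps in [sparse i] multiply like [a + b t] with [t ^ 2 = 0]: the product of two parts of degree
    [i] has degree [2 i > i]. *)
Lemma comp_mul S T : sparse i S -> sparse i T ->
  [/\ sparse i (S \o T)%VF, comp 0 (S \o T)%VF = (comp 0 S \o comp 0 T)%VF
    & comp i (S \o T)%VF = (comp i S \o comp 0 T)%VF + (comp 0 S \o comp i T)%VF].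
Proof.
move=> hS hT.
have key d x e : pi d x = x -> e < d + i + 1 ->
    pi e ((S \o T)%VF x) = pi e (S (comp 0 T x)) + pi e (S (comp i T x)).
  move=> ex lt; have [r hr eT] := sparse_dec hT ex.
  rewrite comp_lfunE eT !linearD /= [X in _ + X](_ : _ = 0) ?addr0 //.
  exact: (sparse_fil hS hr).
have h0 d x : pi d x = x -> pi d (comp 0 T x) = comp 0 T x.
  by move=> ex; have := comp_deg 0 T ex; rewrite addr0.
have hi d x : pi d x = x -> pi (d + i) (comp i T x) = comp i T x by exact: comp_deg.
have low d x e : pi d x = x -> e < d + i -> pi e (S (comp i T x)) = 0.
  move=> ex lt; apply: (hS (d + i)); first exact: hi.
    by move: lt i_gt0; lia.
  by move: lt; lia.
split.
- move=> d x e ex lt ne; rewrite (key d) // ?(low d) //; last by move: lt; lia.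
  by rewrite (hS d) ?addr0 //; apply: h0.
- apply: (lfun_grad_ext zg) => d x ex; rewrite (comp_hom _ _ ex) addr0.
  rewrite (key d) // ?(low d) // ?comp_lfunE; try by move: i_gt0; lia.
  by rewrite (comp_hom 0 S (h0 _ _ ex)) !addr0.
- apply: (lfun_grad_ext zg) => d x ex; rewrite (comp_hom _ _ ex).
  rewrite (key d) // ?add_lfunE ?comp_lfunE; last by lia.
  by rewrite (comp_hom i S (h0 _ _ ex)) (comp_hom 0 S (hi _ _ ex)) addr0.
Qed.

(** The degree 0 part is the map induced on the associated graded algebra, which is the algebra
    itself. *)
Lemma comp0_morph q : sparse i q -> br_morph br q -> br_morph br (comp 0 q).
Proof.
move=> hq m; apply: (br_morph_grad hb zg) => d e x y ex ey.
have fq f z : pi f z = z -> fil pi f (q z).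
  by move=> ez; apply: (sparse_fil hq); apply: (fil_hom zg ez).
rewrite (comp_hom _ _ ex) (comp_hom _ _ ey) (comp_hom _ _ (grad_br zg ex ey)).
by rewrite !addr0 m (lead_br hb zg) //; apply: fq.
Qed.

Lemma comp0_aut q q' : sparse i q -> sparse i q' -> aut_pair br q q' ->
  aut_pair br (comp 0 q) (comp 0 q').
Proof.
move=> hq hq' [c c' m].
have e1 : (q' \o q)%VF = \1%VF by apply/lfunP => x; rewrite comp_lfunE c id_lfunE.
have e2 : (q \o q')%VF = \1%VF by apply/lfunP => x; rewrite comp_lfunE c' id_lfunE.
have [_ f1 _] := comp_mul hq' hq; have [_ f2 _] := comp_mul hq hq'.
split; last exact: comp0_morph.
  by move=> x; rewrite -comp_lfunE -f1 e1 (homog_comp0 homog1) id_lfunE.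
by move=> x; rewrite -comp_lfunE -f2 e2 (homog_comp0 homog1) id_lfunE.
Qed.

(* Leading terms of the automorphisms that are trivial modulo degree [i]. *)
Definition lead (delta : 'End(V)) : Prop := exists u u',
  aut_pair br u u' /\ [/\ sparse i u, sparse i u', comp 0 u = \1%VF, comp 0 u' = \1%VF
    & comp i u = delta].

Lemma lead0 : lead 0.
Proof.
have h1 := homog1.
exists \1%VF, \1%VF; split; first exact: aut_pair1.
by split; rewrite ?homog_comp0 ?homog_compi //; apply: homog_sparse.
Qed.

Lemma leadD a b : lead a -> lead b -> lead (a + b).
Proof.
move=> [u [u' [pu [su su' u0 u0' <-]]]] [v [v' [pv [sv sv' v0 v0' <-]]]].
exists (u \o v)%VF, (v' \o u')%VF; split; first exact: aut_pair_comp.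
have [s1 c1 d1] := comp_mul su sv; have [s2 c2 d2] := comp_mul sv' su'.
by split; rewrite // ?c1 ?c2 ?d1 ?u0 ?v0 ?u0' ?v0' ?comp_lfun1l ?comp_lfun1r.
Qed.

(** Since [u] is trivial in degree 0, the parts of [q] and [q'] of degree [i] contribute exactly the
    degree [i] part of [q q' = 1], which is 0. *)
Lemma lead_conj q q' a : aut_pair br q q' -> sparse i q -> sparse i q' -> lead a ->
  lead (comp 0 q \o a \o comp 0 q')%VF.
Proof.
move=> pq sq sq' [u [u' [pu [su su' u0 u0' <-]]]].
have [c c' m] := pq.
have qq' : (q \o q')%VF = \1%VF by apply/lfunP => x; rewrite comp_lfunE c' id_lfunE.
have [s1 c1 d1] := comp_mul sq su; have [s2 c2 d2] := comp_mul s1 sq'.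
have [s3 c3 d3] := comp_mul su' sq'; have [s4 c4 d4] := comp_mul sq s3.
have [_ c5 d5] := comp_mul sq sq'.
have [h0 hi] := (homog_comp0 homog1, homog_compi i_gt0 homog1).
exists (q \o u \o q')%VF, (q \o (u' \o q'))%VF; split.
  by apply: aut_pair_comp; [apply: aut_pair_comp|apply: aut_pair_inv].
split=> //.
- by rewrite c2 c1 u0 comp_lfun1r -c5 qq' h0.
- by rewrite c4 c3 u0' comp_lfun1l -c5 qq' h0.
rewrite d2 d1 c1 u0 !comp_lfun1r comp_lfunDl addrAC -[RHS]add0r; congr (_ + _).
by rewrite -d5 qq' hi.
Qed.

Definition torus (t : F) : 'End(V) := \sum_(d <- ds) (t ^ d) *: pi d.

Lemma torus_hom t d x : pi d x = x -> torus t x = (t ^ d) *: x.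
Proof.
move=> ex; rewrite sum_lfunE (sum_pick (grad_uniq zg) (e := d)).
- by rewrite scale_lfunE ex.
- by move=> f ne; rewrite scale_lfunE (grad_other zg ne ex) scaler0.
- by move=> out; rewrite (grad_out zg out) scaler0 zero_lfunE.
Qed.

Lemma torus_homog t : homog (torus t).
Proof. by move=> d x ex; rewrite (torus_hom _ ex) linearZ /= ex. Qed.

Lemma torus_aut t : t != 0 -> aut_pair br (torus t) (torus t^-1).
Proof.
have can a : a != 0 -> cancel (torus a) (torus a^-1).
  move=> nz x; suff -> : torus a^-1 (torus a x) = (\1%VF : 'End(V)) x by rewrite id_lfunE.
  rewrite -comp_lfunE; congr (fun_of_lfun _ x); apply: (lfun_grad_ext zg) => d {}x ex.
  rewrite comp_lfunE (torus_hom _ ex) linearZ /= (torus_hom _ ex) scalerA id_lfunE.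
  by rewrite exprz_inv -expfzDr // subrr expr0z scale1r.
move=> nz; split; first exact: can.
  by rewrite -{2}[t]invrK; apply: can; rewrite invr_eq0.
apply: (br_morph_grad hb zg) => d e x y ex ey.
rewrite (torus_hom _ (grad_br zg ex ey)) (torus_hom _ ex) (torus_hom _ ey).
by rewrite (brZl hb) (brZr hb) scalerA expfzDr.
Qed.

(** Conjugation by the torus element [t] multiplies a map of degree [i] by [t ^ i], and [t ^ i = c]
    is solvable because [F] is algebraically closed and [i > 0]. *)
Lemma leadZ c a : lead a -> lead (c *: a).
Proof.
move=> la; have [->|c0] := eqVneq c 0; first by rewrite scale0r; apply: lead0.
have [t et] : exists t : F, t ^ i = c.
  case: i i_gt0 => // -[|n] // _.
  have : exists t : F, root ('X^(n.+1) - c%:P) t.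
    by apply: closed_rootP; rewrite size_XnsubC.
  by case=> t /rootP; rewrite !hornerE => /eqP; rewrite subr_eq0 => /eqP; exists t.
have t0 : t != 0 by apply: contraNneq c0 => e; rewrite -et e exp0rz gt_eqF.
have pt := torus_aut t0.
have := lead_conj pt (homog_sparse (i := i) (@torus_homog t)) (homog_sparse (i := i) (@torus_homog t^-1)) la.
congr lead; rewrite !homog_comp0 //; try exact: torus_homog.
have [u [u' [_ [_ _ _ _ ea]]]] := la.
apply: (lfun_grad_ext zg) => d x ex.
rewrite !comp_lfunE (torus_hom _ ex) !linearZ /= scale_lfunE.
have -> : torus t (a x) = t ^ (d + i) *: a x by apply: torus_hom; rewrite -ea; apply: comp_deg.
by rewrite scalerA exprz_inv -expfzDr // addrA addNr add0r et.
Qed.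

Section Diagonalizable.
Variable G : groupType.
Hypothesis sep : chars_separate F G.
Variables (s : seq G) (P : G -> 'End(V)).
Hypothesis gr : grading_by br (fun g h => (g * h)%g) s P.

Definition qchar (chi : G -> F) : 'End(V) := \sum_(g <- s) chi g *: P g.

Lemma qchar_hom chi g x : P g x = x -> qchar chi x = chi g *: x.
Proof.
move=> ex; rewrite sum_lfunE (sum_pick (grad_uniq gr) (e := g)).
- by rewrite scale_lfunE ex.
- by move=> f ne; rewrite scale_lfunE (grad_other gr ne ex) scaler0.
- by move=> out; rewrite (grad_out gr out) scaler0 zero_lfunE.
Qed.

Lemma qchar_aut chi : is_char chi -> aut_pair br (qchar chi) (qchar (inv_char chi)).
Proof.
have can a b : (forall g, a g * b g = 1) -> cancel (qchar a) (qchar b).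
  move=> ab x; suff -> : qchar b (qchar a x) = (\1%VF : 'End(V)) x by rewrite id_lfunE.
  rewrite -comp_lfunE; congr (fun_of_lfun _ x); apply: (lfun_grad_ext gr) => g {}x ex.
  rewrite comp_lfunE (qchar_hom _ ex) linearZ /= (qchar_hom _ ex) scalerA id_lfunE.
  by rewrite ab scale1r.
move=> hc; split; try by apply: can => g; rewrite /inv_char ?mulVf ?divff ?char_neq0.
apply: (br_morph_grad hb gr) => d e x y ex ey; have [c1 cM] := hc.
rewrite (qchar_hom _ (grad_br gr ex ey)) (qchar_hom _ ex) (qchar_hom _ ey).
by rewrite (brZl hb) (brZr hb) scalerA cM.
Qed.

Hypothesis sp : forall g, sparse i (P g).

Lemma qchar_sparse chi : sparse i (qchar chi).
Proof. by apply: sparse_sum => g; apply: sparseZ. Qed.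

Lemma qchar_comp j chi : comp j (qchar chi) = \sum_(g <- s) chi g *: comp j (P g).
Proof. by rewrite comp_sum; apply: eq_bigr => g _; rewrite compZ. Qed.

Let P0 g := comp 0 (P g).
Let p g := comp i (P g).

Let P0P0 g h x : P0 g (P0 h x) = if g == h then P0 h x else 0.
Proof.
have [_ e _] := comp_mul (sp g) (sp h); rewrite -comp_lfunE -e.
have -> : (P g \o P h)%VF = if g == h then P h else 0.
  by apply/lfunP => y; rewrite comp_lfunE (grad_proj gr); case: ifP; rewrite ?zero_lfunE.
by case: ifP => // _; rewrite -(scale0r 0) compZ scale0r zero_lfunE.
Qed.

(** The degree [i] part of the relations [P g P h = 0] for [g != h] and [P g P g = P g], that is,
    the orthogonality relations to first order. *)
Let pP0 g h x : p g (P0 h x) + P0 g (p h x) = if g == h then p h x else 0.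
Proof.
have [_ _ e] := comp_mul (sp g) (sp h); rewrite -!comp_lfunE -add_lfunE -e.
have -> : (P g \o P h)%VF = if g == h then P h else 0.
  by apply/lfunP => y; rewrite comp_lfunE (grad_proj gr); case: ifP; rewrite ?zero_lfunE.
by case: ifP => // _; rewrite -(scale0r 0) compZ scale0r zero_lfunE.
Qed.

Let sumP : \sum_(g <- s) P g = \1%VF.
Proof. by apply/lfunP => x; rewrite sum_lfunE (grad_sum gr) id_lfunE. Qed.

Let sumP0 x : \sum_(g <- s) P0 g x = x.
Proof. by rewrite -sum_lfunE -comp_sum sumP (homog_comp0 homog1) id_lfunE. Qed.

Let P0out g x : g \notin s -> P0 g x = 0.
Proof.
move=> out; rewrite /P0 (grad_out gr out) -(scale0r 0) compZ scale0r.
by rewrite zero_lfunE.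
Qed.

Let E a b : 'End(V) := (P0 a \o (p b \o P0 b))%VF.

Let E_diag a : E a a = 0.
Proof.
apply/lfunP => x; rewrite !comp_lfunE zero_lfunE.
have := pP0 a a (P0 a x); rewrite eqxx P0P0 eqxx => /(canRL (addKr _)).
by rewrite addNr.
Qed.

(** To first order, moving a system of orthogonal projections changes only the two projections
    attached to a block, with opposite signs. *)
Let P0pP0 a g b x : P0 a (p g (P0 b x)) =
  (if g == b then E a b x else 0) - (if g == a then E a b x else 0).
Proof.
rewrite !comp_lfunE; have [->|ne] := eqVneq g b.
  case: eqVneq => [->|_]; last by rewrite subr0.
  by have := E_diag a => /lfunP/(_ x); rewrite !comp_lfunE zero_lfunE => ->; rewrite subr0.
rewrite sub0r; have := pP0 g b (P0 b x); rewrite (negbTE ne) P0P0 eqxx => /eqP.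
rewrite addr_eq0 => /eqP->; rewrite linearN /= P0P0 [a == g]eq_sym.
by case: eqP => [->|]; rewrite ?oppr0.
Qed.

Let E_P0r a b c x : E a b (P0 c x) = if c == b then E a b x else 0.
Proof. by rewrite !comp_lfunE P0P0 eq_sym; case: eqP => [<-|]; rewrite ?linear0. Qed.

Lemma q0E chi x : comp 0 (qchar chi) x = \sum_(g <- s) chi g *: P0 g x.
Proof. by rewrite qchar_comp sum_lfunE; apply: eq_bigr => g _; rewrite scale_lfunE. Qed.

(** On the block from [P0 b] to [P0 a] the degree [i] part of [qchar chi] acts as [chi b - chi a];
    dividing by [chi b] gives [1 - chi (a / b)], and conjugation by [psi] contributes
    [psi (a / b)]. *)
Let twist chi psi : is_char chi -> is_char psi ->
  (comp 0 (qchar psi) \o (comp i (qchar chi) \o comp 0 (qchar (inv_char chi)))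
     \o comp 0 (qchar (inv_char psi)))%VF =
  \sum_(a <- s) \sum_(b <- s) (psi (a / b)%g * (1 - chi (a / b)%g)) *: E a b.
Proof.
move=> hc hp; have [_ cM] := hc; have [_ pM] := hp; apply/lfunP => x.
rewrite -[x]sumP0 !linear_sum; apply: eq_bigr => b _.
have q0b f : comp 0 (qchar f) (P0 b x) = f b *: P0 b x.
  rewrite q0E (sum_pick (grad_uniq gr) (e := b)).
  - by rewrite P0P0 eqxx.
  - by move=> g /negbTE ne; rewrite P0P0 ne scaler0.
  - by move=> out; rewrite P0P0 eqxx P0out ?scaler0.
rewrite /= !comp_lfunE q0b !linearZ /= q0b !linearZ /= (qchar_comp i) !sum_lfunE linear_sum /=.
rewrite [RHS](_ : _ = \sum_(a <- s) (psi (a / b)%g * (1 - chi (a / b)%g)) *: E a b x); last first.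
  apply: eq_bigr => a _; rewrite sum_lfunE (sum_pick (grad_uniq gr) (e := b)).
  - by rewrite scale_lfunE E_P0r eqxx.
  - by move=> g ne; rewrite scale_lfunE E_P0r eq_sym (negbTE ne) scaler0.
  - by move=> out; rewrite scale_lfunE E_P0r eqxx !comp_lfunE (P0out x out) !linear0 ?scaler0.
under eq_bigr => g _ do rewrite scale_lfunE linearZ /= q0E scaler_sumr.
rewrite exchange_big !scaler_sumr; apply: eq_bigr => a _ /=.
under eq_bigr => g _ do rewrite scalerA mulrC -scalerA P0pP0 scalerBr.
rewrite -scaler_sumr big_split /= sumrN.
rewrite (sum_pick (grad_uniq gr) (e := b)) ?eqxx; first last.
- by move=> out; rewrite !comp_lfunE (P0out x out) !linear0 ?scaler0.
- by move=> g /negbTE->; rewrite scaler0.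
rewrite (sum_pick (grad_uniq gr) (e := a)) ?eqxx; first last.
- by move=> out; rewrite !comp_lfunE (P0out _ out) scaler0.
- by move=> g /negbTE->; rewrite scaler0.
rewrite -scalerBl !scalerA; congr (_ *: _); rewrite !pM !cM !charV //.
by rewrite /inv_char; field; rewrite !char_neq0.
Qed.

(** The automorphism [qchar chi] composed with the inverse of its graded part is trivial below
    degree [i], and its leading term is the inner factor in [twist]. *)
Let lead_twist chi psi : is_char chi -> is_char psi ->
  lead (\sum_(a <- s) \sum_(b <- s) (psi (a / b)%g * (1 - chi (a / b)%g)) *: E a b).
Proof.
move=> hc hp; rewrite -twist //.
apply: (lead_conj (qchar_aut hp) (qchar_sparse _) (qchar_sparse _)).
have pq := qchar_aut hc; have [c c' _] := pq.
have sq := qchar_sparse chi; have sq' := qchar_sparse (inv_char chi).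
have h0 f : comp 0 (comp 0 f) = comp 0 f by apply/homog_comp0/comp0_homog.
have hi f : comp i (comp 0 f) = 0 by apply/homog_compi/comp0_homog.
have hs f : sparse i (comp 0 f) by apply/homog_sparse/comp0_homog.
have [s1 e1 f1] := comp_mul sq (hs (qchar (inv_char chi))).
have [s2 e2 f2] := comp_mul (hs (qchar chi)) sq'.
have one0 : (comp 0 (qchar chi) \o comp 0 (qchar (inv_char chi)))%VF = \1%VF.
  have [_ <- _] := comp_mul sq sq'; rewrite -(homog_comp0 homog1); congr comp.
  by apply/lfunP => x; rewrite comp_lfunE c' id_lfunE.
exists (qchar chi \o comp 0 (qchar (inv_char chi)))%VF,
  (comp 0 (qchar chi) \o qchar (inv_char chi))%VF; split.
  by apply: aut_pair_comp => //; apply: comp0_aut => //; apply: aut_pair_inv.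
by split; rewrite // ?e1 ?e2 ?f1 ?h0 // hi comp_lfun0r addr0.
Qed.

(* [E a b] is the block of the degree-[i] parts [p] sending [P0 b] to [P0 a].  The isotypic
   sums of these blocks over [a / b = k] are leading terms, hence so is the sum of all
   blocks, and conjugation by the corresponding automorphism removes every [p g]. *)
Lemma lead_unconj : exists u u', aut_pair br u u' /\
  forall g, sparse (i + 1) (u' \o P g \o u)%VF.
Proof.
pose eps k := \sum_(a <- s) \sum_(b <- s) (if k == (a / b)%g then E a b else 0).
pose K := undup [seq (a / b)%g | a <- s, b <- s].
have E_out a b : (a / b)%g \notin K -> E a b = 0.
  move=> out; apply/lfunP => x; rewrite !comp_lfunE zero_lfunE.
  case: (boolP (a \in s)) => as_; last by rewrite P0out.
  case: (boolP (b \in s)) => bs; last by rewrite (P0out x bs) !linear0.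
  by case/negP: out; rewrite mem_undup; apply: allpairs_f.
have sumK (c : G -> F) : \sum_(k <- K) c k *: eps k =
    \sum_(a <- s) \sum_(b <- s) c (a / b)%g *: E a b.
  under eq_bigr => k _ do rewrite /eps scaler_sumr.
  rewrite exchange_big; apply: eq_bigr => a _ /=.
  under eq_bigr => k _ do rewrite scaler_sumr.
  rewrite exchange_big; apply: eq_bigr => b _ /=.
  rewrite (sum_pick (undup_uniq _) (e := (a / b)%g)) ?eqxx //.
    by move=> k /negbTE->; rewrite scaler0.
  by move=> out; rewrite E_out ?scaler0.
(* For fixed [chi] with [chi k != 1], letting [psi] vary isolates [(1 - chi k) *: eps k]; the
   quotient [k = 1] only meets diagonal blocks, which vanish. *)
have lead_eps k : k \in K -> lead (eps k).
  move=> kK; have [k1|k1] := eqVneq k 1%g.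
    suff -> : eps k = 0 by apply: lead0.
    rewrite /eps big1 // => a _; rewrite big1 // => b _; rewrite k1; case: eqP => // e.
    by rewrite -(mul1g b) e mulgVK E_diag.
  have [chi [hc nc]] := sep k1.
  have n1 : 1 - chi k != 0 by rewrite subr_eq0 eq_sym.
  rewrite -[eps k]scale1r -(mulVf n1) -scalerA; apply: leadZ.
  apply: (char_split (U := lead) (v := fun k => (1 - chi k) *: eps k) sep lead0 leadD leadZ
    (undup_uniq _) _ kK) => psi hp.
  under eq_bigr => j _ do rewrite scalerA.
  by rewrite (sumK (fun k => psi k * (1 - chi k))); apply: lead_twist.
pose e := \sum_(k <- K) eps k.
have [u [u' [pu [su su' u0 u0' eu]]]] : lead e.
  rewrite /e big_seq; elim/big_rec: _ => [|k x kK]; first exact: lead0.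
  by apply: leadD; apply: lead_eps.
(* Summing the blocks over all targets [a] removes the left factor [P0 a]. The next two facts then
   say that [p g] is the commutator [e P0 g - P0 g e], so conjugation by [u] cancels it. *)
have eE x : e x = \sum_(b <- s) p b (P0 b x).
  have -> : e = \sum_(a <- s) \sum_(b <- s) E a b.
    transitivity (\sum_(k <- K) 1 *: eps k); first by apply: eq_bigr => k _; rewrite scale1r.
    rewrite (sumK (fun => 1)); apply: eq_bigr => a _; apply: eq_bigr => b _.
    by rewrite scale1r.
  rewrite sum_lfunE; under eq_bigr => a _ do rewrite sum_lfunE.
  rewrite exchange_big; apply: eq_bigr => b _ /=.
  by under eq_bigr => a _ do rewrite !comp_lfunE; rewrite sumP0.
have eP0 g x : e (P0 g x) = p g (P0 g x).
  rewrite eE (sum_pick (grad_uniq gr) (e := g)) ?P0P0 ?eqxx //.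
    by move=> h /negbTE ne; rewrite P0P0 ne linear0.
  by move=> out; rewrite (P0out x out) !linear0.
have P0e g x : P0 g (e x) = p g (P0 g x) - p g x.
  rewrite eE linear_sum /=.
  have -> : p g x = \sum_(b <- s) p g (P0 b x) by rewrite -linear_sum sumP0.
  have -> : p g (P0 g x) = \sum_(b <- s) (if b == g then p g (P0 b x) else 0).
    rewrite (sum_pick (grad_uniq gr) (e := g)) ?eqxx // => [b /negbTE->//|out].
    by rewrite (P0out x out) linear0.
  rewrite -sumrB; apply: eq_bigr => b _; have := pP0 g b (P0 b x).
  rewrite P0P0 eqxx [g == b]eq_sym; case: eqP => [->|_].
    by rewrite subrr => /(canRL (addKr _)); rewrite addNr.
  by rewrite sub0r => /eqP; rewrite addrC addr_eq0 => /eqP.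
exists u, u'; split=> // g.
have [s1 e1 f1] := comp_mul su' (sp g); have [s2 e2 f2] := comp_mul s1 su.
apply: sparseS => //; rewrite f2 f1 e1 u0 u0' eu comp_lfun1l comp_lfun1r.
have [c c' _] := pu.
have ui' : comp i u' = - e.
  have [_ _] := comp_mul su' su; rewrite u0 u0' eu comp_lfun1l comp_lfun1r.
  have -> : (u' \o u)%VF = \1%VF by apply/lfunP => x; rewrite comp_lfunE c id_lfunE.
  by rewrite (homog_compi i_gt0 homog1) => /eqP; rewrite eq_sym addr_eq0 => /eqP.
apply/lfunP => x; rewrite ui' comp_lfun1l !(add_lfunE, comp_lfunE) zero_lfunE opp_lfunE.
by rewrite -/(P0 g) -/(p g) eP0 P0e addrAC addKr addNr.
Qed.

End Diagonalizable.
End Level.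

Lemma diff_bound : exists b : nat, forall d e, d \in ds -> e \in ds -> e < d + b%:Z + 1.
Proof.
have [b hb0] : exists b : nat, forall d, d \in ds -> (`|d| <= b)%N.
  elim: (ds) => [|d r [b hr]]; first by exists 0%N.
  exists (maxn `|d| b) => e; rewrite inE leq_max => /predU1P[->|/hr->]; rewrite ?leqnn ?orbT //.
by exists (b + b)%N => d e /hb0 hd /hb0 he; lia.
Qed.

Theorem grading_homogenize (G : groupType) (s : seq G) (P : G -> 'End(V)) :
  chars_separate F G ->
  grading_by br (fun g h => (g * h)%g) s P ->
  (forall g v x, fil pi v x -> fil pi v (P g x)) ->
  exists u u', aut_pair br u u' /\ forall g, homog (u' \o P g \o u)%VF.
Proof.
move=> sep gr fP; have [b hb0] := diff_bound.
have sp1 : forall g, sparse 1 (P g).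
  move=> g d x e ex lt ne; apply: (fP g d) (fil_hom zg ex (lexx _)) _ _.
  by move: lt ne; lia.
(* Once [i] exceeds every difference of degrees, a map in [sparse i] has only its degree 0 part. *)
suff [u [u' [pu hu]]] : exists u u', aut_pair br u u' /\
    forall g, sparse (b.+1)%:Z (u' \o P g \o u)%VF.
  exists u, u'; split=> // g d x ex; apply: (grad_eq zg) => e.
  rewrite (grad_proj zg); case: eqP => [->//|/eqP ne].
  have [dd|/(grad_out zg) z] := boolP (d \in ds); last first.
    by rewrite -ex z zero_lfunE !linear0.
  have [ee|/(grad_out zg)->] := boolP (e \in ds); last by rewrite zero_lfunE.
  by rewrite (hu g d) //; have := hb0 _ _ dd ee; lia.
elim: b {hb0} => [|b [u [u' [pu hu]]]].
  exists \1%VF, \1%VF; split=> [|g]; first exact: aut_pair1.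
  by rewrite comp_lfun1l comp_lfun1r.
have i0 : 0 < b.+1%:Z by [].
have [v [v' [pv hv]]] := lead_unconj i0 sep (grad_conj gr (aut_pair_inv pu)) hu.
exists (u \o v)%VF, (v' \o u')%VF; split; first exact: aut_pair_comp.
move=> g; have := hv g; rewrite !comp_lfunA.
by rewrite (_ : b.+1%:Z + 1 = b.+2%:Z) //; lia.
Qed.

End Cohomology.

(** * Extension of characters of finitely generated abelian groups *)

Lemma least_nat (Q : nat -> Prop) n : Q n -> exists m, Q m /\ forall k, Q k -> (m <= k)%N.
Proof.
elim/ltn_ind: n => n IH Qn.
case: (classic (exists2 k, (k < n)%N & Q k)) => [[k lt Qk]|no]; first exact: (IH k).
exists n; split=> // k Qk; rewrite leqNgt; apply/negP => lt; apply: no.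
by exists k.
Qed.

Section CharacterExtension.
Variables (F : closedFieldType) (G : groupType).
Hypothesis abG : forall g h : G, (g * h = h * g)%g.

Let mulgACA (x y z w : G) : (x * y * (z * w) = x * z * (y * w))%g.
Proof. by rewrite -!mulgA; congr (_ * _)%g; rewrite !mulgA (abG y). Qed.

Definition partial_char (H : G -> Prop) (chi : G -> F) : Prop :=
  [/\ is_subgroup H, chi 1%g = 1, (forall g h, H g -> H h -> chi (g * h)%g = chi g * chi h)
    & forall g, H g -> chi g != 0].

Lemma partial_charX H chi g n : partial_char H chi -> H g ->
  H (g ^+ n)%g /\ chi (g ^+ n)%g = chi g ^+ n.
Proof.
move=> [[H1 HM _] c1 cM _] Hg; elim: n => [|n [Hn en]]; first by rewrite expg0.
by rewrite expgS exprS cM // en; split=> //; apply: HM.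
Qed.

(** On the group generated by [H] and [t] the only possible extension sends [h t ^ n] to
    [chi h * c ^ n]; the hypothesis on [c] makes it well defined. *)
Lemma char_adjoin H chi t c : partial_char H chi -> c != 0 ->
  (forall d, H (t ^+ d)%g -> chi (t ^+ d)%g = c ^+ d) ->
  exists H' chi', [/\ partial_char H' chi', H' t, chi' t = c
    & forall g, H g -> H' g /\ chi' g = chi g].
Proof.
move=> pH c0 hc; have [[H1 HM HV] c1 cM cn] := pH.
(* Integer powers of [t] are written as quotients of natural powers, which avoids case distinctions
   on signs. *)
pose pt (h : G) (a b : nat) := (h * (t ^+ a / t ^+ b))%g.
pose val h a b := chi h * (c ^+ a / c ^+ b).
have ptM h a b h' a' b' : (pt h a b * pt h' a' b' = pt (h * h') (a + a')%N (b + b')%N)%g.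
  rewrite /pt mulgACA; congr (_ * _)%g.
  by rewrite mulgACA !expgnDr invgM [(t ^- b' * _)%g]abG.
have cX n : c ^+ n != 0 by rewrite expf_neq0.
have valM h a b h' a' b' : H h -> H h' ->
    val (h * h')%g (a + a')%N (b + b')%N = val h a b * val h' a' b'.
  by move=> Hh Hh'; rewrite /val cM // !exprD; field; rewrite !cX.
have wd0 h h' p q : H h -> H h' -> (q <= p)%N -> (h * t ^+ p = h' * t ^+ q)%g ->
    chi h * c ^+ p = chi h' * c ^+ q.
  move=> Hh Hh' le; rewrite -(subnK le) expgnDr mulgA => /mulIg e.
  have Ht : H (t ^+ (p - q))%g by rewrite -[X in H X](mulKg h) e; apply: HM => //; apply: HV.
  by rewrite exprD mulrA -hc // -cM // e.
have wd h a b h' a' b' : H h -> H h' -> pt h a b = pt h' a' b' -> val h a b = val h' a' b'.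
  move=> Hh Hh' e.
  have {}e : (h * t ^+ (a + b') = h' * t ^+ (a' + b))%g.
    have := congr1 (fun x : G => (x * (t ^+ b * t ^+ b'))%g) e; rewrite /pt -!mulgA.
    rewrite mulKg [(t ^+ b * _)%g in RHS]abG mulKg => e'.
    by rewrite !expgnDr -e' abG.
  suff e' : chi h * c ^+ (a + b') = chi h' * c ^+ (a' + b).
    apply: (mulIf (cX b)); apply: (mulIf (cX b')); move: e'; rewrite /val !exprD => e'.
    transitivity (chi h * (c ^+ a * c ^+ b')); first by field; rewrite cX.
    by rewrite e'; field; rewrite cX.
  case/orP: (leq_total (a' + b) (a + b')) => le; first exact: wd0.
  by apply/esym/wd0.
pose R x y := exists h a b, [/\ H h, x = pt h a b & y = val h a b].
pose H' x := exists y, R x y.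
(* The value is chosen from the graph [R], which is single-valued by [wd]; outside the new subgroup
   it is arbitrary. *)
pose chi' x := epsilon (inhabits 0) (R x).
have chiE h a b : H h -> chi' (pt h a b) = val h a b.
  move=> Hh; have : R (pt h a b) (chi' (pt h a b)).
    by apply: epsilon_spec; exists (val h a b), h, a, b.
  by move=> [h' [a' [b' [Hh' e ->]]]]; apply: wd.
have ptH h : pt h 0%N 0%N = h by rewrite /pt expg0 mulgV mulg1.
have valH h : val h 0%N 0%N = chi h by rewrite /val expr0 divr1 mulr1.
have H'H h : H h -> H' h /\ chi' h = chi h.
  move=> Hh; split; last by rewrite -{1}(ptH h) chiE ?valH.
  by exists (chi h), h, 0%N, 0%N; rewrite ptH valH.
exists H', chi'; split=> //.
- split.
  + split; first by apply H'H.
      move=> x y [_ [h [a [b [Hh -> _]]]]] [_ [h' [a' [b' [Hh' -> _]]]]].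
      by rewrite ptM; eexists; exists (h * h')%g, (a + a')%N, (b + b')%N; split=> //; apply: HM.
    move=> x [_ [h [a [b [Hh -> _]]]]]; exists (val h^-1 b a)%g, h^-1%g, b, a; split=> //.
      exact: HV.
    by rewrite /pt invgM invgF abG.
  + by have [_ ->] := H'H _ H1.
  + move=> x y [_ [h [a [b [Hh -> _]]]]] [_ [h' [a' [b' [Hh' -> _]]]]].
    by rewrite ptM !chiE ?valM //; apply: HM.
  + move=> x [_ [h [a [b [Hh -> _]]]]]; rewrite chiE // /val.
    by rewrite !mulf_neq0 ?invr_eq0 ?cn.
- by exists (val 1%g 1%N 0%N), 1%g, 1%N, 0%N; rewrite /pt expg1 expg0 invg1 mulg1 mul1g.
- have e : t = pt 1%g 1%N 0%N by rewrite /pt expg1 expg0 invg1 mulg1 mul1g.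
  by rewrite {1}e chiE // /val c1 expr1 expr0 divr1 mul1r.
Qed.

Lemma order_divides H chi t m d : partial_char H chi -> (0 < m)%N -> H (t ^+ m)%g ->
  (forall k, (0 < k)%N /\ H (t ^+ k)%g -> (m <= k)%N) -> H (t ^+ d)%g -> (m %| d)%N.
Proof.
move=> pH m0 Hm min Hd; have [[H1 HM HV] _ _ _] := pH.
case: (posnP (d %% m)) => [e|pos]; first by rewrite /dvdn e.
have := ltn_pmod d m0; rewrite ltnNge min //; split=> //.
have [Hq _] := partial_charX (d %/ m) pH Hm.
rewrite -(mulKg (t ^+ m ^+ (d %/ m)) (t ^+ (d %% m)))%g -expgnA -expgnDr.
by rewrite mulnC -divn_eq; apply: HM => //; apply: HV; rewrite mulnC expgnA.
Qed.

(** The multiplicative group of [F] is divisible: if [m] is the least positive exponent with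
    [t ^+ m] in [H], an [m]-th root of [chi (t ^+ m)] is a possible value at [t]. If there is no
    such exponent, 1 will do. *)
Lemma char_adjoin_exists H chi t : partial_char H chi ->
  exists H' chi', [/\ partial_char H' chi', H' t & forall g, H g -> H' g /\ chi' g = chi g].
Proof.
move=> pH; have [[H1 _ _] c1 _ cn] := pH.
suff [c [c0 hc]] : exists c, c != 0 /\ forall d, H (t ^+ d)%g -> chi (t ^+ d)%g = c ^+ d.
  by have [H' [chi' [p' t' _ e']]] := char_adjoin pH c0 hc; exists H', chi'.
case: (classic (exists m, (0 < m)%N /\ H (t ^+ m)%g)) => [[m0 hm0]|no]; last first.
  exists 1; rewrite oner_neq0; split=> // -[|d] Hd; first by rewrite expg0 c1 expr0.
  by case: no; exists d.+1.
have [m [[m_gt0 Hm] min]] := least_nat (Q := fun m => (0 < m)%N /\ H (t ^+ m)%g) hm0.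
have [c /rootP] : exists c : F, root ('X^m - (chi (t ^+ m)%g)%:P) c.
  by apply: closed_rootP; rewrite size_XnsubC //; case: (m) m_gt0.
rewrite !hornerE => /eqP; rewrite subr_eq0 => /eqP ec.
exists c; split.
  by apply: contraTneq (cn _ Hm) => c0; rewrite -ec c0 expr0n gtn_eqF // eqxx.
move=> d Hd; have /dvdnP[q ->] := order_divides pH m_gt0 Hm min Hd.
by rewrite mulnC expgnA exprM ec; apply: (partial_charX q pH Hm).2.
Qed.

Lemma chars_separate_of_generated (p : nat) (s : seq G) : p \in [pchar F] ->
  (forall g : G, ~ has_order g p) -> generates (fun g => g \in s) -> chars_separate F G.
Proof.
move=> char_p nop gen k k1.
have ptriv : partial_char (fun g => g = 1%g) (fun => 1).
  split=> //; last by move=> *; rewrite oner_neq0.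
    by split=> // [g h -> ->|g ->]; rewrite ?mulg1 ?invg1.
  by move=> g h _ _; rewrite mulr1.
have p_pr : prime p := pcharf_prime char_p.
(* A nontrivial character of the cyclic group generated by [k], to be extended over the generators
   of [G] one by one. *)
have [c [c0 c1 hc]] : exists c : F, [/\ c != 0, c != 1
    & forall d, (k ^+ d = 1)%g -> (1 : F) = c ^+ d].
  case: (classic (exists m, (0 < m)%N /\ (k ^+ m = 1)%g)) => [[m0 hm0]|no]; last first.
    have [c] : exists c : F, ~~ root ('X * ('X - 1)) c.
      by apply: closed_nonrootP; rewrite mulf_neq0 ?polyX_eq0 // polyXsubC_eq0.
    rewrite rootM negb_or rootX -[1]/(1%:P) root_XsubC => /andP[c0 c1].
    exists c; split=> // -[|d] Hd; first by rewrite expr0.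
    by case: no; exists d.+1.
  have [m [[m_gt0 Hm] min]] := least_nat (Q := fun m => (0 < m)%N /\ (k ^+ m = 1)%g) hm0.
  have m1 : (1 < m)%N.
    by case: m m_gt0 Hm {min} => [|[|]] //; rewrite expg1 => _ e; rewrite e eqxx in k1.
  (* If [m = q p], then [k ^+ q] has order [p]. *)
  have pm : ~~ (p %| m)%N.
    apply/negP => /dvdnP[q em]; have q0 : (0 < q)%N by case: (q) em m_gt0 => [->|].
    apply: (nop (k ^+ q)%g); split; first exact: prime_gt0.
      by rewrite -expgnA -em.
    move=> j /andP[j0 jp]; rewrite -expgnA => e.
    have := min (q * j)%N; rewrite muln_gt0 q0 j0 => /(_ (conj isT e)).
    by rewrite em leq_pmul2l // leqNgt jp.
  (* A root of [1 + X + ... + X ^ (m - 1)] is an [m]-th root of unity, different from 1 because the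
     value at 1 is [m], which is nonzero in [F]. *)
  pose r : {poly F} := \poly_(i < m) 1.
  have [c rc] : exists c : F, root r c.
    by apply: closed_rootP; rewrite size_poly_eq ?oner_neq0 //; case: (m) m1 => [|[]].
  have cm : c ^+ m = 1.
    apply/eqP; rewrite -subr_eq0 subrX1 mulf_eq0 orbC; move: rc.
    rewrite /root horner_poly; under eq_bigr => i _ do rewrite mul1r.
    by move=> ->.
  exists c; split.
  - by apply: contra_eq_neq cm => ->; rewrite expr0n gtn_eqF // eq_sym oner_neq0.
  - apply: contra pm => /eqP c1; move: rc; rewrite c1 /root horner_poly.
    under eq_bigr => i _ do rewrite mul1r expr1n.
    by rewrite sumr_const card_ord (dvdn_pcharf char_p).
  - move=> d Hd; have /dvdnP[q ->] := order_divides ptriv m_gt0 Hm min Hd.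
    by rewrite mulnC exprM cm expr1n.
have [H0 [chi0 [p0 k0 ek _]]] := char_adjoin ptriv c0 hc.
have [H [chi [pH Hk ekk Hs]]] : exists H chi, [/\ partial_char H chi, H k, chi k = c
    & forall g, g \in s -> H g].
  elim: s {gen} => [|t s [H [chi [pH Hk ekk Hs]]]]; first by exists H0, chi0.
  have [H' [chi' [p' t' e']]] := char_adjoin_exists t pH.
  exists H', chi'; split=> //; first by apply e'.
    by have [_ ->] := e' _ Hk.
  by move=> g; rewrite inE => /predU1P[->//|/Hs/e'[]].
have [sH h1 hM _] := pH.
have HT g : H g by apply: (gen H).
exists chi; split; last by rewrite ekk.
by split=> // g h; apply: hM.
Qed.

End CharacterExtension.

(** * The Lie algebra axioms for the Melikyan bracket *)

Section OmulRing.
Variables (F : fieldType) (n1 n2 : nat).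

(** The ring structure rests on a proof of characteristic 5, through associativity; a copy of the
    type indexed by that proof lets the instance refer to it. *)
Definition oring (char5 : 5%N \in [pchar F]) : Type := O2 F n1 n2.

Variable char5 : 5%N \in [pchar F].
Local Notation O := (O2 F n1 n2).
HB.instance Definition _ := GRing.Zmodule.on (oring char5).

Let omulr1 : right_id (mon F n1 n2 0 0) (@omul F n1 n2).
Proof. by move=> f; rewrite omulC omul1. Qed.
HB.instance Definition _ := GRing.Zmodule_isComPzRing.Build (oring char5)
  (@omulA F n1 n2 char5) (@omulC F n1 n2) (@omul1 F n1 n2 char5)
  (fun f g h => omulDl f g h).

Local Notation d1 := (@partial1 F n1 n2).
Local Notation d2 := (@partial2 F n1 n2).

Lemma five_oring : 5%:R = 0 :> oring char5.
Proof.
have e : (5%:R : F) = 0 by apply/eqP; rewrite -(dvdn_pcharf char5).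
by rewrite -[LHS](scaler_nat 5 (mon F n1 n2 0 0 : O)) e scale0r.
Qed.

Local Notation M := (Melikyan F n1 n2).

Lemma mbr_dr (u v : M) : mbr u v = @dr_br (oring char5) d1 d2 u v.
Proof.
case: u v => [[f [D1 D2]] [E1 E2]] [[g [D1' D2']] [E1' E2']].
rewrite /dr_br /mbr /br_W_O /br_W_Wt /br_O_O /wbr /oscale /dr_act /act.
rewrite !scaler_nat /=.
by congr (_, (_, _), (_, _)); rewrite /= ?scaler_nat.
Qed.

Lemma mbr_jacobi (u v w : M) :
  mbr u (mbr v w) + mbr v (mbr w u) + mbr w (mbr u v) = 0.
Proof.
by rewrite !mbr_dr; exact: (dr_jacobi five_oring (@partial1D F n1 n2) (@partial2D F n1 n2)
  (partial1_omul char5) (partial2_omul char5) (@partial12 F n1 n2)).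
Qed.

Lemma mbrC (u v : M) : mbr u v = - mbr v u.
Proof.
rewrite !mbr_dr (dr_brC (R := oring char5)).
by case: (dr_br _ _ _ _) => [[f [D1 D2]] [E1 E2]].
Qed.

Lemma mbr_bilinear : bilinear_br (@mbr F n1 n2).
Proof.
have Dl (x y z : M) : mbr (x + y) z = mbr x z + mbr y z.
  rewrite !mbr_dr.
  exact: (dr_brDl (R := oring char5) (@partial1D F n1 n2) (@partial2D F n1 n2)).
have Zl c (x y : M) : mbr (c *: x) y = c *: mbr x y.
  (* A scalar acts as multiplication by a constant function, which both derivations kill. *)
  have eZ (u : M) : c *: u = dr_scale (R := oring char5) (c *: mon F n1 n2 0 0) u.
    case: u => [[f [D1 D2]] [E1 E2]].
    by congr (_, (_, _), (_, _)); rewrite /= -[RHS]/(omul _ _) omulZl omul1.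
  rewrite !mbr_dr !eZ.
  apply: (dr_brZl (R := oring char5) (partial1_omul char5) (partial2_omul char5)).
    by rewrite partial1Z partial1_mon0 scaler0.
  by rewrite partial2Z partial2_mon0 scaler0.
split=> //.
- by move=> x y z; rewrite ![mbr z _]mbrC Dl opprD.
- by move=> c x y; rewrite ![mbr x _]mbrC Zl scalerN.
Qed.

End OmulRing.

(** * Coordinates of the Melikyan algebra and its weight gradings *)

Variant slot := cO | cD1 | cD2 | cE1 | cE2.
Definition slots := [:: cO; cD1; cD2; cE1; cE2].

Section Components.
Variables (F : fieldType) (n1 n2 : nat).
Local Notation N1 := (5 ^ n1)%N.
Local Notation N2 := (5 ^ n2)%N.
Local Notation O := (O2 F n1 n2).
Local Notation M := (Melikyan F n1 n2).

Definition co (u : M) (e : slot) : O :=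
  match e with
  | cO => u.1.1 | cD1 => u.1.2.1 | cD2 => u.1.2.2 | cE1 => u.2.1 | cE2 => u.2.2
  end.

Definition mk (h : slot -> O) : M := (h cO, (h cD1, h cD2), (h cE1, h cE2)).

Lemma co_mk h e : co (mk h) e = h e. Proof. by case: e. Qed.
Lemma co_ext (u v : M) : (forall e, co u e = co v e) -> u = v.
Proof.
case: u v => [[f [D1 D2]] [E1 E2]] [[g [D1' D2']] [E1' E2']] e.
by congr (_, (_, _), (_, _)); [exact: (e cO)|exact: (e cD1)|exact: (e cD2)|exact: (e cE1)|
  exact: (e cE2)].
Qed.
Lemma coD (u v : M) e : co (u + v) e = co u e + co v e. Proof. by case: e. Qed.
Lemma coZ c (u : M) e : co (c *: u) e = c *: co u e. Proof. by case: e. Qed.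
Lemma co0 e : co 0 e = 0. Proof. by case: e. Qed.
Lemma coN (u : M) e : co (- u) e = - co u e. Proof. by case: e. Qed.

(* The coordinate of [u] at the basis vector [x^(i, j) e], for [e] in 1, d_1, d_2, d~_1, d~_2 *)
Definition mc (u : M) e i j : F := cf (co u e) i j.

Lemma mc_ext (u v : M) : (forall e i j, mc u e i j = mc v e i j) -> u = v.
Proof. by move=> h; apply: co_ext => e; apply: cf_ext => i j; apply: h. Qed.
Lemma mcD u v e i j : mc (u + v) e i j = mc u e i j + mc v e i j.
Proof. by rewrite /mc coD cfD. Qed.
Lemma mcZ c u e i j : mc (c *: u) e i j = c * mc u e i j.
Proof. by rewrite /mc coZ cfZ. Qed.
Lemma mcN u e i j : mc (- u) e i j = - mc u e i j.
Proof. by rewrite /mc coN cfN. Qed.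
Lemma mc0 e i j : mc 0 e i j = 0.
Proof. by rewrite /mc co0 cf0. Qed.
Lemma mc_sum I (r : seq I) (P : pred I) (G : I -> M) e i j :
  mc (\sum_(k <- r | P k) G k) e i j = \sum_(k <- r | P k) mc (G k) e i j.
Proof. by rewrite (big_morph (fun f => mc f e i j) (fun f g => mcD f g e i j) (mc0 e i j)). Qed.
Lemma mc_out u e i j : ~~ ((i < N1) && (j < N2))%N -> mc u e i j = 0.
Proof. exact: cf_out. Qed.
Lemma mc_in u e i j : mc u e i j != 0 -> ((i < N1) && (j < N2))%N.
Proof. by apply: contra_neqT => /mc_out->. Qed.

Lemma mc_neq0 u : u != 0 -> exists e i j, mc u e i j != 0.
Proof.
move=> nz; have ex e : (exists e i j, mc u e i j != 0) \/ forall i j, mc u e i j = 0.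
  case: (boolP [exists a : exps n1 n2, mc u e a.1 a.2 != 0]) => [/existsP[a ha]|/existsPn no].
    by left; exists e, a.1, a.2.
  right=> i j; case: (boolP ((i < N1) && (j < N2))%N) => [/andP[lti ltj]|/mc_out->//].
  by have /negPn/eqP := no (Ordinal lti, Ordinal ltj).
case: (ex cO) => // zO; case: (ex cD1) => // z1; case: (ex cD2) => // z2.
case: (ex cE1) => // z3; case: (ex cE2) => // z4; case/eqP: nz.
by apply: mc_ext => -[] i j; rewrite mc0.
Qed.

Definition slot_eq (e e' : slot) : bool :=
  match e, e' with
  | cO, cO | cD1, cD1 | cD2, cD2 | cE1, cE1 | cE2, cE2 => true | _, _ => false
  end.

Definition bas e i j : M := mk (fun e' => if slot_eq e e' then mon F n1 n2 i j else 0).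

Lemma mc_bas e i j e' k l :
  mc (bas e i j) e' k l = [&& slot_eq e e', (k < N1)%N, (l < N2)%N, k == i & l == j]%:R.
Proof. by rewrite /mc co_mk; case: slot_eq; rewrite ?cf0 ?cf_mon. Qed.

End Components.

Section Weights.
Variables (F : fieldType) (n1 n2 : nat).
Hypothesis char5 : 5%N \in [pchar F].
Local Notation O := (O2 F n1 n2).
Local Notation M := (Melikyan F n1 n2).
Variables (al be : int).

(* The value of the functional [c |-> al c_1 + be c_2] on the degree, for the grading
   [Mbar], of the basis vector [x^(i, j) e]. *)
Definition wt (e : slot) : int :=
  match e with
  | cO => - al - be | cD1 => - (3 * al) | cD2 => - (3 * be)
  | cE1 => - (2 * al) + be | cE2 => al - 2 * be
  end.
Definition wgt e (i j : nat) : int := 3 * al * i%:Z + 3 * be * j%:Z + wt e.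

Definition owt (h : int) (f : O) : Prop :=
  forall i j, cf f i j != 0 -> 3 * al * i%:Z + 3 * be * j%:Z = h.

Lemma owtD h f g : owt h f -> owt h g -> owt h (f + g).
Proof.
move=> hf hg i j; rewrite cfD; case: (eqVneq (cf f i j) 0) => [->|nf _]; last exact: hf.
by rewrite add0r; apply: hg.
Qed.
Lemma owtN h f : owt h f -> owt h (- f).
Proof. by move=> hf i j; rewrite cfN oppr_eq0; apply: hf. Qed.
Lemma owtZ h c f : owt h f -> owt h (c *: f).
Proof. by move=> hf i j; rewrite cfZ mulf_eq0 negb_or => /andP[_]; apply: hf. Qed.
Lemma owt_eq h k f : owt h f -> h = k -> owt k f.
Proof. by move=> hf <-. Qed.
Lemma owtM h k f g : owt h f -> owt k g -> owt (h + k) (omul f g).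
Proof.
move=> hf hg i j; rewrite cf_omul; case: ifP; rewrite ?eqxx // => _ nz.
apply/eqP; apply: contra_neqT nz => ne; rewrite big1 // => a _; rewrite big1 // => b _.
have lea : (a <= i)%N by rewrite -ltnS.
have leb : (b <= j)%N by rewrite -ltnS.
have [->|nf] := eqVneq (cf f a b) 0; first by rewrite mulr0 mul0r.
have [->|ng] := eqVneq (cf g (i - a) (j - b)) 0; first by rewrite mulr0.
case/eqP: ne; rewrite -(hf _ _ nf) -(hg _ _ ng).
have -> : i%:Z = a%:Z + (i - a)%N%:Z by lia.
have -> : j%:Z = b%:Z + (j - b)%N%:Z by lia.
ring.
Qed.
Lemma owt1 h f : owt h f -> owt (h - 3 * al) (partial1 f).
Proof.
move=> hf i j; rewrite cf_partial1 => /hf <-.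
have -> : i.+1%:Z = i%:Z + 1 by lia.
ring.
Qed.
Lemma owt2 h f : owt h f -> owt (h - 3 * be) (partial2 f).
Proof.
move=> hf i j; rewrite cf_partial2 => /hf <-.
have -> : j.+1%:Z = j%:Z + 1 by lia.
ring.
Qed.

Definition hw (d : int) (u : M) : Prop := forall e i j, mc u e i j != 0 -> wgt e i j = d.

Lemma hwP d u : hw d u <-> forall e, owt (d - wt e) (co u e).
Proof.
split=> h e i j nz; first by rewrite -(h e i j nz) /wgt addrK.
by rewrite /wgt (h e i j nz) subrK.
Qed.

Ltac owt_tac := lazymatch goal with
  | |- owt _ (_ + _) => apply owtD; owt_tac
  | |- owt _ (- _) => apply owtN; owt_tac
  | |- owt _ (_ *: _) => apply owtZ; owt_tac
  | |- owt _ (omul _ _) => eapply owt_eq; [apply owtM; owt_tac | rewrite /wt; lia]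
  | |- owt _ (partial1 _) => apply owt1; eassumption
  | |- owt _ (partial2 _) => apply owt2; eassumption
  | |- _ => eassumption
  end.

(** Every slot of the bracket is a sum of products of slots and their derivatives, so the weights
    are compared term by term. *)
Lemma hw_mbr d d' u v : hw d u -> hw d' v -> hw (d + d') (mbr u v).
Proof.
move=> /hwP hu /hwP hv; apply/hwP.
move: {hu}(hu cO) (hu cD1) (hu cD2) (hu cE1) (hu cE2).
move: {hv}(hv cO) (hv cD1) (hv cD2) (hv cE1) (hv cE2).
case: u v => [[f [p q]] [r s]] [[f' [p' q']] [r' s']].
rewrite /co /= => f'0 p'0 q'0 r'0 s'0 f0 p0 q0 r0 s0.
by case; rewrite /= /br_W_O /br_W_Wt /br_O_O /br_Wt_Wt /wbr /oscale /divg /act /=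
  ?[2%:R *: (_, _)]/(_, _) /= ?omulDl; owt_tac.
Qed.

Definition ofilt (P : nat -> nat -> bool) (f : O) : O :=
  [ffun a : exps n1 n2 => if P a.1 a.2 then f a else 0].

Lemma cf_ofilt P f i j : cf (ofilt P f) i j = if P i j then cf f i j else 0.
Proof.
rewrite /cf; case: insubP => [a /= _ <-|_]; last by rewrite if_same.
by case: insubP => [b /= _ <-|_]; rewrite ?if_same ?ffunE.
Qed.

Definition wproj (d : int) (u : M) : M :=
  mk (fun e => ofilt (fun i j => wgt e i j == d) (co u e)).

Lemma mc_wproj d u e i j : mc (wproj d u) e i j = if wgt e i j == d then mc u e i j else 0.
Proof. by rewrite /mc co_mk cf_ofilt. Qed.

Fact wproj_linear d : linear (wproj d).
Proof.
move=> c u v; apply: mc_ext => e i j.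
by rewrite mcD mcZ !mc_wproj mcD mcZ; case: ifP => // _; rewrite mulr0 addr0.
Qed.
HB.instance Definition _ d := GRing.isLinear.Build F M M *:%R (wproj d) (wproj_linear d).

Definition wpi (d : int) : 'End(M) := linfun (wproj d).

Lemma mc_wpi d u e i j : mc (wpi d u) e i j = if wgt e i j == d then mc u e i j else 0.
Proof. by rewrite lfunE mc_wproj. Qed.

Lemma wpi_hw d u : wpi d u = u <-> hw d u.
Proof.
split=> h.
  by move=> e i j; rewrite -h mc_wpi; case: (wgt e i j =P d) => // _; rewrite eqxx.
apply: mc_ext => e i j; rewrite mc_wpi; case: eqP => // ne.
by case: (eqVneq (mc u e i j) 0) => [->//|/h].
Qed.

Definition weights : seq int :=
  undup [seq wgt e (val (p : exps n1 n2).1) (val p.2) | e <- slots, p <- enum (exps n1 n2)].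

Lemma weights_in (u : M) e i j : mc u e i j != 0 -> wgt e i j \in weights.
Proof.
move=> /mc_in/andP[lti ltj]; rewrite mem_undup;
by apply/flattenP; exists [seq wgt e (val (p : exps n1 n2).1) (val p.2) | p <- enum (exps n1 n2)];
  [rewrite /slots; case: (e); rewrite !inE eqxx ?orbT
  |apply/mapP; exists (Ordinal lti, Ordinal ltj); rewrite ?mem_enum].
Qed.

Lemma wpi_grading : grading_by (@mbr F n1 n2) +%R weights wpi.
Proof.
split.
- exact: undup_uniq.
- move=> d out; apply/lfunP => u; apply: mc_ext => e i j; rewrite mc_wpi zero_lfunE mc0.
  case: eqP => // ed; apply: contraNeq out; rewrite -ed; exact: weights_in.
- move=> u; apply: mc_ext => e i j; rewrite mc_sum; under eq_bigr => d _ do rewrite mc_wpi.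
  rewrite (sum_pick (undup_uniq _) (e := wgt e i j)) ?eqxx //.
    by move=> d; rewrite eq_sym => /negbTE->.
  by apply: contraNeq; apply: weights_in.
- move=> g h u; apply: mc_ext => e i j.
  case: (eqVneq g h) => [->|ne]; rewrite ?mc0 !mc_wpi; first by case: (wgt e i j == h).
  by case: eqP => // ->; rewrite (negbTE ne).
- by move=> g h u v /wpi_hw hu /wpi_hw hv; apply/wpi_hw/hw_mbr.
Qed.

Lemma fil_mc v u : fil wpi v u <-> forall e i j, wgt e i j < v -> mc u e i j = 0.
Proof.
split=> h; first by move=> e i j /h /(congr1 (fun u => mc u e i j)) /=; rewrite mc_wpi eqxx mc0.
by move=> d lt; apply: mc_ext => e i j; rewrite mc_wpi mc0; case: eqP => // ed; apply: (h); rewrite ed.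
Qed.

End Weights.

(** * Explicit brackets with elements of small degree *)

Section Brackets.
Variables (F : fieldType) (n1 n2 : nat).
Hypothesis char5 : 5%N \in [pchar F].
Hypotheses (n1_gt0 : (0 < n1)%N) (n2_gt0 : (0 < n2)%N).
Local Notation N1 := (5 ^ n1)%N.
Local Notation N2 := (5 ^ n2)%N.
Local Notation O := (O2 F n1 n2).
Local Notation bas := (bas F n1 n2).
Local Notation mon := (mon F n1 n2).

Lemma N1_ge5 : (5 <= N1)%N. Proof. by rewrite -[X in (X <= _)%N]expn1 leq_exp2l. Qed.
Lemma N2_ge5 : (5 <= N2)%N. Proof. by rewrite -[X in (X <= _)%N]expn1 leq_exp2l. Qed.

Lemma partial1_mon_lt i j : (i.+1 < N1)%N -> partial1 (mon i.+1 j) = mon i j.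
Proof. by move=> lt; rewrite partial1_mon lt. Qed.
Lemma partial2_mon_lt i j : (j.+1 < N2)%N -> partial2 (mon i j.+1) = mon i j.
Proof. by move=> lt; rewrite partial2_mon lt. Qed.

Lemma omulr1 (f : O) : omul f (mon 0 0) = f.
Proof. by rewrite omulC omul1. Qed.

Definition simpO := (@omul1 F n1 n2 char5, omulr1, @omul0l F n1 n2, @omul0r F n1 n2,
  @omulNl F n1 n2, @omulNr F n1 n2, @partial1_mon0 F n1 n2, @partial2_mon0 F n1 n2, @partial10 F n1 n2, @partial20 F n1 n2, @addr0 O, @add0r O,
  @subr0 O, @sub0r O, @scaler0 F O, @oppr0 O, @opprK O).

Ltac unfold_br := rewrite /mbr /br_W_O /br_W_Wt /br_O_O /br_Wt_Wt /wbr /oscale /divg /act /co /=.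
Ltac br_tac := case=> [[f [p q]] [r s]]; unfold_br; rewrite ?simpO //.

Lemma co_br_d1 u e : co (mbr (bas cD1 0 0) u) e = partial1 (co u e).
Proof. by move: u; case: e; br_tac. Qed.
Lemma co_br_d2 u e : co (mbr (bas cD2 0 0) u) e = partial2 (co u e).
Proof. by move: u; case: e; br_tac. Qed.

Lemma co_br_one u e : co (mbr (bas cO 0 0) u) e =
  match e with
  | cO => 2%:R *: (partial1 (co u cD1) + partial2 (co u cD2))
  | cD1 => co u cE1 | cD2 => co u cE2
  | cE1 => - (2%:R *: partial2 (co u cO)) | cE2 => 2%:R *: partial1 (co u cO)
  end.
Proof. by move: u; case: e; br_tac; rewrite scalerN. Qed.

Lemma co_br_t1 u e : co (mbr (bas cE1 0 0) u) e =
  match e with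
  | cO => co u cE2
  | cD1 => - co u cO | cD2 => 0
  | cE1 => partial1 (co u cD1) - 2%:R *: (partial1 (co u cD1) + partial2 (co u cD2))
  | cE2 => partial1 (co u cD2)
  end.
Proof. by move: u; case: e; br_tac; rewrite opprD opprK. Qed.

Lemma co_br_t2 u e : co (mbr (bas cE2 0 0) u) e =
  match e with
  | cO => - co u cE1
  | cD1 => 0 | cD2 => - co u cO
  | cE1 => partial2 (co u cD1)
  | cE2 => partial2 (co u cD2) - 2%:R *: (partial1 (co u cD1) + partial2 (co u cD2))
  end.
Proof. by move: u; case: e; br_tac; rewrite opprD opprK. Qed.

Lemma mc_br_d1 u e i j : mc (mbr (bas cD1 0 0) u) e i j = mc u e i.+1 j.
Proof. by rewrite /mc co_br_d1 cf_partial1. Qed.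
Lemma mc_br_d2 u e i j : mc (mbr (bas cD2 0 0) u) e i j = mc u e i j.+1.
Proof. by rewrite /mc co_br_d2 cf_partial2. Qed.

(** At [i = 0] the value of [i.-1] is harmless because the factor [i%:R] vanishes. *)
Lemma cf_mulx1 (f : O) i j : cf (omul (mon 1 0) f) i j = i%:R * cf f i.-1 j.
Proof.
elim: i f => [|i IH] f.
  elim: j f => [|j IH] f.
    rewrite cf00_omul cf_mon (_ : (0 == 1)%N = false) //= !andbF !mul0r //.
  rewrite -cf_partial2 partial2_omul // !simpO IH !mul0r //.
rewrite -cf_partial1 partial1_omul // partial1_mon_lt; last exact: leq_trans N1_ge5.
rewrite omul1 // cfD IH /=; case: i {IH} => [|i]; first by rewrite mul0r addr0 mul1r.
by rewrite cf_partial1 /= -[in RHS]natr1 mulrDl mul1r addrC.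
Qed.

Lemma cf_mulx2 (f : O) i j : cf (omul (mon 0 1) f) i j = j%:R * cf f i j.-1.
Proof.
elim: j f => [|j IH] f.
  elim: i f => [|i IH] f.
    rewrite cf00_omul cf_mon (_ : (0 == 1)%N = false) //= !andbF !mul0r //.
  rewrite -cf_partial1 partial1_omul // !simpO IH !mul0r //.
rewrite -cf_partial2 partial2_omul // partial2_mon_lt; last exact: leq_trans N2_ge5.
rewrite omul1 // cfD IH /=; case: j {IH} => [|j]; first by rewrite mul0r addr0 mul1r.
by rewrite cf_partial2 /= -[in RHS]natr1 mulrDl mul1r addrC.
Qed.

Lemma mc_br_x1 u i j : mc (mbr (bas cO 1 0) u) cE2 i j = 2%:R * ((i%:R - 1) * mc u cO i j).
Proof.
move: u; rewrite /mc; br_tac.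
rewrite partial1_mon_lt ?simpO; last exact: leq_trans N1_ge5.
rewrite cfZ cfB cf_mulx1 cf_partial1; case: i => [|i]; first by rewrite !mul0r; ring.
by rewrite /=; ring.
Qed.
Lemma mc_br_x1d1 u i j : mc (mbr (bas cD1 1 0) u) cD1 i j = (i%:R - 1) * mc u cD1 i j.
Proof.
move: u; rewrite /mc; br_tac.
rewrite partial1_mon_lt ?simpO; last exact: leq_trans N1_ge5.
rewrite cfB cf_mulx1 cf_partial1; case: i => [|i]; first by rewrite !mul0r; ring.
by rewrite /=; ring.
Qed.

Lemma mc_br_x2d2 u i j : mc (mbr (bas cD2 0 1) u) cD2 i j = (j%:R - 1) * mc u cD2 i j.
Proof.
move: u; rewrite /mc; br_tac.
rewrite partial2_mon_lt ?simpO; last exact: leq_trans N2_ge5.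
rewrite cfB cf_mulx2 cf_partial2; case: j => [|j]; first by rewrite !mul0r; ring.
by rewrite /=; ring.
Qed.

Lemma br_d1_bas e i j : (i.+1 < N1)%N -> mbr (bas cD1 0 0) (bas e i.+1 j) = bas e i j.
Proof.
move=> lt; apply: co_ext => e'; rewrite co_br_d1 !co_mk; case: slot_eq; rewrite ?simpO //.
exact: partial1_mon_lt.
Qed.
Lemma br_d2_bas e i j : (j.+1 < N2)%N -> mbr (bas cD2 0 0) (bas e i j.+1) = bas e i j.
Proof.
move=> lt; apply: co_ext => e'; rewrite co_br_d2 !co_mk; case: slot_eq; rewrite ?simpO //.
exact: partial2_mon_lt.
Qed.
Lemma br_one_t1 i j : mbr (bas cO 0 0) (bas cE1 i j) = bas cD1 i j.
Proof. by apply: co_ext => e; rewrite co_br_one; case: e; rewrite /= ?simpO. Qed.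
Lemma br_one_t2 i j : mbr (bas cO 0 0) (bas cE2 i j) = bas cD2 i j.
Proof. by apply: co_ext => e; rewrite co_br_one; case: e; rewrite /= ?simpO. Qed.
Lemma br_t1_t2 i j : mbr (bas cE1 0 0) (bas cE2 i j) = bas cO i j.
Proof. by apply: co_ext => e; rewrite co_br_t1; case: e; rewrite /= ?simpO. Qed.
Lemma br_one_x1d1 : mbr (bas cO 0 0) (bas cD1 1 0) = 2%:R *: bas cO 0 0.
Proof.
apply: co_ext => e; rewrite co_br_one coZ; case: e; rewrite /= ?simpO //.
by rewrite partial1_mon_lt //; apply: leq_trans N1_ge5.
Qed.
Lemma br_t1_x1d2 : mbr (bas cE1 0 0) (bas cD2 1 0) = bas cE2 0 0.
Proof.
apply: co_ext => e; rewrite co_br_t1; case: e; rewrite /= ?simpO //.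
by rewrite partial1_mon_lt //; apply: leq_trans N1_ge5.
Qed.
Lemma br_t2_x2d1 : mbr (bas cE2 0 0) (bas cD1 0 1) = bas cE1 0 0.
Proof.
apply: co_ext => e; rewrite co_br_t2; case: e; rewrite /= ?simpO //.
by rewrite partial2_mon_lt //; apply: leq_trans N2_ge5.
Qed.

Lemma mon_lin1 : partial1 (mon 1 0) = mon 0 0.
Proof. by rewrite partial1_mon_lt //; apply: leq_trans N1_ge5. Qed.
Lemma mon_lin2 : partial2 (mon 0 1) = mon 0 0.
Proof. by rewrite partial2_mon_lt //; apply: leq_trans N2_ge5. Qed.

Ltac lin_tac := apply: co_ext; case; unfold_br; rewrite ?(mon_lin1, mon_lin2, simpO) //.

Lemma br_x1d2_x1t1 : mbr (bas cD2 1 0) (bas cE1 1 0) = - bas cE2 1 0.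
Proof. lin_tac. Qed.
Lemma br_x1d2_x2t1 : mbr (bas cD2 1 0) (bas cE1 0 1) = bas cE1 1 0 - bas cE2 0 1.
Proof. lin_tac. Qed.
Lemma br_x2d1_x2t2 : mbr (bas cD1 0 1) (bas cE2 0 1) = - bas cE1 0 1.
Proof. lin_tac. Qed.
Lemma br_x2d1_x1t2 : mbr (bas cD1 0 1) (bas cE2 1 0) = bas cE2 0 1 - bas cE1 1 0.
Proof. lin_tac. Qed.

Lemma co_br_E1 k l v : co (mbr (bas cE1 k l) v) cO = omul (mon k l) (co v cE2).
Proof. by move: v; br_tac. Qed.
Lemma co_br_E2 k l v : co (mbr (bas cE2 k l) v) cO = - omul (mon k l) (co v cE1).
Proof. by move: v; br_tac. Qed.
Lemma co_br_E1B v : co (mbr (bas cE1 1 0 - bas cE2 0 1) v) cO =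
  omul (mon 1 0) (co v cE2) + omul (mon 0 1) (co v cE1).
Proof. by move: v; br_tac. Qed.
Lemma co_br_E2B v : co (mbr (bas cE2 0 1 - bas cE1 1 0) v) cO =
  - omul (mon 1 0) (co v cE2) - omul (mon 0 1) (co v cE1).
Proof. by move: v; br_tac. Qed.
Lemma mulx1_mon i j : omul (mon 1 0) (partial1 (mon i j)) = i%:R *: mon i j.
Proof.
apply: cf_ext => k l; rewrite cf_mulx1 // cfZ cf_partial1 !cf_mon.
case: k => [|k] /=; last by case: (k.+1 =P i) => [->//|_]; rewrite /= !andbF !mulr0.
by case: i => [|i]; rewrite !mul0r //= !andbF mulr0.
Qed.
Lemma mulx2_mon i j : omul (mon 0 1) (partial2 (mon i j)) = j%:R *: mon i j.
Proof.
apply: cf_ext => k l; rewrite cf_mulx2 // cfZ cf_partial2 !cf_mon.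
case: l => [|l] /=; last by case: (l.+1 =P j) => [->//|_]; rewrite /= !andbF !mulr0.
by case: j => [|j]; rewrite !mul0r //= !andbF mulr0.
Qed.

Lemma br_x2d2_t1 i j : mbr (bas cD2 0 1) (bas cE1 i j) = (j%:R + 2%:R) *: bas cE1 i j.
Proof.
apply: co_ext => e; rewrite coZ.
by case: e; unfold_br; rewrite ?(mon_lin2, mulx2_mon, simpO) // -scalerDl.
Qed.
Lemma br_x1d1_t2 i j : mbr (bas cD1 1 0) (bas cE2 i j) = (i%:R + 2%:R) *: bas cE2 i j.
Proof.
apply: co_ext => e; rewrite coZ.
by case: e; unfold_br; rewrite ?(mon_lin1, mulx1_mon, simpO) // -scalerDl.
Qed.
End Brackets.

Arguments mbr : simpl never.
Arguments bas : simpl never.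

(* The degree of [x^(i, j) e] for the grading [Mbar] is [(3 i + wt1 e, 3 j + wt2 e)]. *)
Definition wt1 e : int := match e with cO => -1 | cD1 => -3 | cD2 => 0 | cE1 => -2 | cE2 => 1 end.
Definition wt2 e : int := match e with cO => -1 | cD1 => 0 | cD2 => -3 | cE1 => 1 | cE2 => -2 end.

Lemma wgtE al be e i j :
  wgt al be e i j = al * (3 * i%:Z + wt1 e) + be * (3 * j%:Z + wt2 e).
Proof. by rewrite /wgt; case: e; rewrite /wt /wt1 /wt2; ring. Qed.

(** The weight is [a (c1 + c2) + c2]: a drop of the total degree by 1 costs [a], which the gain in
    [c2] cannot make up. *)
Lemma lex_le (a c1 c2 c1' c2' : int) : a * c1' + (a + 1) * c2' <= a * c1 + (a + 1) * c2 ->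
  0 <= a -> c2 - c2' < a -> c1' + c2' <= c1 + c2.
Proof.
move=> le a0 b; rewrite leNgt; apply/negP => lt.
have : a * (c1 + c2 + 1) <= a * (c1' + c2') by apply: ler_wpM2l; lia.
by move: le; rewrite !mulrDr !mulrDl !mul1r mulr1; lia.
Qed.

#[local] Opaque bas.

(** * An invariant description of the component of highest degree *)

Section TopComponent.
Variables (F : fieldType) (n1 n2 : nat).
Hypothesis char5 : 5%N \in [pchar F].
Hypotheses (n1_gt0 : (0 < n1)%N) (n2_gt0 : (0 < n2)%N).
Local Notation N1 := (5 ^ n1)%N.
Local Notation N2 := (5 ^ n2)%N.
Local Notation M := (Melikyan F n1 n2).
Local Notation bas := (bas F n1 n2).
Local Notation wpi := (wpi F n1 n2).
Let hb : bilinear_br (@mbr F n1 n2) := mbr_bilinear n1 n2 char5.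

(* Coefficients of a functional that is injective on the support of [Mbar] and refines the
   total degree *)
Definition al1 : int := 3 * N2%:Z + 10.
Definition be1 : int := al1 + 1.

(** The weight is [al1 (c1 + c2) + c2], and second coordinates differ by less than [al1]; so it
    determines [c1 + c2] and then [c2], like digits. *)
Lemma wgt_inj e i j e' i' j' : (j < N2)%N -> (j' < N2)%N ->
  wgt al1 be1 e i j = wgt al1 be1 e' i' j' ->
  3 * i%:Z + wt1 e = 3 * i'%:Z + wt1 e' /\ 3 * j%:Z + wt2 e = 3 * j'%:Z + wt2 e'.
Proof.
move=> lt lt'; rewrite !wgtE /be1 => eq0.
set c1 := 3 * i%:Z + wt1 e in eq0 *; set c1' := 3 * i'%:Z + wt1 e' in eq0 *.
set c2 := 3 * j%:Z + wt2 e in eq0 *; set c2' := 3 * j'%:Z + wt2 e' in eq0 *.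
have b2 : `|c2 - c2'| < al1.
  have h (e0 : slot) : -3 <= wt2 e0 <= 1 by case: e0.
  have := h e; have := h e'; rewrite /c2 /c2' /al1; lia.
have e0 : al1 * ((c1 + c2) - (c1' + c2')) = c2' - c2.
  by move: eq0; rewrite !mulrDl !mul1r; lia.
have z : c1 + c2 - (c1' + c2') = 0.
  apply/eqP; apply: contraLR (b2) => nz; rewrite -leNgt distrC -e0 normrM.
  have a0 : 0 <= al1 by rewrite /al1; lia.
  by rewrite (ger0_norm a0) ler_peMr //; lia.
by move: e0; rewrite z mulr0; split; lia.
Qed.

(* [quad] is invariant under automorphisms and characterizes the component [top] of highest
   degree: [qm] is the largest length of words for which the products vanish for reasons of
   degree. *)
Definition top (u : M) : Prop := forall e i j, mc u e i j != 0 ->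
  (e = cE1 \/ e = cE2) /\ (i = N1.-1 /\ j = N2.-1).

Definition qm : nat := (N1 + N2 - 3)%N.
Definition quad (c : M) : Prop := forall ys : seq M, (size ys <= qm)%N ->
  mbr c (foldr mbr c ys) = 0.

Lemma top_fil c : top c <-> fil (wpi 1 1) (3 * (N1%:Z + N2%:Z) - 7) c.
Proof.
have N1p : (0 < N1)%N by rewrite expn_gt0.
have N2p : (0 < N2)%N by rewrite expn_gt0.
rewrite fil_mc; split=> h e i j.
  apply: contraTeq => nz; rewrite -leNgt wgtE.
  by have [[->|->] [-> ->]] := h _ _ _ nz; rewrite /wt1 /wt2; lia.
move=> nz; have /andP[lti ltj] := mc_in nz.
have : ~~ (wgt 1 1 e i j < 3 * (N1%:Z + N2%:Z) - 7) by apply: contra nz => /h->.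
rewrite -leNgt wgtE; case: e nz => _; rewrite /wt1 /wt2 => le.
- by lia.
- by lia.
- by lia.
- by split; [left|lia].
- by split; [right|lia].
Qed.

Lemma fil_foldr al be v (w : int) c (ys : seq M) : (forall u, fil (wpi al be) w u) ->
  fil (wpi al be) v c -> fil (wpi al be) (v + w *+ size ys) (foldr mbr c ys).
Proof.
move=> all0 hc; elim: ys => [|y ys IH]; first by rewrite addr0.
rewrite /= mulrS addrCA; apply: (fil_br hb (wpi_grading n1 n2 char5 al be)) => //.
Qed.

Lemma fil_bottom (u : M) : fil (wpi 1 1) (-3) u.
Proof. by apply/fil_mc => e i j; rewrite wgtE; case: e; rewrite /wt1 /wt2; lia. Qed.

Lemma fil_above (u : M) : fil (wpi 1 1) (3 * (N1%:Z + N2%:Z) - 6) u -> u = 0.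
Proof.
move=> /fil_mc h; apply: mc_ext => e i j; rewrite mc0.
case: (boolP ((i < N1) && (j < N2))%N) => [/andP[lti ltj]|/mc_out->//].
by apply: h; rewrite wgtE; case: e; rewrite /wt1 /wt2; lia.
Qed.

(** With [S = N1 + N2], the product has degree at least [2 (3 S - 7) - 3 (S - 3) = 3 S - 5], while
    the highest degree is [3 S - 7]. *)
Lemma top_quad c : top c -> quad c.
Proof.
move=> /top_fil hc ys le; apply: fil_above.
have h := fil_foldr (ys := ys) fil_bottom hc.
apply: fil_le (fil_br hb (wpi_grading n1 n2 char5 1 1) hc h).
have := leq_trans (N1_ge5 n1_gt0) (leqnn _); have := N2_ge5 n2_gt0; rewrite /qm in le.
by rewrite -mulr_natr; lia.
Qed.

Definition hquad (z : M) : Prop := forall ys : seq M,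
  (forall y, y \in ys -> exists d, hw al1 be1 d y) -> (size ys <= qm)%N ->
  mbr z (foldr mbr z ys) = 0.

(** For homogeneous words the leading term of each product is the product of the leading terms, so
    the identity descends to the leading term of [c]. *)
Lemma quad_lead c v : quad c -> fil (wpi al1 be1) v c -> hquad (wpi al1 be1 v c).
Proof.
move=> qc hc ys hy le; have zg := wpi_grading n1 n2 char5 al1 be1.
have [w [hw1 hw2]] : exists w, fil (wpi al1 be1) w (foldr mbr c ys) /\
    wpi al1 be1 w (foldr mbr c ys) = foldr mbr (wpi al1 be1 v c) ys.
  elim: ys hy {le} => [|y ys IH] hy; first by exists v.
  have [w [h1 h2]] := IH (fun y0 h => hy y0 (mem_behead (s := y :: ys) h)).
  have [d /wpi_hw hd] := hy y (mem_head _ _).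
  have fy := fil_hom zg hd (lexx d).
  exists (d + w); split; first exact: (fil_br hb zg).
  by rewrite /= (lead_br hb zg fy h1) hd h2.
by rewrite -hw2 -(lead_br hb zg hc hw1) qc ?linear0.
Qed.

Definition lower p q (z : M) : M :=
  foldr mbr z (nseq p (bas cD1 0 0) ++ nseq q (bas cD2 0 0)).

Lemma mc_lower p q z e i j : mc (lower p q z) e i j = mc z e (i + p) (j + q).
Proof.
rewrite /lower foldr_cat; elim: p i => [|p IH] i /=; last by rewrite mc_br_d1 // IH addSnnS.
rewrite addn0; elim: q j => [|q IH] j /=; last by rewrite mc_br_d2 // IH addSnnS.
by rewrite addn0.
Qed.

Lemma hw_bas al be e i j : hw al be (wgt al be e i j) (bas e i j).
Proof.
move=> e' k l; rewrite mc_bas.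
case: (boolP (slot_eq e e')) => //= se; last by rewrite eqxx.
have -> : e' = e by case: (e) (e') se => -[].
by case: (boolP [&& _, _, _ & _]) => [/and4P[_ _ /eqP-> /eqP->]//|_]; rewrite eqxx.
Qed.

Lemma hquad_lower z p q ys : hquad z ->
  (forall y, y \in ys -> exists e i j, y = bas e i j) ->
  (size ys + (p + q) <= qm)%N -> mbr z (foldr mbr (lower p q z) ys) = 0.
Proof.
move=> hz hy le; rewrite /lower -foldr_cat; apply: hz.
  move=> y; rewrite !mem_cat => /orP[/hy[e [i [j ->]]]|/orP[]]; last 2 first.
  - by rewrite mem_nseq => /andP[_ /eqP->]; eexists; apply: hw_bas.
  - by rewrite mem_nseq => /andP[_ /eqP->]; eexists; apply: hw_bas.
  by eexists; apply: hw_bas.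
by rewrite !size_cat !size_nseq.
Qed.

Lemma foldrZ a (x : M) ys : foldr mbr (a *: x) ys = a *: foldr mbr x ys.
Proof. by elim: ys => //= y ys ->; rewrite (brZr hb). Qed.

Lemma lower_scaled z p q a y ys : hquad z -> lower p q z = a *: y -> a != 0 ->
  (forall y, y \in ys -> exists e i j, y = bas e i j) ->
  (size ys + (p + q) <= qm)%N -> mbr (foldr mbr y ys) z = 0.
Proof.
move=> hz el a0 hy le; have := hquad_lower hz hy le.
rewrite el foldrZ (brZr hb) mbrC // scalerN => /eqP.
by rewrite oppr_eq0 scaler_eq0 (negbTE a0) => /eqP.
Qed.

Section Homogeneous.
Variables (d : int) (z : M).
Hypotheses (hz : hw al1 be1 d z) (qz : hquad z).

Lemma hw_inj e i j e' i' j' : mc z e i j != 0 -> mc z e' i' j' != 0 ->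
  3 * i%:Z + wt1 e = 3 * i'%:Z + wt1 e' /\ 3 * j%:Z + wt2 e = 3 * j'%:Z + wt2 e'.
Proof.
move=> h h'; have /andP[_ lt] := mc_in h; have /andP[_ lt'] := mc_in h'.
by apply: wgt_inj => //; rewrite (hz h) (hz h').
Qed.

(** Another basis vector of the same Z^2-degree has a smaller exponent in one of the two variables,
    so lowering by [(i, j)] kills it. *)
Lemma lower_all e i j : mc z e i j != 0 -> lower i j z = mc z e i j *: bas e 0 0.
Proof.
move=> nz; apply: mc_ext => e' k l; rewrite mc_lower mcZ mc_bas.
have /andP[lti ltj] := mc_in nz.
case: (boolP (slot_eq e e' && (k == 0)%N && (l == 0)%N)) => [/andP[/andP[se /eqP-> /eqP->]]|ne].
  rewrite !expn_gt0 se /= !add0n mulr1.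
  by have -> : e' = e by case: (e) (e') se => -[].
have -> : [&& slot_eq e e', (k < N1)%N, (l < N2)%N, k == 0%N & l == 0%N] = false.
  by apply/negbTE; apply: contra ne => /and5P[-> _ _ -> ->].
rewrite mulr0; apply/eqP.
apply: contraNT ne => nz'; have [] := hw_inj nz nz'.
by case: (e); case: (e'); rewrite /wt1 /wt2 /=; lia.
Qed.

Lemma kill e i j ys : mc z e i j != 0 ->
  (forall y, y \in ys -> exists e i j, y = bas e i j) ->
  (size ys + (i + j) <= qm)%N -> mbr (foldr mbr (bas e 0 0) ys) z = 0.
Proof. by move=> nz; apply: lower_scaled qz (lower_all nz) nz. Qed.

Let two : 2%:R != 0 :> F.
Proof. by rewrite -(dvdn_pcharf char5). Qed.

Let nilb (y : M) : y \in [::] -> exists e i j, y = bas e i j. Proof. by []. Qed.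
Let oneb e i j (y : M) : y \in [:: bas e i j] -> exists e i j, y = bas e i j.
Proof. by rewrite inE => /eqP->; exists e, i, j. Qed.

Lemma lower_lin e i j p q k l : mc z e i j != 0 -> i = (k + p)%N -> j = (l + q)%N ->
  (forall e' k' l', mc z e' (k' + p) (l' + q) != 0 -> slot_eq e e' /\ k' = k /\ l' = l) ->
  lower p q z = mc z e i j *: bas e k l.
Proof.
move=> nz ei ej h; have /andP[lti ltj] := mc_in nz.
apply: mc_ext => e' k' l'; rewrite mc_lower mcZ mc_bas.
case: (boolP (slot_eq e e' && (k' == k)%N && (l' == l)%N)) => [/andP[/andP[se /eqP-> /eqP->]]|ne].
  have lk : (k < N1)%N by apply: leq_ltn_trans lti; rewrite ei leq_addr.
  have ll : (l < N2)%N by apply: leq_ltn_trans ltj; rewrite ej leq_addr.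
  rewrite -ei -ej se !eqxx lk ll mulr1.
  by have -> : e' = e by case: (e) (e') se => -[].
have -> : [&& slot_eq e e', (k' < N1)%N, (l' < N2)%N, k' == k & l' == l] = false.
  by apply/negbTE; apply: contra ne => /and5P[-> _ _ -> ->].
rewrite mulr0; apply/eqP; apply: contraNT ne => nz'.
by have [-> [-> ->]] := h _ _ _ nz'; rewrite !eqxx.
Qed.

Let G1 := N1_ge5 n1_gt0.
Let G2 := N2_ge5 n2_gt0.

Let N1m : ((N1.-1)%:R : F) = -1.
Proof.
have : (N1%:R : F) = 0.
  by apply/eqP; rewrite -(dvdn_pcharf char5) -[X in (X %| _)%N]expn1 dvdn_exp2l.
by case: (N1) G1 => // n _; rewrite -natr1 => /eqP; rewrite addr_eq0 => /eqP.
Qed.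
Let N2m : ((N2.-1)%:R : F) = -1.
Proof.
have : (N2%:R : F) = 0.
  by apply/eqP; rewrite -(dvdn_pcharf char5) -[X in (X %| _)%N]expn1 dvdn_exp2l.
by case: (N2) G2 => // n _; rewrite -natr1 => /eqP; rewrite addr_eq0 => /eqP.
Qed.

Let at_coord (u : M) e i j : u = 0 -> mc u e i j = 0. Proof. by move=> ->; rewrite mc0. Qed.

Let m2 : (-1 - 1 : F) != 0.
Proof. by rewrite -opprD oppr_eq0 -[1 + 1]/(2%:R). Qed.

Lemma no_O i j : mc z cO i j = 0.
Proof.
apply/eqP; apply: wlog_neg => nz; have /andP[lti ltj] := mc_in nz.
(* Only the extreme monomial lies beyond [qm]. Lowering it one step less, to [x_1], keeps the word
   short enough, and the coefficient [i - 1] is then [-2], which is nonzero. *)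
case: (leqP (i + j) qm) => le; last first.
  have ei : i = N1.-1 by move: le; rewrite /qm; lia.
  have ej : j = N2.-1 by move: le; rewrite /qm; lia.
  have el : lower i.-1 j z = mc z cO i j *: bas cO 1 0.
    apply: lower_lin => //; first by lia.
    move=> e' k' l' nz'; have [] := hw_inj nz nz'.
    by case: e' nz'; rewrite /wt1 /wt2 /= => nz' h1 h2; move: (mc_in nz'); split=> //; lia.
  have h : mbr (bas cO 1 0) z = 0.
    by apply: (lower_scaled (ys := [::]) qz el nz nilb); rewrite /qm /=; lia.
  have := at_coord cE2 i j h; rewrite mc_br_x1 // => /eqP.
  by rewrite ei N1m !mulf_eq0 (negbTE two) (negbTE m2) /= -ei.
have h := kill nz nilb le; rewrite /= in h.
case: i nz lti le h => [|i] nz lti le h; last first.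
  have := at_coord cE2 i j h; rewrite /mc co_br_one // cfZ cf_partial1 => /eqP.
  by rewrite mulf_eq0 (negbTE two).
case: j nz ltj le h => [|j] nz ltj le h; last first.
  have := at_coord cE1 0%N j h; rewrite /mc co_br_one // cfN cfZ cf_partial2 => /eqP.
  by rewrite oppr_eq0 mulf_eq0 (negbTE two).
(* Here [z] is a multiple of 1, and [[[x_1 d~_1, 1], 1] = [1, x_1 d_1] = 2]. *)
have {}h : mbr (mbr (bas cE1 1 0) (bas cO 0 0)) z = 0.
  by apply: (kill (ys := [:: bas cE1 1 0]) nz (@oneb _ _ _)); rewrite /qm /=; lia.
have ez : z = mc z cO 0 0 *: bas cO 0 0 by rewrite -(lower_all nz).
move/eqP: h; rewrite ez (brZr hb) scaler_eq0 (negbTE nz) /=.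
rewrite [mbr (bas cE1 1 0) _]mbrC // br_one_t1 // (brNl hb) mbrC // opprK.
rewrite br_one_x1d1 // scaler_eq0 (negbTE two) /= => /eqP/(at_coord cO 0%N 0%N)/eqP.
by rewrite mc_bas !expn_gt0 /= oner_eq0.
Qed.

Lemma no_D1 i j : mc z cD1 i j = 0.
Proof.
apply/eqP; apply: wlog_neg => nz; have /andP[lti ltj] := mc_in nz.
case: (leqP (i + j) qm) => le; last first.
  have ei : i = N1.-1 by move: le; rewrite /qm; lia.
  have ej : j = N2.-1 by move: le; rewrite /qm; lia.
  have el : lower i.-1 j z = mc z cD1 i j *: bas cD1 1 0.
    apply: lower_lin => //; first by lia.
    move=> e' k' l' nz'; have [] := hw_inj nz nz'.
    by case: e' nz'; rewrite /wt1 /wt2 /= => nz' h1 h2; move: (mc_in nz'); lia.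
  have h : mbr (bas cD1 1 0) z = 0.
    by apply: (lower_scaled (ys := [::]) qz el nz nilb); rewrite /qm /=; lia.
  have := at_coord cD1 i j h; rewrite mc_br_x1d1 // => /eqP.
  by rewrite mulf_eq0 ei N1m (negbTE m2) /= -ei.
case: i nz lti le => [|i] nz lti le; last first.
  have h := kill nz nilb le.
  by have := at_coord cD1 i j h; rewrite /= mc_br_d1 // => /eqP.
(* [d_1] does not see the exponent [j]; the word [x_1 d_2] turns [d_1] into [- d_2], which does. *)
case: j nz ltj le => [|j] nz ltj le; last first.
  have h : mbr (mbr (bas cD2 1 0) (bas cD1 0 0)) z = 0.
    by apply: (kill (ys := [:: bas cD2 1 0]) nz (@oneb _ _ _)); rewrite /qm /=; lia.
  have := at_coord cD1 0%N j h; rewrite [mbr (bas cD2 1 0) _]mbrC // br_d1_bas //; last by lia.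
  by rewrite (brNl hb) mcN mc_br_d2 // => /eqP; rewrite oppr_eq0.
(* Here [z] is a multiple of [d_1], and applying [d_1] twice to [x^(2, 0)] gives 1. *)
have h : mbr (mbr (bas cO 2 0) (bas cD1 0 0)) z = 0.
  by apply: (kill (ys := [:: bas cO 2 0]) nz (@oneb _ _ _)); rewrite /qm /=; lia.
have ez : z = mc z cD1 0 0 *: bas cD1 0 0 by rewrite -(lower_all nz).
move/eqP: h; rewrite ez (brZr hb) scaler_eq0 (negbTE nz) /=.
rewrite [mbr (bas cO 2 0) _]mbrC // br_d1_bas //; last by lia.
rewrite (brNl hb) mbrC // br_d1_bas // ?opprK; last by lia.
by move=> /eqP/(at_coord cO 0%N 0%N)/eqP; rewrite mc_bas !expn_gt0 /= oner_eq0.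
Qed.

Lemma no_D2 i j : mc z cD2 i j = 0.
Proof.
apply/eqP; apply: wlog_neg => nz; have /andP[lti ltj] := mc_in nz.
case: (leqP (i + j) qm) => le; last first.
  have ei : i = N1.-1 by move: le; rewrite /qm; lia.
  have ej : j = N2.-1 by move: le; rewrite /qm; lia.
  have el : lower i j.-1 z = mc z cD2 i j *: bas cD2 0 1.
    apply: lower_lin => //; first by lia.
    move=> e' k' l' nz'; have [] := hw_inj nz nz'.
    by case: e' nz'; rewrite /wt1 /wt2 /= => nz' h1 h2; move: (mc_in nz'); lia.
  have h : mbr (bas cD2 0 1) z = 0.
    by apply: (lower_scaled (ys := [::]) qz el nz nilb); rewrite /qm /=; lia.
  have := at_coord cD2 i j h; rewrite mc_br_x2d2 // => /eqP.
  by rewrite mulf_eq0 ej N2m (negbTE m2) /= -ej.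
case: j nz ltj le => [|j] nz ltj le; last first.
  have h := kill nz nilb le.
  by have := at_coord cD2 i j h; rewrite /= mc_br_d2 // => /eqP.
case: i nz lti le => [|i] nz lti le; last first.
  have h : mbr (mbr (bas cD1 0 1) (bas cD2 0 0)) z = 0.
    by apply: (kill (ys := [:: bas cD1 0 1]) nz (@oneb _ _ _)); rewrite /qm /=; lia.
  have := at_coord cD2 i 0%N h; rewrite [mbr (bas cD1 0 1) _]mbrC // br_d2_bas //; last by lia.
  by rewrite (brNl hb) mcN mc_br_d1 // => /eqP; rewrite oppr_eq0.
have h : mbr (mbr (bas cO 0 2) (bas cD2 0 0)) z = 0.
  by apply: (kill (ys := [:: bas cO 0 2]) nz (@oneb _ _ _)); rewrite /qm /=; lia.
have ez : z = mc z cD2 0 0 *: bas cD2 0 0 by rewrite -(lower_all nz).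
move/eqP: h; rewrite ez (brZr hb) scaler_eq0 (negbTE nz) /=.
rewrite [mbr (bas cO 0 2) _]mbrC // br_d2_bas //; last by lia.
rewrite (brNl hb) mbrC // br_d2_bas // ?opprK; last by lia.
by move=> /eqP/(at_coord cO 0%N 0%N)/eqP; rewrite mc_bas !expn_gt0 /= oner_eq0.
Qed.

(** For [i + j < qm], the word [x_1 d_2] turns [d~_1] into [- d~_2], whose bracket with [z] exhibits
    the coordinate in question. For [i + j = qm] no room is left for this word after full lowering,
    so [z] is lowered to a linear monomial instead. *)
Lemma top_E1 i j : mc z cE1 i j != 0 -> i = N1.-1 /\ j = N2.-1.
Proof.
move=> nz; have /andP[lti ltj] := mc_in nz.
case: (ltnP (i + j) qm) => le.
  have h : mbr (mbr (bas cD2 1 0) (bas cE1 0 0)) z = 0.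
    by apply: (kill (ys := [:: bas cD2 1 0]) nz (@oneb _ _ _)); rewrite /=; lia.
  have := at_coord cO i j h; rewrite [mbr (bas cD2 1 0) _]mbrC // br_t1_x1d2 //.
  rewrite (brNl hb) mcN /mc co_br_t2 // cfN opprK => /eqP.
  by rewrite -/(mc z cE1 i j) (negbTE nz).
case: (leqP (i + j) qm) => le'; last by move: le'; rewrite /qm; lia.
have h2 k l : mc z cE2 k l = 0.
  have h := kill nz nilb le'.
  by have := at_coord cO k l h; rewrite /= /mc co_br_t1.
have pure e : e <> cE1 -> co z e = 0.
  by move=> ne; apply: cf_ext => k l; rewrite cf0 -/(mc z e k l); case: e ne => // _;
    rewrite ?no_O ?no_D1 ?no_D2 ?h2.
(* Stopping the lowering at a linear monomial leaves room for one more letter: the total length is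
   exactly [i + j = qm]. The resulting coefficient is [N1 - 1] or [N2 - 1], that is, [-1] in [F]. *)
have lin (k l : nat) : (k <= i)%N -> (l <= j)%N -> (k + l = 1)%N ->
    mbr (mbr (bas cD2 1 0) (bas cE1 k l)) z = 0.
  move=> lk ll kl; have el : lower (i - k) (j - l) z = mc z cE1 i j *: bas cE1 k l.
    apply: (lower_lin nz); try lia.
    move=> e' k' l' nz'; have [] := hw_inj nz nz'.
    by case: e' nz'; rewrite /wt1 /wt2 /= => nz' h3 h4; move: (mc_in nz'); try lia;
      rewrite h2 eqxx in nz'.
  apply: (lower_scaled (ys := [:: bas cD2 1 0]) qz el nz (@oneb _ _ _)).
  by move: le'; rewrite /qm /=; lia.
have [[ei ej]|[ei ej]] : (i = N1.-1 /\ j = N2.-2) \/ (i = N1.-2 /\ j = N2.-1).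
- by move: le le'; rewrite /qm; lia.
- have h := lin 0%N 1%N (leq0n _) ltac:(lia) erefl.
  have := at_coord cO i j.+1 h; rewrite br_x1d2_x2t1 // /mc co_br_E1B // (pure cE2) //.
  rewrite omul0r add0r.
  rewrite cf_mulx2 // ej prednK ?N2m -?ej; last by lia.
  by move/eqP; rewrite mulf_eq0 oppr_eq0 oner_eq0 /= -/(mc z cE1 i j) (negbTE nz).
- have h := lin 1%N 0%N ltac:(lia) (leq0n _) erefl.
  have := at_coord cO i.+1 j h; rewrite br_x1d2_x1t1 // (brNl hb) mcN.
  rewrite /mc co_br_E2 cfN opprK cf_mulx1 // ei prednK ?N1m -?ei; last by lia.
  by move/eqP; rewrite mulf_eq0 oppr_eq0 oner_eq0 /= -/(mc z cE1 i j) (negbTE nz).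
Qed.

Lemma top_E2 i j : mc z cE2 i j != 0 -> i = N1.-1 /\ j = N2.-1.
Proof.
move=> nz; have /andP[lti ltj] := mc_in nz.
case: (ltnP (i + j) qm) => le.
  have h : mbr (mbr (bas cD1 0 1) (bas cE2 0 0)) z = 0.
    by apply: (kill (ys := [:: bas cD1 0 1]) nz (@oneb _ _ _)); rewrite /=; lia.
  have := at_coord cO i j h; rewrite [mbr (bas cD1 0 1) _]mbrC // br_t2_x2d1 //.
  rewrite (brNl hb) mcN /mc co_br_t1 // => /eqP; rewrite oppr_eq0.
  by rewrite -/(mc z cE2 i j) (negbTE nz).
case: (leqP (i + j) qm) => le'; last by move: le'; rewrite /qm; lia.
have h2 k l : mc z cE1 k l = 0.
  have h := kill nz nilb le'.
  by have := at_coord cO k l h; rewrite /= /mc co_br_t2 // cfN => /eqP; rewrite oppr_eq0 => /eqP.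
have pure e : e <> cE2 -> co z e = 0.
  by move=> ne; apply: cf_ext => k l; rewrite cf0 -/(mc z e k l); case: e ne => // _;
    rewrite ?no_O ?no_D1 ?no_D2 ?h2.
have lin (k l : nat) : (k <= i)%N -> (l <= j)%N -> (k + l = 1)%N ->
    mbr (mbr (bas cD1 0 1) (bas cE2 k l)) z = 0.
  move=> lk ll kl; have el : lower (i - k) (j - l) z = mc z cE2 i j *: bas cE2 k l.
    apply: (lower_lin nz); try lia.
    move=> e' k' l' nz'; have [] := hw_inj nz nz'.
    by case: e' nz'; rewrite /wt1 /wt2 /= => nz' h3 h4; move: (mc_in nz'); try lia;
      rewrite h2 eqxx in nz'.
  apply: (lower_scaled (ys := [:: bas cD1 0 1]) qz el nz (@oneb _ _ _)).
  by move: le'; rewrite /qm /=; lia.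
have [[ei ej]|[ei ej]] : (i = N1.-1 /\ j = N2.-2) \/ (i = N1.-2 /\ j = N2.-1).
- by move: le le'; rewrite /qm; lia.
- have h := lin 0%N 1%N (leq0n _) ltac:(lia) erefl.
  have := at_coord cO i j.+1 h; rewrite br_x2d1_x2t2 // (brNl hb) mcN.
  rewrite /mc co_br_E1 cf_mulx2 // ej prednK ?N2m -?ej; last by lia.
  by move/eqP; rewrite oppr_eq0 mulf_eq0 oppr_eq0 oner_eq0 /= -/(mc z cE2 i j) (negbTE nz).
- have h := lin 1%N 0%N ltac:(lia) (leq0n _) erefl.
  have := at_coord cO i.+1 j h; rewrite br_x2d1_x1t2 // /mc co_br_E2B // (pure cE1) //.
  rewrite omul0r subr0 cfN cf_mulx1 // ei prednK ?N1m -?ei; last by lia.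
  by move/eqP; rewrite oppr_eq0 mulf_eq0 oppr_eq0 oner_eq0 /= -/(mc z cE2 i j) (negbTE nz).
Qed.

Lemma hquad_top : top z.
Proof.
move=> e i j; case: e => nz; try by rewrite ?no_O ?no_D1 ?no_D2 eqxx in nz.
  by split; [left|apply: top_E1].
by split; [right|apply: top_E2].
Qed.

End Homogeneous.

Lemma wgt_top e i j e' : (i < N1)%N -> (j < N2)%N -> e' = cE1 \/ e' = cE2 ->
  wgt al1 be1 e' N1.-1 N2.-1 <= wgt al1 be1 e i j ->
  (e = cE1 \/ e = cE2) /\ (i = N1.-1 /\ j = N2.-1).
Proof.
move=> lti ltj he'; rewrite !wgtE /be1 => le.
set c1 := 3 * i%:Z + wt1 e in le; set c2 := 3 * j%:Z + wt2 e in le.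
set c1' := 3 * _ + wt1 e' in le; set c2' := 3 * _ + wt2 e' in le.
have ge : c1' + c2' <= c1 + c2.
  apply: (lex_le le); first by rewrite /al1; lia.
  by rewrite /c2 /c2' /al1; case: (e); case: (e'); rewrite /wt2; lia.
move: ge; rewrite /c1 /c2 /c1' /c2'; clear le c1 c2 c1' c2'.
case: he' => ->; case: e; rewrite /wt1 /wt2 => le; first [lia|split; [by [left|right]|lia]].
Qed.

(** The lowest component of [c] for the refined weight is already in the top component, so all other
    coordinates of [c] have at least the weight of a top vector, and only top vectors do. *)
Theorem quad_top c : quad c -> top c.
Proof.
move=> qc; case: (eqVneq c 0) => [-> e i j|c0]; first by rewrite mc0 eqxx.
have zg := wpi_grading n1 n2 char5 al1 be1.
have [v [hc nz]] := lead_exists zg c0.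
have hz : hw al1 be1 v (wpi al1 be1 v c) by apply/wpi_hw; apply: (grad_id zg).
have tz := hquad_top hz (quad_lead qc hc).
have [e' [i' [j' nz']]] := mc_neq0 nz.
have [he' [ei' ej']] := tz _ _ _ nz'.
have ev : wgt al1 be1 e' N1.-1 N2.-1 = v by rewrite -ei' -ej' (hz _ _ _ nz').
move=> e i j nz''; have /andP[lti ltj] := mc_in nz''.
apply: (wgt_top lti ltj he'); rewrite ev leNgt; apply: contra nz'' => lt.
by move/fil_mc: hc => ->.
Qed.

End TopComponent.

#[local] Transparent bas.

(** * The support of a grading of a simple Lie algebra commutes *)

Section CommutingSupport.
Variables (F : fieldType) (V : vectType F) (br : V -> V -> V) (G : groupType).
Hypothesis hb : bilinear_br br.
Hypothesis brC : forall x y, br x y = - br y x.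
Hypothesis jacobi : forall x y z, br x (br y z) + br y (br z x) + br z (br x y) = 0.

Definition ideal (U : V -> Prop) : Prop :=
  [/\ U 0, (forall x y, U x -> U y -> U (x + y)), (forall c x, U x -> U (c *: x))
    & forall x y, U x -> U (br x y)].

Variables (s : seq G) (P : G -> 'End(V)).
Hypothesis gr : grading_by br (fun g h => (g * h)%g) s P.

(** Left-normed brackets of homogeneous elements; the list records the degrees with the last factor
    first. *)
Inductive monomial : seq G -> V -> Prop :=
  | Mono1 g x : P g x = x -> monomial [:: g] x
  | MonoS l v g x : monomial l v -> P g x = x -> monomial (g :: l) (br v x).

Definition lprod (l : seq G) : G := foldr (fun g p => (p * g)%g) 1%g l.

Lemma monomial_deg l v : monomial l v -> P (lprod l) v = v.
Proof.
elim=> [g x ex|{}l {}v g x _ IH ex]; first by rewrite /lprod /= mul1g.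
exact: (grad_br gr).
Qed.

Lemma monomialZ c l v : monomial l v -> monomial l (c *: v).
Proof.
elim=> [g x ex|{}l {}v g x _ IH ex]; first by apply: Mono1; rewrite linearZ /= ex.
by rewrite -(brZl hb); apply: MonoS.
Qed.

Lemma lprod_commute (g : G) l : (forall h, h \in l -> (g * h = h * g)%g) ->
  (g * lprod l = lprod l * g)%g.
Proof.
elim: l => [|h l IH] hl; first by rewrite mulg1 mul1g.
rewrite /= -/(lprod l) mulgA IH => [|k kl]; last by apply: hl; rewrite inE kl orbT.
by rewrite -!mulgA hl ?mem_head.
Qed.

(* A nonzero bracket [v, x] of homogeneous elements forces their degrees to commute;
   the Jacobi identity moves the last factor of a monomial inwards. *)
Lemma monomial_commute l v : monomial l v -> v != 0 ->
  forall g h, g \in l -> h \in l -> (g * h = h * g)%g.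
Proof.
have [n] := ubnP (size l); elim: n l v => // n IH l v lt ml.
case: ml lt => [g x ex _ _ g1 h1|{}l {}v g x ml ex lt nz].
  by rewrite !inE => /eqP-> /eqP->.
have v0 : v != 0 by apply: contraNneq nz => ->; rewrite (br0l hb).
have cl := IH l v lt ml v0.
(* By antisymmetry the nonzero bracket is homogeneous of both degrees. *)
have cp : (g * lprod l = lprod l * g)%g.
  have e1 := grad_br gr (monomial_deg ml) ex.
  have e2 := grad_br gr ex (monomial_deg ml).
  apply/eqP; apply: contraNT nz => ne; rewrite brC -e2 -linearN /= -brC -e1.
  by rewrite (grad_proj gr) (negbTE ne).
suff cg : forall h, h \in l -> (g * h = h * g)%g.
  move=> a b; rewrite !inE => /predU1P[->|al] /predU1P[->|bl] //; first exact: cg.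
    by rewrite cg.
  exact: cl.
case: ml lt cl cp nz {v0} => [k y ey|{}l w k y ml ey] lt cl cp nz.
  by move=> h; rewrite inE => /eqP->; move: cp; rewrite /= mul1g.
have split : br (br w y) x = br (br w x) y + br w (br y x).
  have := jacobi w y x; rewrite [br x (br w y)]brC [br y (br x w)]brC [br x w]brC.
  by rewrite (brNl hb) opprK => /eqP; rewrite subr_eq0 addrC => /eqP<-.
have ck h : h \in l -> (k * h = h * k)%g.
  by move=> hl; apply: cl; rewrite ?mem_head // inE hl orbT.
have gl h : h \in l -> (g * h = h * g)%g.
  move=> hl; case: (eqVneq (br (br w x) y) 0) => [z|nz1].
    have nz2 : br w (br y x) != 0 by rewrite split z add0r in nz.
    have mm := MonoS ml (grad_br gr ey ex).
    have c := IH ((k * g)%g :: l) _ lt mm nz2 (k * g)%g h (mem_head _ _) (mem_behead (s := _ :: _) hl).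
    by apply: (mulgI k); rewrite mulgA c !mulgA ck.
  have nz2 : br w x != 0 by apply: contraNneq nz1 => ->; rewrite (br0l hb).
  exact: (IH (g :: l) _ lt (MonoS ml ex) nz2 g h (mem_head _ _) (mem_behead (s := _ :: _) hl)).
move=> h; rewrite inE => /predU1P[->|/gl//].
(* [g] commutes with the product of the degrees in [w] and, by [cp], with that product times [k];
   hence it commutes with [k]. *)
have cpl := lprod_commute gl.
by move: cp; rewrite /= -/(lprod l) mulgA cpl -!mulgA => /mulgI.
Qed.

Hypothesis simple : forall U, ideal U -> (exists2 x, x != 0 & U x) -> forall x, U x.

Inductive mono_span (g : G) : V -> Prop :=
  | Span0 : mono_span g 0
  | SpanM l v x : monomial l v -> g \in l -> mono_span g x -> mono_span g (v + x).

(** The monomials having a factor of degree [g] span a nonzero ideal, hence everything. So one of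
    them is nonzero of degree [h], and [h] is a product of degrees that all commute with [g]. *)
Lemma support_commute g h x y : P g x = x -> x != 0 -> P h y = y -> y != 0 ->
  (g * h = h * g)%g.
Proof.
move=> ex x0 ey y0.
have spD u v : mono_span g u -> mono_span g v -> mono_span g (u + v).
  by move=> hu hv; elim: hu => [|l w u' mw gl _ IH]; rewrite ?add0r // -addrA; exact: (SpanM mw gl IH).
have idl : ideal (mono_span g).
  split=> [||c u hu|u v hu]; [exact: Span0|exact: spD| |].
    elim: hu => [|l w u' mw gl _ IH]; first by rewrite scaler0; apply: Span0.
    by rewrite scalerDr; exact: (SpanM (monomialZ c mw) gl IH).
  elim: hu => [|l w u' mw gl _ IH]; first by rewrite (br0l hb); apply: Span0.
  rewrite (brDl hb); apply: spD => //; rewrite -[v](grad_sum gr) (br_sumr hb).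
  elim/big_rec: _ => [|k z _ hz]; first exact: Span0.
  by apply: (SpanM (MonoS mw (grad_id gr k v)) _ hz); rewrite inE gl orbT.
have /(simple idl)/(_ y) : exists2 x, x != 0 & mono_span g x.
  by exists x => //; rewrite -[x]addr0; exact: (SpanM (Mono1 ex) (mem_head _ _) (Span0 g)).
move=> hy; have : exists l v, [/\ monomial l v, g \in l, v != 0 & P h v != 0].
  move: y0; rewrite -ey => {ey}; elim: hy => [|l v u mv gl _ IH]; first by rewrite linear0 eqxx.
  rewrite linearD /=; case: (eqVneq (P h v) 0) => [->|nv _]; first by rewrite add0r.
  by exists l, v; split=> //; apply: contraNneq nv => ->; rewrite linear0.
case=> l [v [mv gl v0 nh]].
have -> : h = lprod l.
  by apply/eqP; apply: contraNT nh => ne; rewrite (grad_other gr ne (monomial_deg mv)).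
by apply: lprod_commute => k kl; apply: (monomial_commute mv).
Qed.

Lemma generated_abelian : generates (fun g => exists2 x, x != 0 & P g x = x) ->
  forall g h : G, (g * h = h * g)%g.
Proof.
move=> gen; have commV (g h : G) : (g * h = h * g)%g -> (g * h^-1 = h^-1 * g)%g.
  by move=> e; apply: (mulgI h); rewrite mulgA -e mulgK mulVKg.
have subC (g : G) : is_subgroup (fun h => (g * h = h * g)%g).
  split=> [|h k e1 e2|h /commV//]; first by rewrite mulg1 mul1g.
  by rewrite mulgA e1 -mulgA e2 mulgA.
have supp_c g : (exists2 x, x != 0 & P g x = x) -> forall h, (g * h = h * g)%g.
  move=> [x x0 ex]; apply: (gen _ (subC g)) => h [y y0 ey].
  exact: (support_commute ex x0 ey y0).
move=> g h; apply/esym; apply: (gen _ (subC h)) => k /supp_c -> //.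
Qed.

End CommutingSupport.

(** * Simplicity of the Melikyan algebra *)

Section Simplicity.
Variables (F : fieldType) (n1 n2 : nat).
Hypothesis char5 : 5%N \in [pchar F].
Hypotheses (n1_gt0 : (0 < n1)%N) (n2_gt0 : (0 < n2)%N).
Local Notation N1 := (5 ^ n1)%N.
Local Notation N2 := (5 ^ n2)%N.
Local Notation M := (Melikyan F n1 n2).
Local Notation bas := (bas F n1 n2).
Local Notation mon := (mon F n1 n2).
Let hb : bilinear_br (@mbr F n1 n2) := mbr_bilinear n1 n2 char5.

Lemma mon_sum (f : O2 F n1 n2) : f = \sum_(a : exps n1 n2) f a *: mon a.1 a.2.
Proof.
apply/ffunP => b; rewrite sum_ffunE (bigD1 b) //= big1 => [|a ne].
  by rewrite !ffunE eqxx addr0; apply/esym/mulr1.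
rewrite !ffunE; case: eqP => [[e1 e2]|]; last by rewrite scaler0.
by case/eqP: ne; case: a b e1 e2 => [a1 a2] [b1 b2] /= e1 e2; congr (_, _); apply/val_inj.
Qed.

Lemma bas_span (U : M -> Prop) u : U 0 -> (forall x y, U x -> U y -> U (x + y)) ->
  (forall c x, U x -> U (c *: x)) -> (forall e i j, mc u e i j != 0 -> U (bas e i j)) -> U u.
Proof.
move=> U0 UD UZ Ub.
have Ue e : U (mk (fun e' => if slot_eq e e' then co u e else 0)).
  set f := co u e.
  have -> : mk (fun e' => if slot_eq e e' then f else 0)
      = \sum_(a : exps n1 n2) f a *: bas e a.1 a.2.
    apply: mc_ext => e' i j; rewrite mc_sum /mc co_mk.
    under eq_bigr => a _ do rewrite coZ co_mk.
    case: ifP => _; first by rewrite {1}[f]mon_sum cf_sum.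
    by rewrite cf0 big1 // => a _; rewrite scaler0 cf0.
  elim/big_rec: _ => // a x _ Ux; apply: (UD) => //.
  case: (eqVneq (f a) 0) => [->|nz]; first by rewrite scale0r.
  by apply: (UZ); apply: Ub; rewrite /mc cf_ord.
have -> : u = mk (fun e' => if slot_eq cO e' then co u cO else 0)
  + mk (fun e' => if slot_eq cD1 e' then co u cD1 else 0)
  + mk (fun e' => if slot_eq cD2 e' then co u cD2 else 0)
  + mk (fun e' => if slot_eq cE1 e' then co u cE1 else 0)
  + mk (fun e' => if slot_eq cE2 e' then co u cE2 else 0).
  by apply: co_ext => e; rewrite !coD !co_mk; case: e; rewrite /= ?addr0 ?add0r.
by do 4![apply: (UD); last exact: Ue]; apply: Ue.
Qed.

(** Brackets of 1 with the third summand give all of [W]; brackets of [d_1] and [d_2] with the third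
    summand give all of it but the top monomials, which are eigenvectors of [x_2 d_2] or
    [x_1 d_1]. *)
Lemma ideal_with_one (U : M -> Prop) : ideal mbr U -> U (bas cO 0 0) -> forall u, U u.
Proof.
move=> [U0 UD UZ Ubr] U1.
have Ur x y : U y -> U (mbr x y).
  by move=> hy; rewrite mbrC // -scaleN1r; apply: (UZ); apply: Ubr.
have D1 i j : U (bas cD1 i j) by rewrite -br_one_t1 //; apply: Ubr.
have D2 i j : U (bas cD2 i j) by rewrite -br_one_t2 //; apply: Ubr.
(* The eigenvalue of [x_1 d_1] on a top monomial of the slot [d~_2]; it equals 1 in [F]. *)
have cN1 : (N1.-1)%:R + 2%:R != 0 :> F.
  rewrite -natrD -(dvdn_pcharf char5) (_ : (N1.-1 + 2 = N1 + 1)%N).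
    by rewrite dvdn_addr // -[X in (X %| _)%N]expn1 dvdn_exp2l.
  by have := N1_ge5 n1_gt0; lia.
have cN2 : (N2.-1)%:R + 2%:R != 0 :> F.
  rewrite -natrD -(dvdn_pcharf char5) (_ : (N2.-1 + 2 = N2 + 1)%N).
    by rewrite dvdn_addr // -[X in (X %| _)%N]expn1 dvdn_exp2l.
  by have := N2_ge5 n2_gt0; lia.
have ZU c x : c != 0 -> U (c *: x) -> U x.
  by move=> c0 /(UZ c^-1); rewrite scalerA mulVf // scale1r.
have E1 i j : (i < N1)%N -> (j < N2)%N -> U (bas cE1 i j).
  move=> lti ltj; case: (ltnP i.+1 N1) => [h|hi].
    by rewrite -(br_d1_bas _ char5 _ _ h); apply: Ubr.
  case: (ltnP j.+1 N2) => [h|hj]; first by rewrite -(br_d2_bas _ char5 _ _ h); apply: Ubr.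
  have ej : j = N2.-1 by lia.
  by apply: (ZU _ _ cN2); rewrite -ej -br_x2d2_t1 //; apply: Ubr.
have E2 i j : (i < N1)%N -> (j < N2)%N -> U (bas cE2 i j).
  move=> lti ltj; case: (ltnP j.+1 N2) => [h|hj].
    by rewrite -(br_d2_bas _ char5 _ _ h); apply: Ubr.
  case: (ltnP i.+1 N1) => [h|hi]; first by rewrite -(br_d1_bas _ char5 _ _ h); apply: Ubr.
  have ei : i = N1.-1 by lia.
  by apply: (ZU _ _ cN1); rewrite -ei -br_x1d1_t2 //; apply: Ubr.
move=> u; apply: bas_span => // -[] i j /mc_in/andP[lti ltj]; [|exact: D1|exact: D2|exact: E1|exact: E2].
by rewrite -br_t1_t2 //; apply: (Ur); apply: E2.
Qed.

Lemma melikyan_simple (U : M -> Prop) : ideal mbr U -> (exists2 x, x != 0 & U x) ->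
  forall u, U u.
Proof.
move=> idU [x x0 Ux]; have [U0 UD UZ Ubr] := idU; apply: ideal_with_one => //.
have Ur y z : U z -> U (mbr y z).
  by move=> hz; rewrite mbrC // -scaleN1r; apply: (UZ); apply: Ubr.
have ZU c y : c != 0 -> U (c *: y) -> U y.
  by move=> c0 /(UZ c^-1); rewrite scalerA mulVf // scale1r.
(* Applying [d_1] and [d_2] as long as the result is nonzero ends with constant coefficients. *)
have [u [u0 Uu cu]] : exists u, [/\ u != 0, U u & forall e i j, mc u e i j != 0 -> (i + j = 0)%N].
  have : forall e i j, mc x e i j != 0 -> (i + j <= N1 + N2)%N.
    by move=> e i j /mc_in/andP[lti ltj]; lia.
  elim: (N1 + N2)%N x x0 Ux => [|n IH] y y0 Uy hy.
    by exists y; split=> // e i j /hy; rewrite leqn0 => /eqP.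
  case: (eqVneq (mbr (bas cD1 0 0) y) 0) => [z1|nz1]; last first.
    by apply: (IH _ nz1 (Ur _ _ Uy)) => e i j; rewrite mc_br_d1 // => /hy; lia.
  case: (eqVneq (mbr (bas cD2 0 0) y) 0) => [z2|nz2]; last first.
    by apply: (IH _ nz2 (Ur _ _ Uy)) => e i j; rewrite mc_br_d2 // => /hy; lia.
  exists y; split=> // e [|i] [|j] //.
  - by rewrite -mc_br_d2 // z2 mc0 eqxx.
  - by rewrite -mc_br_d1 // z1 mc0 eqxx.
  - by rewrite -mc_br_d1 // z1 mc0 eqxx.
have coE e : co u e = mc u e 0 0 *: mon 0 0.
  apply: cf_ext => i j; rewrite cfZ cf_mon -/(mc u e i j).
  case: (eqVneq (mc u e i j) 0) => [z|/[dup] nz /cu]; last first.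
    by case: i j nz => [|//] [|//] _ _; rewrite !expn_gt0 mulr1.
  by case: i j z => [|i] [|j] -> ; rewrite ?mul0r //= ?andbF ?mulr0.
have x1 : (1 < N1)%N by have := N1_ge5 n1_gt0; lia.
have x2 : (1 < N2)%N by have := N2_ge5 n2_gt0; lia.
have one_d1 : U (bas cD1 0 0) -> U (bas cO 0 0).
  by move=> h; rewrite -(br_d1_bas _ char5 _ _ x1); apply: Ubr.
have one_d2 : U (bas cD2 0 0) -> U (bas cO 0 0).
  by move=> h; rewrite -(br_d2_bas _ char5 _ _ x2); apply: Ubr.
(* Among constants, [d~_1] sends [d~_2] to 1 and 1 to [- d_1] and kills the other slots, so its
   square isolates the [d~_2]-coordinate. *)
case: (eqVneq (mc u cE2 0 0) 0) => [z2|nz2]; last first.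
  apply/one_d1/(ZU (- mc u cE2 0 0)); first by rewrite oppr_eq0.
  have -> : - mc u cE2 0 0 *: bas cD1 0 0 = mbr (bas cE1 0 0) (mbr (bas cE1 0 0) u).
    apply: co_ext => e; rewrite co_br_t1 // !co_br_t1 // !coE coZ.
    by case: e; rewrite /= ?(partial1Z, partial2Z, partial1_mon0, partial2_mon0,
      scaler0, oppr0, addr0, subr0, partial1N, partial2N, partial20, partial10, scaleNr).
  by apply: (Ur); apply: (Ur).
case: (eqVneq (mc u cE1 0 0) 0) => [z1|nz1]; last first.
  apply/one_d2/(ZU (mc u cE1 0 0)) => //.
  have -> : mc u cE1 0 0 *: bas cD2 0 0 = mbr (bas cE2 0 0) (mbr (bas cE2 0 0) u).
    apply: co_ext => e; rewrite co_br_t2 // !co_br_t2 // !coE coZ.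
    by case: e; rewrite /= ?(partial1Z, partial2Z, partial1_mon0, partial2_mon0,
      scaler0, oppr0, addr0, subr0, partial1N, partial2N, partial20, partial10, scaleNr, opprK).
  by apply: (Ur); apply: (Ur).
case: (eqVneq (mc u cO 0 0) 0) => [zO|nzO]; last first.
  apply/one_d1/(ZU (- mc u cO 0 0)); first by rewrite oppr_eq0.
  have -> : - mc u cO 0 0 *: bas cD1 0 0 = mbr (bas cE1 0 0) u.
    apply: co_ext => e; rewrite co_br_t1 // !coE coZ.
    by case: e; rewrite /= ?(partial1Z, partial2Z, partial1_mon0, partial2_mon0,
      scaler0, oppr0, addr0, subr0, partial1N, partial2N, partial20, partial10, scaleNr, z2, scale0r).
  exact: Ur.
have eu : u = mc u cD1 0 0 *: bas cD1 0 0 + mc u cD2 0 0 *: bas cD2 0 0.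
  apply: co_ext => e; rewrite coE coD !coZ.
  by case: e; rewrite /= ?(zO, z1, z2, scale0r, scaler0, addr0, add0r).
have d12 : mbr (bas cD1 0 0) (bas cO 0 1) = 0.
  by apply: co_ext => e; rewrite co_br_d1 // co0; case: e; rewrite /= ?(partial1_mon0, partial10).
have d21 : mbr (bas cD2 0 0) (bas cO 1 0) = 0.
  by apply: co_ext => e; rewrite co_br_d2 // co0; case: e; rewrite /= ?(partial2_mon0, partial20).
case: (eqVneq (mc u cD1 0 0) 0) => [y1|ny1].
  have ny2 : mc u cD2 0 0 != 0.
    by apply: contraNneq u0 => y2; rewrite eu y1 y2 !scale0r addr0.
  apply: (ZU _ _ ny2); rewrite -(br_d2_bas _ char5 _ _ x2) -(brZl hb).
  rewrite -[X in mbr X _]add0r -[X in mbr (X + _) _](scale0r (bas cD1 0 0)) -y1 -eu.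
  exact: Ubr.
apply: (ZU _ _ ny1).
have -> : mc u cD1 0 0 *: bas cO 0 0 = mbr u (bas cO 1 0).
  by rewrite [in RHS]eu (brDl hb) !(brZl hb) d21 scaler0 addr0 br_d1_bas.
exact: Ubr.
Qed.

End Simplicity.

(** * From a family of subspaces to a finite system of projections *)

Section Projections.
Variables (F : fieldType) (V : vectType F) (br : V -> V -> V) (G : groupType).
Variable A : G -> {vspace V}.
Hypothesis gA : is_grading br A.

(** A basis of the finite-dimensional space uses only finitely many components, so these already
    span. *)
Lemma grading_projections : exists (s : seq G) (P : G -> 'End(V)),
  grading_by br (fun g h => (g * h)%g) s P /\ forall g x, x \in A g <-> P g x = x.
Proof.
have [sum direct brA] := gA.
have sub (s t : seq G) : {subset s <= t} -> (\sum_(g <- s) A g <= \sum_(g <- t) A g)%VS.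
  elim: s => [|g s IH] st; first by rewrite big_nil sub0v.
  rewrite big_cons subv_add IH ?andbT => [|h hs]; last by apply: st; rewrite inE hs orbT.
  by rewrite (big_rem g (st _ (mem_head _ _))) addvSl.
have [s0 hs0] : exists s : seq G, forall x, x \in (vbasis fullv : seq V) ->
    x \in (\sum_(g <- s) A g)%VS.
  elim: (vbasis fullv : seq V) => [|x r [s hs]]; first by exists [::].
  have [t [v [va ex]]] := sum x; exists (t ++ s) => y; rewrite inE => /predU1P[->|/hs yin].
    rewrite big_cat; apply: (subvP (addvSl _ _)); rewrite ex.
    elim: (t) => [|g r' IH]; first by rewrite !big_nil mem0v.
    by rewrite !big_cons memv_add.
  by rewrite big_cat; apply: (subvP (addvSr _ _)).
pose s := undup s0; have us : uniq s by apply: undup_uniq.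
have full x : x \in (\sum_(g <- s) A g)%VS.
  suff /subvP : (fullv <= \sum_(g <- s) A g)%VS by apply; apply: memvf.
  rewrite -(span_basis (vbasisP fullv)); apply/span_subvP => y /hs0; apply: subvP.
  by apply: sub => g; rewrite mem_undup.
pose P g : 'End(V) := sumv_pi (\sum_(g <- s) A g)%VS g.
have PA g x : P g x \in A g by apply: memv_sum_pi.
have sumP x : \sum_(g <- s) P g x = x by apply: sumv_pi_uniq_sum => //; rewrite filter_predT.
(* Expanding [x] along [s] gives a relation between distinct degrees in which [x] itself is the term
   of degree [g]. *)
have out g x : g \notin s -> x \in A g -> x = 0.
  move=> gs xA; pose v h := if h == g then x else - P h x.
  have vA h : v h \in A h by rewrite /v; case: eqP => [->//|_]; rewrite memvN.
  have := direct (g :: s) v _ vA _ g (mem_head _ _); rewrite /v eqxx; apply.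
    by rewrite /= gs.
  rewrite big_cons eqxx -[X in X + _](sumP x) big_seq -big_seq -big_split big_seq big1 //= => h hs.
  by case: eqP => [e|_]; [rewrite -e hs in gs|rewrite subrr].
have id g k x : x \in A g -> P k x = if k == g then x else 0.
  move=> xA; case: (boolP (g \in s)) => gs; last first.
    by rewrite (out g x gs xA) linear0 if_same.
  case: (boolP (k \in s)) => ks; last first.
    by rewrite (out k _ ks (PA k x)); case: eqP => // e; rewrite e gs in ks.
  pose v h := P h x - (if h == g then x else 0).
  have vA h : v h \in A h by rewrite /v; apply: memvB => //; case: eqP => [->//|_]; apply: mem0v.
  have := direct s v us vA _ k ks; rewrite /v => h; apply/eqP; rewrite -subr_eq0.
  apply/eqP; apply: h; rewrite sumrB sumP (sum_pick us (e := g)) ?eqxx ?subrr //.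
    by move=> h /negbTE->.
  by rewrite gs.
have idP g x : x \in A g <-> P g x = x.
  by split=> [/(id g g)->|<-]; rewrite ?eqxx.
exists s, P; split=> //; split=> //.
- by move=> g gs; apply/lfunP => x; rewrite zero_lfunE; apply: (out g).
- by move=> g h x; apply: id.
- by move=> g h x y /idP hx /idP hy; apply/idP/brA.
Qed.

End Projections.

(** * Automorphisms and the weight filtration *)

Section Filtered.
Variables (F : fieldType) (n1 n2 : nat).
Hypothesis char5 : 5%N \in [pchar F].
Hypotheses (n1_gt0 : (0 < n1)%N) (n2_gt0 : (0 < n2)%N).
Local Notation N1 := (5 ^ n1)%N.
Local Notation N2 := (5 ^ n2)%N.
Local Notation M := (Melikyan F n1 n2).
Local Notation bas := (bas F n1 n2).
Local Notation wpi := (wpi F n1 n2).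
Let hb : bilinear_br (@mbr F n1 n2) := mbr_bilinear n1 n2 char5.

Lemma top_aut (q q' : 'End(M)) c : aut_pair mbr q q' -> top c -> top (q c).
Proof.
move=> [k k' m] tc; apply: (quad_top char5 n1_gt0 n2_gt0) => ys le.
have -> : foldr mbr (q c) ys = q (foldr mbr c (map q' ys)).
  by elim: ys {le} => //= y ys ->; rewrite m k'.
by rewrite -m (top_quad char5 n1_gt0 n2_gt0 tc) ?linear0 // size_map.
Qed.

Variables (al be : int).
Local Notation fl := (fil (wpi al be)).

(* [d_1], [d_2] and the two top vectors generate everything downwards, with additive weights. *)
Lemma filtered_of_generators (q : 'End(M)) : br_morph mbr q ->
  fl (wgt al be cD1 0 0) (q (bas cD1 0 0)) -> fl (wgt al be cD2 0 0) (q (bas cD2 0 0)) ->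
  fl (wgt al be cE1 N1.-1 N2.-1) (q (bas cE1 N1.-1 N2.-1)) ->
  fl (wgt al be cE2 N1.-1 N2.-1) (q (bas cE2 N1.-1 N2.-1)) ->
  forall v x, fl v x -> fl v (q x).
Proof.
move=> m hd1 hd2 ht1 ht2; have zg := wpi_grading n1 n2 char5 al be.
have N1p := N1_ge5 n1_gt0; have N2p := N2_ge5 n2_gt0.
have step (x y z : M) a b c : mbr x y = z -> fl a (q x) -> fl b (q y) -> c = a + b -> fl c (q z).
  by move=> <- hx hy ->; rewrite m; apply: (fil_br hb zg).
have down e : fl (wgt al be e N1.-1 N2.-1) (q (bas e N1.-1 N2.-1)) ->
    forall i j, (i < N1)%N -> (j < N2)%N -> fl (wgt al be e i j) (q (bas e i j)).
  move=> ht i j lti ltj.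
  have [k ek] : exists k, (i + k = N1.-1)%N by exists (N1.-1 - i)%N; lia.
  have [l el] : exists l, (j + l = N2.-1)%N by exists (N2.-1 - j)%N; lia.
  elim: k i lti ek => [|k IHk] i lti ek; last first.
    apply: (step _ _ _ _ _ _ (br_d1_bas n2 char5 e j (_ : (i.+1 < N1)%N)) hd1 (IHk i.+1 _ _));
      try lia.
    by rewrite !wgtE /wt1 /wt2; lia.
  elim: l j ltj el => [|l IHl] j ltj el; last first.
    apply: (step _ _ _ _ _ _ (br_d2_bas n1 char5 e i (_ : (j.+1 < N2)%N)) hd2 (IHl j.+1 _ _));
      try lia.
    by rewrite !wgtE /wt1 /wt2; lia.
  by rewrite -(addn0 i) ek -(addn0 j) el.
have N1_0 : (0 < N1)%N by lia.
have N2_0 : (0 < N2)%N by lia.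
have E1 := down _ ht1; have E2 := down _ ht2.
have O i j : (i < N1)%N -> (j < N2)%N -> fl (wgt al be cO i j) (q (bas cO i j)).
  move=> lti ltj; apply: (step _ _ _ _ _ _ (br_t1_t2 n1 n2 char5 i j) (E1 _ _ N1_0 N2_0) (E2 _ _ lti ltj)).
  by rewrite !wgtE /wt1 /wt2; lia.
have D1 i j : (i < N1)%N -> (j < N2)%N -> fl (wgt al be cD1 i j) (q (bas cD1 i j)).
  move=> lti ltj; apply: (step _ _ _ _ _ _ (br_one_t1 n1 n2 char5 i j) (O _ _ N1_0 N2_0) (E1 _ _ lti ltj)).
  by rewrite !wgtE /wt1 /wt2; lia.
have D2 i j : (i < N1)%N -> (j < N2)%N -> fl (wgt al be cD2 i j) (q (bas cD2 i j)).
  move=> lti ltj; apply: (step _ _ _ _ _ _ (br_one_t2 n1 n2 char5 i j) (O _ _ N1_0 N2_0) (E2 _ _ lti ltj)).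
  by rewrite !wgtE /wt1 /wt2; lia.
move=> v x /fil_mc hx; apply: (bas_span (U := fun x => fl v (q x))).
- by rewrite linear0; apply: fil0.
- by move=> y z hy hz; rewrite linearD; apply: filD.
- by move=> c y hy; rewrite linearZ; apply: filZ.
move=> e i j nz; have /andP[lti ltj] := mc_in nz.
have le : v <= wgt al be e i j by rewrite leNgt; apply: contra nz => lt; rewrite hx.
apply: (fil_le le); case: (e); [exact: O|exact: D1|exact: D2|exact: E1|exact: E2].
Qed.

End Filtered.

(** * Exchange of the variables and the shear substitution *)

Section Swap.
Variables (F : fieldType) (n1 n2 : nat).
Hypothesis char5 : 5%N \in [pchar F].
Local Notation O12 := (O2 F n1 n2).
Local Notation O21 := (O2 F n2 n1).
Local Notation M12 := (Melikyan F n1 n2).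
Local Notation M21 := (Melikyan F n2 n1).

Definition oswap (f : O12) : O21 := [ffun a : exps n2 n1 => f (a.2, a.1)].

Lemma cf_oswap f i j : cf (oswap f) i j = cf f j i.
Proof.
rewrite /cf; case: insubP => [a _ _|nlt]; last by case: insubP.
by case: insubP => // b _ _; rewrite ffunE.
Qed.

Lemma oswapD f g : oswap (f + g) = oswap f + oswap g.
Proof. by apply: cf_ext => i j; rewrite !(cfD, cf_oswap). Qed.
Lemma oswapZ c f : oswap (c *: f) = c *: oswap f.
Proof. by apply: cf_ext => i j; rewrite !(cfZ, cf_oswap). Qed.
Lemma oswapN f : oswap (- f) = - oswap f.
Proof. by apply: cf_ext => i j; rewrite !(cfN, cf_oswap). Qed.
Lemma oswap_partial1 f : partial1 (oswap f) = oswap (partial2 f).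
Proof. by apply: cf_ext => i j; rewrite cf_partial1 !cf_oswap cf_partial2. Qed.
Lemma oswap_partial2 f : partial2 (oswap f) = oswap (partial1 f).
Proof. by apply: cf_ext => i j; rewrite cf_partial2 !cf_oswap cf_partial1. Qed.
Lemma oswapM f g : oswap (omul f g) = omul (oswap f) (oswap g).
Proof.
apply: cf_ext => i j; rewrite cf_oswap !cf_omul andbC; case: ifP => // _.
rewrite exchange_big; apply: eq_bigr => k _; apply: eq_bigr => l _.
by rewrite !cf_oswap ['C(i, k)%:R * _]mulrC.
Qed.

(* The sign on [O] and [W~] compensates the antisymmetry of [W~ x W~ -> O] *)
Definition swap (u : M12) : M21 :=
  (- oswap u.1.1, (oswap u.1.2.2, oswap u.1.2.1), (- oswap u.2.2, - oswap u.2.1)).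

Lemma co_swap u e : co (swap u) e = match e with
  | cO => - oswap (co u cO) | cD1 => oswap (co u cD2) | cD2 => oswap (co u cD1)
  | cE1 => - oswap (co u cE2) | cE2 => - oswap (co u cE1) end.
Proof. by case: e. Qed.

Fact swap_linear : linear swap.
Proof.
move=> c u v; apply: co_ext => e; rewrite coD coZ !co_swap.
by case: e; rewrite coD coZ oswapD oswapZ ?opprD ?scalerN.
Qed.
HB.instance Definition _ := GRing.isLinear.Build F M12 M21 *:%R swap swap_linear.

Lemma swap_mbr u v : swap (mbr u v) = mbr (swap u) (swap v).
Proof.
rewrite !(mbr_dr char5).
exact: (dr_swap_br (R := oring n1 n2 char5) (S := oring n2 n1 char5) (@partial1N F n2 n1)
  (@partial2N F n2 n1) oswapD oswapN oswapM _ _ oswap_partial1 oswap_partial2).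
Qed.

End Swap.

Lemma oswapK (F : fieldType) (n1 n2 : nat) (f : O2 F n1 n2) : oswap (oswap f) = f.
Proof. by apply: cf_ext => i j; rewrite !cf_oswap. Qed.

Lemma swapK (F : fieldType) (n1 n2 : nat) (u : Melikyan F n1 n2) : swap (swap u) = u.
Proof.
case: u => [[f [p q]] [r s]].
by congr (_, (_, _), (_, _)); rewrite /= ?oswapN ?opprK oswapK.
Qed.

Definition swap_slot (e : slot) : slot :=
  match e with cO => cO | cD1 => cD2 | cD2 => cD1 | cE1 => cE2 | cE2 => cE1 end.

Lemma swap_bas (F : fieldType) n1 n2 e i j : swap (bas F n1 n2 e i j)
  = (if e is cD1 then 1 else if e is cD2 then 1 else -1) *: bas F n2 n1 (swap_slot e) j i.
Proof.
apply: mc_ext => e' k l; rewrite mcZ mc_bas [LHS]/mc co_swap.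
have E e1 : cf (oswap (co (bas F n1 n2 e i j) e1)) k l = mc (bas F n1 n2 e i j) e1 l k.
  by rewrite cf_oswap.
have C b1 b2 b3 b4 : [&& b1, b2, b3 & b4] = [&& b2, b1, b4 & b3].
  by rewrite andbCA [b3 && b4]andbC.
by case: e e' E => -[] E; rewrite ?cfN E mc_bas /= ?mul1r ?mulN1r ?oppr0 // C.
Qed.

Section Shear.
Variables (F : fieldType) (n1 n2 : nat).
Hypothesis char5 : 5%N \in [pchar F].
Hypothesis n12 : (n1 <= n2)%N.
Local Notation N1 := (5 ^ n1)%N.
Local Notation N2 := (5 ^ n2)%N.
Local Notation O := (O2 F n1 n2).
Local Notation M := (Melikyan F n1 n2).

(* The substitution [x_1 |-> x_1 + lam x_2] *)
Definition oshear (lam : F) (f : O) : O := [ffun a : exps n1 n2 =>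
  \sum_(l < a.2.+1) 'C(a.2, l)%:R * lam ^+ l * cf f (a.1 + l) (a.2 - l)].

Lemma cf_oshear lam f i j : (j < N2)%N -> cf (oshear lam f) i j =
  \sum_(l < j.+1) 'C(j, l)%:R * lam ^+ l * cf f (i + l) (j - l).
Proof.
move=> ltj; case: (ltnP i N1) => [lti|hi].
  by have := cf_ord (oshear lam f) (Ordinal lti, Ordinal ltj); rewrite ffunE /=.
rewrite cf_out ?negb_and -?leqNgt ?hi // big1 // => l _.
by rewrite cf_out ?mulr0 // negb_and -leqNgt (leq_trans hi) // leq_addr.
Qed.

Lemma oshear_linear lam c f g : oshear lam (c *: f + g) = c *: oshear lam f + oshear lam g.
Proof.
apply/ffunP => a; rewrite !ffunE [X in _ = X + _]big_distrr -big_split.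
by apply: eq_bigr => l _ /=; rewrite cfD cfZ; ring.
Qed.
Lemma oshearD lam f g : oshear lam (f + g) = oshear lam f + oshear lam g.
Proof. by have := oshear_linear lam 1 f g; rewrite !scale1r. Qed.
Lemma oshear0 lam : oshear lam 0 = 0.
Proof. by apply: (addrI (oshear lam 0)); rewrite -oshearD !addr0. Qed.
Lemma oshearZ lam c f : oshear lam (c *: f) = c *: oshear lam f.
Proof. by have := oshear_linear lam c f 0; rewrite oshear0 !addr0. Qed.
Lemma oshearN lam f : oshear lam (- f) = - oshear lam f.
Proof. by rewrite -scaleN1r oshearZ scaleN1r. Qed.

Lemma oshear_partial1 lam f : partial1 (oshear lam f) = oshear lam (partial1 f).
Proof.
apply: cf_ext => i j; rewrite cf_partial1; case: (ltnP j N2) => ltj; last first.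
  by rewrite !cf_out // negb_and -!leqNgt ltj orbT.
by rewrite !cf_oshear //; apply: eq_bigr => l _; rewrite cf_partial1.
Qed.

Lemma oshear_partial2 lam f :
  partial2 (oshear lam f) = oshear lam (partial2 f) + lam *: oshear lam (partial1 f).
Proof.
apply: cf_ext => i j; rewrite cfD cfZ cf_partial2; case: (ltnP j N2) => ltj; last first.
  by rewrite !cf_out ?mulr0 ?addr0 // negb_and -!leqNgt ?ltj ?(leqW ltj) orbT.
rewrite [in RHS]cf_oshear // [in RHS]cf_oshear //.
have -> : \sum_(l < j.+1) 'C(j, l)%:R * lam ^+ l * cf (partial2 f) (i + l) (j - l)
    + lam * (\sum_(l < j.+1) 'C(j, l)%:R * lam ^+ l * cf (partial1 f) (i + l) (j - l))
    = \sum_(l < j.+2) 'C(j.+1, l)%:R * (lam ^+ l * cf f (i + l) (j.+1 - l)).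
  rewrite (sum_bin_shift (fun l k => lam ^+ l * cf f (i + l) k)) addrC big_distrr /=.
  congr (_ + _); apply: eq_bigr => l _; last by rewrite cf_partial2 mulrA.
  by rewrite cf_partial1 addnS exprS; ring.
case: (ltnP j.+1 N2) => ltj1.
  by rewrite cf_oshear //; apply: eq_bigr => l _; rewrite mulrA.
(* At the truncation bound every term must vanish: the inner ones by their binomial coefficient,
   [l = 0] by the bound on [x_2], and [l = N2] by the bound on [x_1], since [N1 <= N2]. *)
have ej : j.+1 = N2 by apply/eqP; rewrite eqn_leq ltj ltj1.
rewrite cf_out ?big1 // => [l _|]; last by rewrite negb_and -!leqNgt ltj1 orbT.
case: l => l /=; rewrite ltnS ej => lel; have [->|l0] := eqVneq l 0%N.
  by rewrite subn0 cf_out ?mulr0 // negb_and ltnn orbT.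
have [->|lN] := eqVneq l N2.
  rewrite cf_out ?mulr0 // negb_and -leqNgt (leq_trans _ (leq_addl _ _)) //.
  by rewrite leq_exp2l.
by rewrite bin_pow_eq0 ?mul0r // lt0n l0 ltn_neqAle lN.
Qed.

Lemma cf00_oshear lam f : cf (oshear lam f) 0 0 = cf f 0 0.
Proof. by rewrite cf_oshear ?expn_gt0 // big_ord1 bin0 mul1r expr0 mul1r. Qed.

Lemma oshearM lam f g : oshear lam (omul f g) = omul (oshear lam f) (oshear lam g).
Proof.
apply: cf_ext => i; elim: i f g => [|i IH] f g j; last first.
  rewrite -!cf_partial1 partial1_omul // !oshear_partial1 partial1_omul // oshearD.
  by rewrite !cfD !IH.
elim: j f g => [|j IH] f g; first by rewrite !(cf00_omul, cf00_oshear).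
rewrite -!cf_partial2 oshear_partial2 partial1_omul // partial2_omul // !oshearD !cfD cfZ cfD.
rewrite !IH [in RHS]partial2_omul // !oshear_partial2 omulDl omulDr omulZl omulZr !cfD !cfZ.
by rewrite mulrDr addrACA.
Qed.

Lemma oshearK lam f : oshear (- lam) (oshear lam f) = f.
Proof.
apply: cf_ext => i; elim: i f => [|i IH] f j; last by rewrite -!cf_partial1 !oshear_partial1 IH.
elim: j f => [|j IH] f; first by rewrite !cf00_oshear.
rewrite -!cf_partial2 oshear_partial2 oshear_partial1 oshear_partial2 oshearD oshearZ.
by rewrite !cfD !cfZ !IH mulNr addrK.
Qed.

Definition shear (lam : F) (u : M) : M :=
  (oshear lam u.1.1,
   (oshear lam u.1.2.1 - lam *: oshear lam u.1.2.2, oshear lam u.1.2.2),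
   (oshear lam u.2.1 - lam *: oshear lam u.2.2, oshear lam u.2.2)).

Lemma co_shear lam u e : co (shear lam u) e = match e with
  | cD1 => oshear lam (co u cD1) - lam *: oshear lam (co u cD2)
  | cE1 => oshear lam (co u cE1) - lam *: oshear lam (co u cE2)
  | _ => oshear lam (co u e) end.
Proof. by case: e. Qed.

Fact shear_linear lam : linear (shear lam).
Proof.
move=> c u v; apply: co_ext => e; rewrite coD coZ !co_shear.
case: e; rewrite !coD !coZ !oshear_linear // scalerDr scalerA scalerBr scalerA;
  by rewrite mulrC opprD addrACA.
Qed.
HB.instance Definition _ lam := GRing.isLinear.Build F M M *:%R (shear lam) (shear_linear lam).

Lemma shearK lam u : shear (- lam) (shear lam u) = u.
Proof.
case: u => [[f [p q]] [r s]].
by congr (_, (_, _), (_, _)); rewrite /= ?oshearK // oshearD oshearN oshearZ !oshearK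
  scaleNr opprK subrK.
Qed.

Lemma shear_mbr lam u v : shear lam (mbr u v) = mbr (shear lam u) (shear lam v).
Proof.
pose k : oring n1 n2 char5 := lam *: mon F n1 n2 0 0.
have kE (x : O) : lam *: x = omul k x by rewrite /k omulZl omul1.
have eS (w : M) : shear lam w = dr_shear (R := oring n1 n2 char5) (S := oring n1 n2 char5) (oshear lam) k w.
  by case: w => [[f [p q]] [r s]]; rewrite /shear /= !kE.
rewrite !(mbr_dr char5) !eS.
apply: (dr_shear_br (R := oring n1 n2 char5) (S := oring n1 n2 char5) (@partial1D F n1 n2)
  (@partial2D F n1 n2) (@partial1N F n1 n2) (@partial2N F n1 n2) (oshearD lam) (oshearN lam)
  (oshearM lam)).
- by move=> x; rewrite -[k * _]kE -[k * _]kE; apply: partial1Z.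
- by move=> x; rewrite -[k * _]kE -[k * _]kE; apply: partial2Z.
- exact: oshear_partial1.
- by move=> x; rewrite -[k * _]kE; apply: oshear_partial2.
Qed.

End Shear.

Lemma slot_eqP e e' : slot_eq e e' -> e = e'. Proof. by case: e; case: e'. Qed.

Lemma slot_eqxx e : slot_eq e e. Proof. by case: e. Qed.
Lemma slot_eqC e e' : slot_eq e e' = slot_eq e' e. Proof. by case: e; case: e'. Qed.

(** * Homogenizing for the total degree and for the refined weight *)

Section Homogenization.
Variables (F : closedFieldType) (n1 n2 : nat).
Hypothesis char5 : 5%N \in [pchar F].
Hypotheses (n1_gt0 : (0 < n1)%N) (n2_gt0 : (0 < n2)%N).
Local Notation N1 := (5 ^ n1)%N.
Local Notation N2 := (5 ^ n2)%N.
Local Notation M := (Melikyan F n1 n2).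
Local Notation bas := (bas F n1 n2).
Local Notation wpi := (wpi F n1 n2).
Let hb : bilinear_br (@mbr F n1 n2) := mbr_bilinear n1 n2 char5.
Variable G : groupType.
Hypothesis sep : chars_separate F G.
Let zg al be := wpi_grading n1 n2 char5 al be.

Definition is_ggrading (s : seq G) (P : G -> 'End(M)) : Prop :=
  grading_by (@mbr F n1 n2) (fun g h => (g * h)%g) s P.

Lemma two_slots (u : M) e1 e2 i j : slot_eq e1 e2 = false -> (i < N1)%N -> (j < N2)%N ->
  (forall e k l, mc u e k l != 0 -> (e = e1 \/ e = e2) /\ (k = i /\ l = j)) ->
  u = mc u e1 i j *: bas e1 i j + mc u e2 i j *: bas e2 i j.
Proof.
move=> ne lti ltj h; apply: mc_ext => e k l; rewrite mcD !mcZ !mc_bas.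
have [z|nz] := eqVneq (mc u e k l) 0; last first.
  have [he [-> ->]] := h _ _ _ nz.
  have d e' : [&& slot_eq e' e, (i < N1)%N, (j < N2)%N, i == i & j == j] = slot_eq e' e.
    by rewrite lti ltj !eqxx !andbT.
  rewrite !d; case: he => ->; first by rewrite slot_eqxx slot_eqC ne mulr1 mulr0 addr0.
  by rewrite slot_eqxx ne mulr1 mulr0 add0r.
have zz e' : mc u e' i j * [&& slot_eq e' e, (k < N1)%N, (l < N2)%N, k == i & l == j]%:R = 0.
  case: (boolP [&& _, _, _, _ & _]) => [/and5P[/slot_eqP-> _ _ /eqP<- /eqP<-]|_];
  by rewrite ?z ?mul0r ?mulr0.
by rewrite z !zz addr0.
Qed.

Lemma homog_hw al be (T : 'End(M)) d u : homog (wpi al be) T -> hw al be d u ->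
  hw al be d (T u).
Proof. by move=> hT /wpi_hw hu; apply/wpi_hw/hT. Qed.

Lemma homog_of_hw al be (T : 'End(M)) : (forall d u, hw al be d u -> hw al be d (T u)) ->
  homog (wpi al be) T.
Proof. by move=> hT d u /wpi_hw hu; apply/wpi_hw/hT. Qed.

Section OneGrading.
Variables (s : seq G) (P : G -> 'End(M)).
Hypothesis gr : is_ggrading s P.

(** Independence of characters recovers each projection from the automorphisms [qchar], so it is
    enough that these are filtered. *)
Lemma qchar_conj_fil al be :
  (forall chi, is_char chi -> forall v x, fil (wpi al be) v x -> fil (wpi al be) v (qchar s P chi x)) ->
  forall g v x, fil (wpi al be) v x -> fil (wpi al be) v (P g x).
Proof.
move=> hq g v x hx; case: (boolP (g \in s)) => [gs|/(grad_out gr)->]; last first.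
  by rewrite zero_lfunE; apply: fil0.
apply: (char_split (U := fil (wpi al be) v) (v := fun g => P g x) sep _ _ _ (grad_uniq gr)) gs.
- exact: fil0.
- by move=> y z; apply: filD.
- by move=> c y; apply: filZ.
move=> chi hc; have := hq chi hc v x hx; rewrite /qchar sum_lfunE.
by under eq_bigr => h _ do rewrite scale_lfunE.
Qed.

Lemma homogenize_std : exists u u', aut_pair (@mbr F n1 n2) u u' /\
  forall g, homog (wpi 1 1) (u' \o P g \o u)%VF.
Proof.
apply: (grading_homogenize hb (zg 1 1) sep gr); apply: qchar_conj_fil => chi hc.
have pq := qchar_aut hb gr hc; have [_ _ m] := pq.
have tq e : e = cE1 \/ e = cE2 ->
    fil (wpi 1 1) (wgt 1 1 e N1.-1 N2.-1) (qchar s P chi (bas e N1.-1 N2.-1)).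
  move=> he; have -> : wgt 1 1 e N1.-1 N2.-1 = 3 * (N1%:Z + N2%:Z) - 7.
    have := N1_ge5 n1_gt0; have := N2_ge5 n2_gt0; rewrite wgtE.
    by case: he => ->; rewrite /wt1 /wt2; lia.
  apply/(top_fil n1_gt0 n2_gt0)/(top_aut char5 n1_gt0 n2_gt0 pq) => e' i j.
  rewrite mc_bas; case: (boolP [&& _, _, _, _ & _]) => [|_]; last by rewrite eqxx.
  by move=> /and5P[/slot_eqP<- _ _ /eqP-> /eqP->].
(* [d_1] and [d_2] have the lowest degree, so the filtration imposes nothing on their images. *)
apply: (filtered_of_generators char5 n1_gt0 n2_gt0 m); try exact: (fil_bottom n1_gt0 n2_gt0).
  by apply: tq; left.
by apply: tq; right.
Qed.

Hypothesis hP : forall g, homog (wpi 1 1) (P g).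

Lemma qchar_homog chi : homog (wpi 1 1) (qchar s P chi).
Proof.
apply: homog_of_hw => d u hu; rewrite /qchar sum_lfunE => e i j; rewrite mc_sum.
case: (wgt 1 1 e i j =P d) => // ne /eqP[]; apply: big1 => g _.
rewrite scale_lfunE mcZ; have := homog_hw (hP g) hu (e := e) (i := i) (j := j).
by case: (eqVneq (mc (P g u) e i j) 0) => [->|_ /(_ isT)//]; rewrite mulr0.
Qed.

Lemma hw_m3 u : hw 1 1 (-3) u -> u = mc u cD1 0 0 *: bas cD1 0 0 + mc u cD2 0 0 *: bas cD2 0 0.
Proof.
move=> hu; apply: two_slots; rewrite ?expn_gt0 // => e i j /hu; rewrite wgtE.
case: e; rewrite /wt1 /wt2 => ee; try lia; (split; [by [left|right]|lia]).
Qed.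

Lemma hw_bas0 e d : wgt 1 1 e 0 0 = d -> hw 1 1 d (bas e 0 0).
Proof. by move=> <-; apply: hw_bas. Qed.

(* The characters preserve the refined filtration as soon as [d_1] is homogeneous. *)
Lemma homogenize_refined g : P g (bas cD1 0 0) = bas cD1 0 0 ->
  exists u u', aut_pair (@mbr F n1 n2) u u' /\
  forall g, homog (wpi (al1 n2) (be1 n2)) (u' \o P g \o u)%VF.
Proof.
move=> ed1; set al := al1 n2; set be := be1 n2.
have N1p := N1_ge5 n1_gt0; have N2p := N2_ge5 n2_gt0.
apply: (grading_homogenize hb (zg al be) sep gr); apply: qchar_conj_fil => chi hc.
have pq := qchar_aut hb gr hc; have qh := qchar_homog chi.
have qd1 := qchar_hom gr chi ed1; move: pq qh qd1.
move: (qchar s P chi) (qchar s P (inv_char chi)) (chi g) => q q' chig pq qh qd1.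
have [ck _ m] := pq.
have qn0 x : x != 0 -> q x != 0.
  by apply: contraNneq => z; rewrite -(ck x) z linear0.
have bn0 e : bas e 0 0 != 0.
  apply/eqP => /(congr1 (fun u => mc u e 0 0))/eqP; rewrite mc_bas mc0 !expn_gt0 /=.
  by rewrite slot_eqxx oner_eq0.
(* Degree [-2] contains only the multiples of 1; [cD1] merely fills the second place of
   [two_slots]. *)
have qone : exists2 mu, mu != 0 & q (bas cO 0 0) = mu *: bas cO 0 0.
  have hq := homog_hw qh (hw_bas0 (e := cO) (d := -2) erefl).
  have e1 : q (bas cO 0 0) = mc (q (bas cO 0 0)) cO 0 0 *: bas cO 0 0 +
      mc (q (bas cO 0 0)) cD1 0 0 *: bas cD1 0 0.
    apply: two_slots; rewrite ?expn_gt0 // => e i j /hq; rewrite wgtE.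
    by case: e; rewrite /wt1 /wt2 => ee; try lia; (split; [by [left|right]|lia]).
  have z : mc (q (bas cO 0 0)) cD1 0 0 = 0.
    by apply/eqP; apply: wlog_neg => /hq; rewrite wgtE.
  rewrite z scale0r addr0 in e1; exists (mc (q (bas cO 0 0)) cO 0 0) => //.
  by apply: contraNneq (qn0 _ (bn0 cO)) => z0; rewrite e1 z0 scale0r.
have [mu mu0 q1] := qone.
have qt1 : exists2 a, a != 0 & q (bas cE1 0 0) = a *: bas cE1 0 0.
  have hq := homog_hw qh (hw_bas0 (e := cE1) (d := -1) erefl).
  have e1 : q (bas cE1 0 0) = mc (q (bas cE1 0 0)) cE1 0 0 *: bas cE1 0 0 +
      mc (q (bas cE1 0 0)) cE2 0 0 *: bas cE2 0 0.
    apply: two_slots; rewrite ?expn_gt0 // => e i j /hq; rewrite wgtE.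
    by case: e; rewrite /wt1 /wt2 => ee; try lia; (split; [by [left|right]|lia]).
  set a := mc _ cE1 0 0 in e1; set b := mc _ cE2 0 0 in e1.
  (* Since [d_1 = [1, d~_1]] is only rescaled, the image of [d~_1] has no [d~_2]-part. *)
  have e2 : chig *: bas cD1 0 0 = (mu * a) *: bas cD1 0 0 + (mu * b) *: bas cD2 0 0.
    rewrite -qd1 -(br_one_t1 n1 n2 char5 0 0) m q1 e1 (brZl hb) (brDr hb) !(brZr hb).
    by rewrite br_one_t1 // br_one_t2 // scalerDr !scalerA.
  have b0 : b = 0.
    have e3 := congr1 (fun u => mc u cD2 0 0) e2.
    rewrite /= [LHS]mcZ [RHS]mcD [X in _ = X + _]mcZ [X in _ = _ + X]mcZ in e3.
    move/eqP: e3; rewrite !mc_bas !expn_gt0 /= !mulr0 mulr1 add0r eq_sym mulf_eq0.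
    by rewrite (negbTE mu0) => /eqP.
  exists a; last by rewrite e1 b0 scale0r addr0.
  by apply: contraNneq (qn0 _ (bn0 cE1)) => z0; rewrite e1 z0 b0 !scale0r addr0.
have [a a0 qt] := qt1.
pose w0 := 3 * (N1%:Z + N2%:Z) - 7.
have htop e : e = cE1 \/ e = cE2 -> q (bas e N1.-1 N2.-1) =
    mc (q (bas e N1.-1 N2.-1)) cE1 N1.-1 N2.-1 *: bas cE1 N1.-1 N2.-1 +
    mc (q (bas e N1.-1 N2.-1)) cE2 N1.-1 N2.-1 *: bas cE2 N1.-1 N2.-1.
  move=> he; apply: two_slots => //; try lia.
  apply: (top_aut char5 n1_gt0 n2_gt0 pq) => e' i j.
  rewrite mc_bas; case: (boolP [&& _, _, _, _ & _]) => [|_]; last by rewrite eqxx.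
  by move=> /and5P[/slot_eqP<- _ _ /eqP-> /eqP->].
have fb e i j : fil (wpi al be) (wgt al be e i j) (bas e i j).
  by apply: (fil_hom (zg al be)) (lexx _); apply/wpi_hw/hw_bas.
have al_gt0 : 0 < al by rewrite /al /al1; lia.
apply: (filtered_of_generators char5 n1_gt0 n2_gt0 m).
- by rewrite qd1; apply/filZ/fb.
(* A [d_1]-part is allowed here, because [d_1] has a larger weight than [d_2]. *)
- rewrite (hw_m3 (homog_hw qh (hw_bas0 (e := cD2) (d := -3) erefl))).
  apply: filD; apply: filZ; last exact: fb.
  by apply: fil_le (fb cD1 0 0)%N; rewrite !wgtE /wt1 /wt2 /be /be1 -/al; lia.
- have et := htop cE1 (or_introl erefl); set c := mc _ cE1 _ _ in et; set d := mc _ cE2 _ _ in et.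
  (* [d~_1] is rescaled and commutes with the top monomial of its own slot, whereas it sends that of
     [d~_2] to the nonzero top monomial of [O]. *)
  have d0 : d = 0.
    have z : mbr (bas cE1 0 0) (bas cE1 N1.-1 N2.-1) = 0.
      apply: co_ext => e; rewrite co_br_t1 // co0.
      by case: e; rewrite /= ?(partial10, partial20, addr0, subr0, scaler0, oppr0).
    have := m (bas cE1 0 0) (bas cE1 N1.-1 N2.-1); rewrite z linear0 qt et (brZl hb).
    rewrite (brDr hb) !(brZr hb) z scaler0 add0r br_t1_t2 // => /esym/eqP.
    rewrite scalerA scaler_eq0 mulf_eq0 (negbTE a0) /= => /orP[/eqP//|/eqP].
    move/(congr1 (fun u => mc u cO N1.-1 N2.-1))/eqP; rewrite mc_bas mc0 !eqxx /=.
    by rewrite !prednK ?expn_gt0 // !leqnn /= oner_eq0.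
  by rewrite et d0 scale0r addr0; apply/filZ/fb.
(* Conversely, the top vector in the slot [d~_1] is heavier by 3 and may appear. *)
- rewrite (htop cE2 (or_intror erefl)); apply: filD; apply: filZ; last exact: fb.
  by apply: fil_le (fb cE1 N1.-1 N2.-1); rewrite !wgtE /wt1 /wt2 /be /be1 -/al; lia.
Qed.

End OneGrading.
End Homogenization.

Lemma iter_brZ (F : fieldType) (V : vectType F) (br : V -> V -> V) (hb : bilinear_br br)
  (w x : V) c k : iter k (br w) (c *: x) = c *: iter k (br w) x.
Proof. by elim: k => //= k ->; rewrite (brZr hb). Qed.

Lemma homogeneous_of_line (F : fieldType) (V : vectType F) (br : V -> V -> V) (I : eqType)
  (op : I -> I -> I) (s : seq I) (P : I -> 'End(V)) (gr : grading_by br op s P) (x : V) :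
  x != 0 -> (forall g, exists c, P g x = c *: x) -> exists g, P g x = x.
Proof.
move=> x0 line; have [g ng] : exists g, P g x != 0.
  have /hasP[g _ ng] : has (fun g => P g x != 0) s; last by exists g.
  apply: contraNT x0 => /hasPn no; apply/eqP/(grad_eq0 gr) => g.
  case: (boolP (g \in s)) => [/no/negPn/eqP//|/(grad_out gr)->].
  by rewrite zero_lfunE.
exists g; have [c ec] := line g.
have c0 : c != 0 by apply: contraNneq ng => z; rewrite ec z scale0r.
have := grad_id gr g x; rewrite ec linearZ /= ec scalerA => /eqP.
rewrite -subr_eq0 -scalerBl scaler_eq0 (negbTE x0) orbF -{3}[c]mulr1 -mulrBr mulf_eq0.
by rewrite (negbTE c0) subr_eq0 => /eqP->; rewrite scale1r.
Qed.

(** * Making the first derivation homogeneous *)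

Section FirstDerivation.
Variables (F : closedFieldType) (n1 n2 : nat).
Hypothesis char5 : 5%N \in [pchar F].
Hypotheses (n1_gt0 : (0 < n1)%N) (n2_gt0 : (0 < n2)%N) (n12 : (n1 < n2)%N).
Local Notation N1 := (5 ^ n1)%N.
Local Notation N2 := (5 ^ n2)%N.
Local Notation M := (Melikyan F n1 n2).
Local Notation bas := (bas F n1 n2).
Local Notation wpi := (wpi F n1 n2).
Let hb : bilinear_br (@mbr F n1 n2) := mbr_bilinear n1 n2 char5.

Lemma iter_d1 u : iter N1 (mbr (bas cD1 0 0)) u = 0.
Proof.
apply: mc_ext => e i j; rewrite mc0.
suff h k l : mc (iter k (mbr (bas cD1 0 0)) u) e l j = mc u e (l + k) j.
  by rewrite h mc_out // negb_and -leqNgt leq_addl.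
elim: k l => [|k IH] l; first by rewrite addn0.
by rewrite iterS mc_br_d1 // IH addSnnS.
Qed.

Lemma iter_constant a b k l : (l + k < N2)%N ->
  iter k (mbr (a *: bas cD1 0 0 + b *: bas cD2 0 0)) (bas cO 0 (l + k)) =
  b ^+ k *: bas cO 0 l.
Proof.
elim: k => [|k IH] lt; first by rewrite addn0 scale1r.
have z : mbr (bas cD1 0 0) (bas cO 0 (l + k.+1)) = 0.
  apply: co_ext => e; rewrite co_br_d1 // co_mk co0.
  by case: slot_eq; rewrite ?partial1_mon0 ?partial10.
rewrite iterSr (brDl hb) !(brZl hb) z scaler0 add0r addnS br_d2_bas //; last by rewrite -addnS.
rewrite (iter_brZ hb) IH ?scalerA -?exprS //.
by rewrite addnS in lt; apply: ltnW.
Qed.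

Variable G : groupType.
Hypothesis sep : chars_separate F G.
Variables (s : seq G) (P : G -> 'End(M)).
Hypothesis gr : is_ggrading s P.
Hypothesis hP : forall g, homog (wpi 1 1) (P g).

(* [ad (a d_1 + b d_2)] is nilpotent of order [5 ^ n1] only if [b = 0]. *)
Lemma d1_homogeneous : exists g, P g (bas cD1 0 0) = bas cD1 0 0.
Proof.
apply: (homogeneous_of_line gr).
  apply/eqP => /(congr1 (fun u => mc u cD1 0 0))/eqP.
  by rewrite mc_bas mc0 !expn_gt0 /= oner_eq0.
move=> g; case: (boolP (g \in s)) => [gs|/(grad_out gr)->]; last first.
  by exists 0; rewrite zero_lfunE scale0r.
pose U (y : M) := exists c, y = c *: bas cD1 0 0.
apply: (char_split (U := U) (v := fun g => P g (bas cD1 0 0)) sep _ _ _ (grad_uniq gr)) gs.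
- by exists 0; rewrite scale0r.
- by move=> y z [c ->] [d ->]; exists (c + d); rewrite scalerDl.
- by move=> c y [d ->]; exists (c * d); rewrite scalerA.
move=> chi hc; have pq := qchar_aut hb gr hc; have qh := qchar_homog s hP chi.
suff : U (qchar s P chi (bas cD1 0 0)).
  by rewrite /qchar sum_lfunE; under eq_bigr => h _ do rewrite scale_lfunE.
move: pq qh; move: (qchar s P chi) (qchar s P (inv_char chi)) => q q' pq qh.
have [ck ck' m] := pq.
have hq := homog_hw qh (hw_bas0 (e := cD1) (d := -3) erefl).
have eq1 := hw_m3 n1_gt0 n2_gt0 hq; set a := mc _ cD1 _ _ in eq1; set b := mc _ cD2 _ _ in eq1.
have it k x : q (iter k (mbr (bas cD1 0 0)) x) = iter k (mbr (q (bas cD1 0 0))) (q x).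
  by elim: k => //= k <-; rewrite m.
(* The test vector [x^(0, N1)] exists because [n1 < n2]; the [N1]-th power of [a d_1 + b d_2] sends
   it to [b ^+ N1] times 1. *)
have := it N1 (q' (bas cO 0 N1)); rewrite iter_d1 linear0 ck' eq1.
rewrite -[X in bas cO 0 X]add0n iter_constant ?add0n; last by rewrite ltn_exp2l.
move=> /esym/eqP; rewrite scaler_eq0 expf_eq0 expn_gt0 /= => /orP[/eqP b0|/eqP].
  by exists a; rewrite b0 scale0r addr0.
move/(congr1 (fun u => mc u cO 0 0))/eqP; rewrite mc_bas mc0 !expn_gt0 /=.
by rewrite oner_eq0.
Qed.

End FirstDerivation.

Section EqualHeights.
Variables (F : closedFieldType) (n : nat).
Hypothesis char5 : 5%N \in [pchar F].
Hypothesis n_gt0 : (0 < n)%N.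
Local Notation M := (Melikyan F n n).
Local Notation bas := (bas F n n).
Local Notation wpi := (wpi F n n).

Lemma swap_aut : aut_pair (@mbr F n n) (linfun (@swap F n n)) (linfun (@swap F n n)).
Proof. by split=> x; rewrite ?lfunE /= ?swapK // => y; rewrite !lfunE /= swap_mbr. Qed.

Lemma swap_homog : homog (wpi 1 1) (linfun (@swap F n n)).
Proof.
apply: (homog_of_hw) => d u hu e i j; rewrite lfunE /mc /= co_swap.
case: e; rewrite ?cfN ?oppr_eq0 cf_oswap; [move/(hu cO)|move/(hu cD2)|move/(hu cD1)|
  move/(hu cE2)|move/(hu cE1)]; by rewrite !wgtE /wt1 /wt2; lia.
Qed.

Lemma shear_aut lam :
  aut_pair (@mbr F n n) (linfun (@shear F n n lam)) (linfun (@shear F n n (- lam))).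
Proof.
split=> x; rewrite ?lfunE /= ?lfunE /=; first exact: shearK.
  by rewrite -{1}[lam]opprK; apply: shearK.
by move=> y; rewrite !lfunE /=; apply: shear_mbr.
Qed.

Lemma shear_homog lam : homog (wpi 1 1) (linfun (@shear F n n lam)).
Proof.
have nz (f : O2 F n n) i j : cf (oshear lam f) i j != 0 ->
    exists2 l, (l <= j)%N & cf f (i + l) (j - l) != 0.
  case: (ltnP j (5 ^ n)) => ltj; last by rewrite cf_out ?eqxx // negb_and -!leqNgt ltj orbT.
  rewrite cf_oshear // => nz.
  case: (boolP [exists l : 'I_j.+1, cf f (i + l) (j - l) != 0]) => [/existsP[l hl]|/existsPn no].
    by exists l => //; rewrite -ltnS.
  case/eqP: nz; apply: big1 => l _; have /negPn/eqP-> := no l; exact: mulr0.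
have nz2 (f g : O2 F n n) i j : cf (oshear lam f - lam *: oshear lam g) i j != 0 ->
    exists2 l, (l <= j)%N & (cf f (i + l) (j - l) != 0) || (cf g (i + l) (j - l) != 0).
  rewrite cfB cfZ; case: (eqVneq (cf (oshear lam f) i j) 0) => [->|/nz[l ll hl] _].
    by rewrite sub0r oppr_eq0 mulf_eq0 negb_or => /andP[_ /nz[l ll hl]]; exists l; rewrite ?hl ?orbT.
  by exists l; rewrite ?hl.
apply: (homog_of_hw) => d u hu e i j; rewrite lfunE /mc /= co_shear.
case: e => [/nz[l ll /(hu cO)]|/nz2[l ll /orP[/(hu cD1)|/(hu cD2)]]|/nz[l ll /(hu cD2)]|
  /nz2[l ll /orP[/(hu cE1)|/(hu cE2)]]|/nz[l ll /(hu cE2)]]; by rewrite !wgtE /wt1 /wt2; lia.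
Qed.

Lemma swap_d1 : swap (bas cD1 0 0) = bas cD2 0 0.
Proof. by rewrite swap_bas scale1r. Qed.

Lemma shear_d2 lam : shear lam (bas cD2 0 0) = bas cD2 0 0 - lam *: bas cD1 0 0.
Proof.
have e0 : oshear lam (mon F n n 0 0) = mon F n n 0 0.
  apply: cf_ext => i; elim: i => [|i IH] j; last first.
    by rewrite -!cf_partial1 oshear_partial1 partial1_mon0 oshear0.
  case: j => [|j]; first by rewrite cf00_oshear.
  by rewrite -!cf_partial2 oshear_partial2 // partial1_mon0 partial2_mon0 !oshear0 scaler0 addr0.
apply: co_ext => e; rewrite co_shear coD coN coZ.
by case: e; rewrite /= ?oshear0 ?e0 ?scaler0 ?oppr0 ?subr0 ?addr0 ?add0r ?sub0r.
Qed.

Lemma shear_line a b : b != 0 ->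
  shear (- (a / b)) (bas cD2 0 0) = b^-1 *: (a *: bas cD1 0 0 + b *: bas cD2 0 0).
Proof.
move=> b0; rewrite shear_d2; move: (bas cD1 0 0) (bas cD2 0 0) => x y.
rewrite scaleNr opprK scalerDr !scalerA mulVf // scale1r addrC.
by rewrite [b^-1 * a]mulrC.
Qed.

Variable G : groupType.
Variables (s : seq G) (P : G -> 'End(M)).
Hypothesis gr : is_ggrading s P.
Hypothesis hP : forall g, homog (wpi 1 1) (P g).

(** The projections sum to the identity, so some [P g] sends [d_2] to [a d_1 + b d_2] with [b != 0].
    A shear takes [d_2] to a multiple of this homogeneous vector, and the exchange of variables
    takes [d_1] to [d_2]. *)
Lemma straighten_d1 : exists u u', [/\ aut_pair (@mbr F n n) u u',
  (forall g, homog (wpi 1 1) (u' \o P g \o u)%VF) &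
  exists g, (u' \o P g \o u)%VF (bas cD1 0 0) = bas cD1 0 0].
Proof.
have [g ng] : exists g, mc (P g (bas cD2 0 0)) cD2 0 0 != 0.
  have /hasP[g _ ng] : has (fun g => mc (P g (bas cD2 0 0)) cD2 0 0 != 0) s; last by exists g.
  apply/negPn/negP => /hasPn no.
  have := mc_bas F n n cD2 0 0 cD2 0 0; rewrite -[X in mc X](grad_sum gr) mc_sum.
  rewrite big_seq big1 => [|g /no/negPn/eqP//].
  by rewrite !expn_gt0 /= => /esym/eqP; rewrite oner_eq0.
set v := P g (bas cD2 0 0) in ng.
have hv : hw 1 1 (-3) v := homog_hw (hP g) (hw_bas0 (e := cD2) (d := -3) erefl).
have ev := hw_m3 n_gt0 n_gt0 hv; set a := mc v cD1 0 0 in ev; set b := mc v cD2 0 0 in ev ng.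
pose lam := - (a / b).
pose U := linfun (@shear F n n lam); pose U' := linfun (@shear F n n (- lam)).
pose W := linfun (@swap F n n).
have pU : aut_pair (@mbr F n n) U U' := shear_aut lam.
exists (U \o W)%VF, (W \o U')%VF; split.
- exact: aut_pair_comp pU swap_aut.
- by move=> h; do !apply: homog_mul => //; first [exact: swap_homog|exact: shear_homog].
exists g; have [_ cU _] := pU.
rewrite !comp_lfunE [W (bas _ _ _)]lfunE /= swap_d1.
have eU : U (bas cD2 0 0) = b^-1 *: v by rewrite [LHS]lfunE [LHS](shear_line a ng) -ev.
have [cU1 _ _] := pU.
rewrite eU linearZ /= [P g v](grad_id gr) -eU cU1.
by rewrite lfunE /= -swap_d1 swapK.
Qed.

End EqualHeights.

(** * Degrees of monomials as integer combinations of two of them *)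

(** Additive notation makes integer multiples of degrees and their arithmetic available. *)
Definition additive_group (G : groupType) (abG : forall g h : G, (g * h = h * g)%g) : Type := G.

Section AdditiveGroup.
Variables (G : groupType) (abG : forall g h : G, (g * h = h * g)%g).
HB.instance Definition _ := Choice.on (additive_group abG).
HB.instance Definition _ := GRing.isZmodule.Build (additive_group abG)
  (@mulgA G) abG (@mul1g G) (@mulVg G).
End AdditiveGroup.

(* The coordinates of the degree of [e] in the basis of [Z^2] given by the degrees
   of [d_1] and 1 *)
Definition slot_d (e : slot) : int :=
  match e with cO => 0 | cD1 => 1 | cD2 => -1 | cE1 => 1 | cE2 => -1 end.
Definition slot_o (e : slot) : int :=
  match e with cO => 1 | cD1 => 0 | cD2 => 3 | cE1 => -1 | cE2 => 2 end.

Section Degrees.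
Variables (F : closedFieldType) (n1 n2 : nat).
Hypothesis char5 : 5%N \in [pchar F].
Hypotheses (n1_gt0 : (0 < n1)%N) (n2_gt0 : (0 < n2)%N).
Local Notation N1 := (5 ^ n1)%N.
Local Notation N2 := (5 ^ n2)%N.
Local Notation M := (Melikyan F n1 n2).
Local Notation bas := (bas F n1 n2).
Variables (G : groupType) (abG : forall g h : G, (g * h = h * g)%g).
Local Notation A := (additive_group abG).
Variables (s : seq G) (P : G -> 'End(M)).
Hypothesis gr : is_ggrading s P.
Variable ge : slot -> G.
Hypothesis hge : forall e, P (ge e) (bas e 0 0) = bas e 0 0.

Lemma bas_neq0 e i j : (i < N1)%N -> (j < N2)%N -> bas e i j != 0.
Proof.
move=> lti ltj; apply/eqP => /(congr1 (fun u => mc u e i j))/eqP.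
by rewrite mc_bas mc0 lti ltj slot_eqxx !eqxx /= oner_eq0.
Qed.

Let deg_unique (g h : G) (x : M) : P g x = x -> P h x = x -> x != 0 -> g = h.
Proof.
move=> eg eh x0; apply/eqP; apply: contraNT x0 => ne.
by rewrite -eg -eh (grad_proj gr) (negbTE ne).
Qed.

Definition nf (m n : int) : A := (ge cD1 : A) *~ m + (ge cO : A) *~ n.

Lemma nfD m n m' n' : nf m n + nf m' n' = nf (m + m') (n + n').
Proof. by rewrite /nf !mulrzDr addrACA. Qed.
Lemma nfN m n : - nf m n = nf (- m) (- n).
Proof. by rewrite /nf opprD !mulrNz. Qed.
Lemma nf_nat m n k : nf m n *+ k = nf (m * k%:Z) (n * k%:Z).
Proof. by rewrite /nf mulrnDl !pmulrn -!mulrzA. Qed.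

Let bn0 e : bas e 0 0 != 0. Proof. by rewrite bas_neq0 ?expn_gt0. Qed.

(** The relations are [[d~_1, d~_2] = 1], [[1, d~_1] = d_1] and [[1, d~_2] = d_2]. *)
Lemma slot_degree e : ge e = nf (slot_d e) (slot_o e) :> A.
Proof.
have eo : ge cO = (ge cE1 : A) + (ge cE2 : A).
  apply: (deg_unique (hge cO)) (bn0 cO).
  by have := grad_br gr (hge cE1) (hge cE2); rewrite br_t1_t2.
have e1 : ge cD1 = (ge cO : A) + (ge cE1 : A).
  apply: (deg_unique (hge cD1)) (bn0 cD1).
  by have := grad_br gr (hge cO) (hge cE1); rewrite br_one_t1.
have e2 : ge cD2 = (ge cO : A) + (ge cE2 : A).
  apply: (deg_unique (hge cD2)) (bn0 cD2).
  by have := grad_br gr (hge cO) (hge cE2); rewrite br_one_t2.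
have f1 : (ge cE1 : A) = nf 1 (-1) by rewrite /nf mulr1z mulrN1z e1 addrAC subrr add0r.
have f2 : (ge cE2 : A) = nf (-1) 2.
  have -> : (ge cE2 : A) = (ge cO : A) - (ge cE1 : A) by rewrite eo addrAC subrr add0r.
  rewrite f1 nfN -[ge cO : A](_ : nf 0 1 = _); last by rewrite /nf mulr0z mulr1z add0r.
  by rewrite nfD.
have fO : (ge cO : A) = nf 0 1 by rewrite /nf mulr0z mulr1z add0r.
case: e => //=; first by rewrite /nf mulr0z mulr1z addr0.
by rewrite e2 fO f2 nfD.
Qed.

Lemma lower_degree (g : G) z i j : P g z = z ->
  P ((ge cD1 : A) *+ i + ((ge cD2 : A) *+ j + (g : A))) (lower i j z) = lower i j z.
Proof.
move=> ez; rewrite /lower foldr_cat; elim: i => [|i IH].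
  rewrite mulr0n add0r /=; elim: j => [|j IH]; first by rewrite mulr0n add0r.
  by rewrite mulrS -addrA; apply: (grad_br gr (hge cD2) IH).
by rewrite mulrS -addrA; apply: (grad_br gr (hge cD1) IH).
Qed.

(** Lowering shifts the degree by [i] times that of [d_1] and [j] times that of [d_2], and ends in a
    constant whose degree is known. *)
Lemma degree_formula (g : G) z e i j c : P g z = z -> lower i j z = c *: bas e 0 0 ->
  c != 0 -> g = nf (slot_d e - i%:Z + j%:Z) (slot_o e - 3 * j%:Z).
Proof.
move=> ez el c0; have := lower_degree i j ez; rewrite el => h.
have h' : P (ge e) (c *: bas e 0 0) = c *: bas e 0 0 by rewrite linearZ /= hge.
have cn : c *: bas e 0 0 != 0 by rewrite scaler_eq0 negb_or c0 bn0.
have ee := deg_unique h h' cn.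
have -> : g = (ge e : A) - (ge cD1 : A) *+ i - (ge cD2 : A) *+ j.
  by rewrite -[ge e : A]ee [X in X - _ - _]addrC addrK addrC addKr.
rewrite !(slot_degree) !nf_nat !nfN !nfD; congr nf; rewrite /slot_d /slot_o; lia.
Qed.

Lemma degree_bas (g : G) e i j : (i < N1)%N -> (j < N2)%N -> P g (bas e i j) = bas e i j ->
  g = nf (slot_d e - i%:Z + j%:Z) (slot_o e - 3 * j%:Z).
Proof.
move=> lti ltj ez; apply: (degree_formula ez _ (oner_neq0 F)); rewrite scale1r.
apply: mc_ext => e' k l; rewrite mc_lower // !mc_bas.
congr (nat_of_bool (_ && _))%:R.
have -> : (k + i == i)%N = (k == 0)%N by rewrite -{2}[i]add0n eqn_add2r.
have -> : (l + j == j)%N = (l == 0)%N by rewrite -{2}[j]add0n eqn_add2r.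
case: eqP => [->|_]; last by rewrite !andbF.
case: eqP => [->|_]; last by rewrite !andbF.
by rewrite !add0n lti ltj !expn_gt0.
Qed.

End Degrees.

Section Monomials.
Variables (F : closedFieldType) (n1 n2 : nat).
Hypothesis char5 : 5%N \in [pchar F].
Hypotheses (n1_gt0 : (0 < n1)%N) (n2_gt0 : (0 < n2)%N).
Local Notation N1 := (5 ^ n1)%N.
Local Notation N2 := (5 ^ n2)%N.
Local Notation M := (Melikyan F n1 n2).
Local Notation bas := (bas F n1 n2).
Local Notation wpi := (wpi F n1 n2).
Variables (G : groupType) (abG : forall g h : G, (g * h = h * g)%g).
Variables (s : seq G) (P : G -> 'End(M)).
Hypothesis gr : is_ggrading s P.

Definition monomial_grading : Prop := forall e i j, (i < N1)%N -> (j < N2)%N ->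
  exists g, P g (bas e i j) = bas e i j.

Hypothesis hP : forall g, homog (wpi (al1 n2) (be1 n2)) (P g).

Let same_degree g e i j e' k l : (j < N2)%N -> mc (P g (bas e i j)) e' k l != 0 ->
  3 * k%:Z + wt1 e' = 3 * i%:Z + wt1 e /\ 3 * l%:Z + wt2 e' = 3 * j%:Z + wt2 e.
Proof.
move=> ltj nz; have /andP[_ ltl] := mc_in nz.
have h : wgt (al1 n2) (be1 n2) e' k l = wgt (al1 n2) (be1 n2) e i j.
  by have := homog_hw (hP g) (@hw_bas F n1 n2 (al1 n2) (be1 n2) e i j); apply.
exact: (wgt_inj F n1_gt0 n2_gt0 ltl ltj h).
Qed.

Lemma refined_monomials : monomial_grading.
Proof.
(* The Z^2-degree of each constant basis vector has a one-dimensional component. *)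
have lines e : exists g, P g (bas e 0 0) = bas e 0 0.
  apply: (homogeneous_of_line gr); first by rewrite bas_neq0 ?expn_gt0.
  move=> g; exists (mc (P g (bas e 0 0)) e 0 0); apply: mc_ext => e' k l; rewrite mcZ mc_bas.
  case: (eqVneq (mc (P g (bas e 0 0)) e' k l) 0) => [z|nz].
    case: (boolP [&& _, _, _, _ & _]) => [/and5P[/slot_eqP ee _ _ /eqP ek /eqP el]|_];
      last by rewrite mulr0.
    by move: z; rewrite ee ek el => ->; rewrite mul0r.
  have [] := same_degree (expn_gt0 5 n2 : (0 < N2)%N) nz.
  move=> h1 h2; have [ee [ek el]] : e' = e /\ (k = 0%N /\ l = 0%N).
    by case: (e) (e') h1 h2 => -[]; rewrite /wt1 /wt2 => h1 h2; (split; [by [] || lia|lia]) || lia.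
  by rewrite ee ek el slot_eqxx !expn_gt0 !eqxx mulr1.
have [ge hge] : exists ge : slot -> G, forall e, P (ge e) (bas e 0 0) = bas e 0 0.
  have [[gO hO] [g1 h1]] := (lines cO, lines cD1); have [g2 h2] := lines cD2.
  have [[g3 h3] [g4 h4]] := (lines cE1, lines cE2).
  exists (fun e => match e with cO => gO | cD1 => g1 | cD2 => g2 | cE1 => g3 | cE2 => g4 end).
  by case.
move=> e i j lti ltj.
(* A component of Z^2-degree may be two-dimensional, but its basis vectors give the same normal
   form; so only one [g] can occur. *)
have deg g : P g (bas e i j) != 0 ->
    g = nf abG ge (slot_d e - i%:Z + j%:Z) (slot_o e - 3 * j%:Z).
  move=> nz; have [e' [k [l nz']]] := mc_neq0 nz.
  have hz := homog_hw (hP g) (@hw_bas F n1 n2 (al1 n2) (be1 n2) e i j).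
  rewrite (degree_formula char5 n1_gt0 n2_gt0 abG gr hge (grad_id gr g _)
    (lower_all char5 n1_gt0 n2_gt0 hz nz') nz').
  have [h1 h2] := same_degree ltj nz'.
  by case: (e) (e') h1 h2 => -[]; rewrite /wt1 /wt2 /slot_d /slot_o => h1 h2; congr nf; lia.
have [g ng] : exists g, P g (bas e i j) != 0.
  have /hasP[g _ ng] : has (fun g => P g (bas e i j) != 0) s; last by exists g.
  apply: contraTT (bas_neq0 F e lti ltj) => /hasPn no; rewrite negbK.
  by apply/eqP; rewrite -[LHS](grad_sum gr) big_seq big1 // => g /no/negPn/eqP.
exists g; rewrite -[RHS](grad_sum gr) (sum_pick (grad_uniq gr) (e := g)) //.
  move=> h hg; apply/eqP; apply: contraNT hg => nh; apply/eqP.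
  by rewrite (deg _ nh) (deg _ ng).
by move=> /(grad_out gr)->; rewrite zero_lfunE.
Qed.

End Monomials.

(** * Reduction to a grading in which all monomials are homogeneous *)

Section Normalization.
Variables (F : closedFieldType).
Hypothesis char5 : 5%N \in [pchar F].
Variables (G : groupType) (abG : forall g h : G, (g * h = h * g)%g).
Hypothesis sep : chars_separate F G.

Definition normalizable n1 n2 (P : G -> 'End(Melikyan F n1 n2)) : Prop :=
  exists u u', aut_pair (@mbr F n1 n2) u u' /\ monomial_grading (fun g => u' \o P g \o u)%VF.

Lemma normalizable_conj n1 n2 (P : G -> 'End(Melikyan F n1 n2)) u u' :
  aut_pair (@mbr F n1 n2) u u' -> normalizable (fun g => u' \o P g \o u)%VF -> normalizable P.
Proof.
move=> pu [v [v' [pv mv]]]; exists (u \o v)%VF, (v' \o u')%VF; split.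
  exact: aut_pair_comp.
move=> e i j lti ltj; have [g hg] := mv e i j lti ltj; exists g.
by rewrite -[RHS]hg !comp_lfunE.
Qed.

Lemma normalizable_le n1 n2 s (P : G -> 'End(Melikyan F n1 n2)) :
  (0 < n1)%N -> (n1 <= n2)%N -> is_ggrading s P -> normalizable P.
Proof.
move=> n1_gt0 le12 gr; have n2_gt0 : (0 < n2)%N by apply: leq_trans le12.
have [u [u' [pu hu]]] := homogenize_std char5 n1_gt0 n2_gt0 sep gr.
apply: (normalizable_conj pu).
pose P0 g := (u' \o P g \o u)%VF.
have [gr1 h1] : is_ggrading s P0 /\ forall g, homog (wpi F n1 n2 1 1) (P0 g).
  by split; [exact: (grad_conj gr (aut_pair_inv pu))|exact: hu].
rewrite -/P0; move: P0 gr1 h1 => P1 gr1 h1 {u u' pu hu gr P}.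
have [P2 [gr2 h2 [g hg] back]] : exists P2, [/\ is_ggrading s P2,
    (forall g, homog (wpi F n1 n2 1 1) (P2 g)),
    (exists g, P2 g (bas F n1 n2 cD1 0 0) = bas F n1 n2 cD1 0 0)
    & normalizable P2 -> normalizable P1].
  case: (ltngtP n1 n2) le12 => // [lt12|e12] _.
    by exists P1; split=> //; apply: (d1_homogeneous char5 n1_gt0 n2_gt0 lt12 sep gr1 h1).
  move: P1 gr1 h1; rewrite -e12 => P1 gr1 h1.
  have [u [u' [pu hu hg]]] := straighten_d1 char5 n1_gt0 gr1 h1.
  exists (fun g => u' \o P1 g \o u)%VF; split=> //; last exact: normalizable_conj.
  exact: (grad_conj gr1 (aut_pair_inv pu)).
have [u [u' [pu hu]]] := homogenize_refined char5 n1_gt0 n2_gt0 sep gr2 h2 hg.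
apply: back; exists u, u'; split=> //.
exact: (refined_monomials char5 n1_gt0 n2_gt0 abG (grad_conj gr2 (aut_pair_inv pu)) hu).
Qed.

Lemma normalizable_all n1 n2 s (P : G -> 'End(Melikyan F n1 n2)) :
  (0 < n1)%N -> (0 < n2)%N -> is_ggrading s P -> normalizable P.
Proof.
move=> n1_gt0 n2_gt0 gr; case: (leqP n1 n2) => [le12|/ltnW le21].
  exact: (normalizable_le n1_gt0 le12 gr).
(* For [n2 < n1] the grading is carried to the algebra with exchanged heights, normalized there, and
   carried back. *)
pose W : 'Hom(Melikyan F n1 n2, Melikyan F n2 n1) := linfun (@swap F n1 n2).
pose W' : 'Hom(Melikyan F n2 n1, Melikyan F n1 n2) := linfun (@swap F n2 n1).
have WE x : W x = swap x by rewrite lfunE.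
have WE' x : W' x = swap x by rewrite lfunE.
have K x : W' (W x) = x by rewrite WE' WE swapK.
have K' x : W (W' x) = x by rewrite WE WE' swapK.
have Wbr x y : W (mbr x y) = mbr (W x) (W y) by rewrite !WE (swap_mbr char5).
have Wbr' x y : W' (mbr x y) = mbr (W' x) (W' y) by rewrite !WE' (swap_mbr char5).
have gr' : is_ggrading s (fun g => W \o P g \o W')%VF.
  split; first exact: (grad_uniq gr).
  - by move=> g out; rewrite (grad_out gr out) comp_lfun0r comp_lfun0l.
  - move=> x; under eq_bigr => g _ do rewrite !comp_lfunE.
    by rewrite -(linear_sum W) (grad_sum gr); exact: K'.
  - move=> g h x; rewrite !comp_lfunE K (grad_proj gr).
    by case: ifP => // _; rewrite linear0.
  - move=> g h x y; rewrite !comp_lfunE => ex ey.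
    have ex' : P g (W' x) = W' x by rewrite -[in RHS]ex K.
    have ey' : P h (W' y) = W' y by rewrite -[in RHS]ey K.
    by rewrite Wbr' (grad_br gr ex' ey') Wbr !K'.
have [u [u' [[c c' m] mon]]] := normalizable_le n2_gt0 le21 gr'.
exists (W' \o u \o W)%VF, (W' \o u' \o W)%VF; split.
  split=> [x|x|x y]; rewrite !comp_lfunE ?K' ?c ?c' ?K //.
  by rewrite Wbr m Wbr'.
move=> e i j lti ltj; have [g] := mon (swap_slot e) j i ltj lti.
set T := (u' \o _ \o u)%VF => hg; exists g.
have eW := swap_bas F n1 n2 e i j; rewrite -WE in eW.
have eT : T (W (bas F n1 n2 e i j)) = W (bas F n1 n2 e i j) by rewrite eW linearZ /= hg.
by rewrite -[RHS]K -eT /T !comp_lfunE.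
Qed.

End Normalization.

(** * Comparison with the standard gradings *)

Section StandardDegrees.
Variables (F : fieldType) (n1 n2 : nat).
Local Notation N1 := (5 ^ n1)%N.
Local Notation N2 := (5 ^ n2)%N.
Local Notation bas := (bas F n1 n2).

Lemma phiME (a : int * int) : phiM a = (3 * a.1 + a.2, a.2).
Proof.
rewrite /phiM [LHS]surjective_pairing !raddfD !raddfMz /= !mulrzz mul1r mul0r add0r.
by [].
Qed.

(** Integer exponents are allowed, with value 0 out of range, to match the spanning vectors of
    [Mbar]. *)
Definition slot_pow (e : slot) (c : int * int) : Melikyan F n1 n2 :=
  mk (fun e' => if slot_eq e e' then xpow F n1 n2 c else 0).

Lemma slot_pow_case e c : slot_pow e c = 0 \/
  exists i j, [/\ (i < N1)%N, (j < N2)%N, c = (i%:Z, j%:Z) & slot_pow e c = bas e i j].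
Proof.
have [->|nz] := eqVneq (slot_pow e c) 0; first by left.
right; have [e' [i [j]]] := mc_neq0 nz.
rewrite /mc /slot_pow co_mk; case: ifP => _; last by rewrite cf0 eqxx.
rewrite cf_xpow; case: and3P => [[lti ltj /eqP ec] _|_]; last by rewrite eqxx.
by exists i, j; rewrite -ec.
Qed.

Lemma Mbar_0 (p q : int) : Mbar F n1 n2 (3 * p, 3 * q) =
  <<[:: slot_pow cD1 (p + 1, q)%R; slot_pow cD2 (p, q + 1)%R]>>%VS.
Proof.
rewrite /Mbar /dvd3 /quo3 /=.
have -> : ((3 %| 3 * p) && (3 %| 3 * q))%Z by lia.
have -> : ((3 * p %/ 3)%Z, (3 * q %/ 3)%Z) = (p, q) by congr pair; lia.
by have [-> ->] : (p, q) + eps1 = (p + 1, q) /\ (p, q) + eps2 = (p, q + 1)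
  by split; congr pair; rewrite /= addr0.
Qed.

Lemma Mbar_1 (p q : int) : Mbar F n1 n2 (3 * p + 1, 3 * q + 1) =
  <<[:: slot_pow cE1 (p + 1, q)%R; slot_pow cE2 (p, q + 1)%R]>>%VS.
Proof.
rewrite /Mbar /dvd3 /quo3 /=.
have -> : ((3 %| 3 * p + 1) && (3 %| 3 * q + 1))%Z = false by lia.
have -> : ((3 %| 3 * p + 1 - 1) && (3 %| 3 * q + 1 - 1))%Z by lia.
have -> : (((3 * p + 1 - 1)%R %/ 3)%Z, ((3 * q + 1 - 1)%R %/ 3)%Z) = (p, q) by congr pair; lia.
by have [-> ->] : (p, q) + eps1 = (p + 1, q) /\ (p, q) + eps2 = (p, q + 1)
  by split; congr pair; rewrite /= addr0.
Qed.

Lemma Mbar_m1 (p q : int) : Mbar F n1 n2 (3 * p - 1, 3 * q - 1) = <<[:: slot_pow cO (p, q)]>>%VS.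
Proof.
rewrite /Mbar /dvd3 /quo3 /=.
have -> : ((3 %| 3 * p - 1) && (3 %| 3 * q - 1))%Z = false by lia.
have -> : ((3 %| 3 * p - 1 - 1) && (3 %| 3 * q - 1 - 1))%Z = false by lia.
have -> : ((3 %| 3 * p - 1 + 1) && (3 %| 3 * q - 1 + 1))%Z by lia.
by have -> : (((3 * p - 1 + 1)%R %/ 3)%Z, ((3 * q - 1 + 1)%R %/ 3)%Z) = (p, q) by congr pair; lia.
Qed.

End StandardDegrees.

(** The preimage under [phiM] of [c = (3 i + wt1 e, 3 j + wt2 e)], namely
    [((c.1 - c.2) / 3, c.2)]. *)
Definition slot_deg (e : slot) (i j : nat) : int * int :=
  (i%:Z - j%:Z - slot_d e, 3 * j%:Z - slot_o e).

Section Standard.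
Variables (F : closedFieldType) (n1 n2 : nat).
Hypothesis char5 : 5%N \in [pchar F].
Hypotheses (n1_gt0 : (0 < n1)%N) (n2_gt0 : (0 < n2)%N).
Local Notation N1 := (5 ^ n1)%N.
Local Notation N2 := (5 ^ n2)%N.
Local Notation M := (Melikyan F n1 n2).
Local Notation bas := (bas F n1 n2).

Lemma mem_GammaM (U : {vspace M}) a :
  (forall e i j, (i < N1)%N -> (j < N2)%N -> slot_deg e i j = a -> bas e i j \in U) ->
  (GammaM F n1 n2 a <= U)%VS.
Proof.
move=> hU; have pow e c : (forall i j, c = (i%:Z, j%:Z) -> slot_deg e i j = a) ->
    slot_pow F n1 n2 e c \in U.
  by case: (slot_pow_case F n1 n2 e c) => [->|[i [j [lti ltj ec ->]]]] h; rewrite ?mem0v ?hU ?h.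
rewrite /GammaM phiME; case: a {hU} pow => a b pow /=.
have [q [e|[e|e]]] : exists q : int, b = 3 * q \/ (b = 3 * q + 1 \/ b = 3 * q - 1).
  by exists (if (3 %| b - 1)%Z then (b - 1) %/ 3 else (b + 1) %/ 3)%Z; case: ifP; lia.
- have -> : (3 * a + b, b) = (3 * (a + q), 3 * q) by congr pair; lia.
  rewrite Mbar_0; apply/span_subvP => y; rewrite !inE => /orP[] /eqP->; apply: pow => i j [h1 h2];
    rewrite /slot_deg /=; congr pair; lia.
- have -> : (3 * a + b, b) = (3 * (a + q) + 1, 3 * q + 1) by congr pair; lia.
  rewrite Mbar_1; apply/span_subvP => y; rewrite !inE => /orP[] /eqP->; apply: pow => i j [h1 h2];
    rewrite /slot_deg /=; congr pair; lia.
- have -> : (3 * a + b, b) = (3 * (a + q) - 1, 3 * q - 1) by congr pair; lia.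
  rewrite Mbar_m1; apply/span_subvP => y; rewrite !inE => /eqP->; apply: pow => i j [h1 h2];
    rewrite /slot_deg /=; congr pair; lia.
Qed.

Lemma bas_degree e i j : (i < N1)%N -> (j < N2)%N -> has_degree (bas e i j) (slot_deg e i j).
Proof.
move=> lti ltj; split; first exact: bas_neq0.
rewrite /GammaM phiME /slot_deg /=;
have B u v : u = i%:Z -> v = j%:Z -> bas e i j = slot_pow F n1 n2 e (u, v) by move=> -> ->.
case: e B => B; rewrite /slot_d /slot_o.
- have -> : (3 * (i%:Z - j%:Z - 0) + (3 * j%:Z - 1), 3 * j%:Z - 1) = (3 * i%:Z - 1, 3 * j%:Z - 1)
    by congr pair; lia.
  by rewrite Mbar_m1; apply: memv_span; rewrite !inE (B _ _ erefl erefl) eqxx.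
- have -> : (3 * (i%:Z - j%:Z - 1) + (3 * j%:Z - 0), 3 * j%:Z - 0) = (3 * (i%:Z - 1), 3 * j%:Z)
    by congr pair; lia.
  by rewrite Mbar_0; apply: memv_span; rewrite !inE (B _ _ (subrK 1 i%:Z) erefl) eqxx.
- have -> : (3 * (i%:Z - j%:Z - (-1)) + (3 * j%:Z - 3), 3 * j%:Z - 3) = (3 * i%:Z, 3 * (j%:Z - 1))
    by congr pair; lia.
  by rewrite Mbar_0; apply: memv_span; rewrite !inE (B _ _ erefl (subrK 1 j%:Z)) eqxx orbT.
- have -> : (3 * (i%:Z - j%:Z - 1) + (3 * j%:Z - (-1)), 3 * j%:Z - (-1))
    = (3 * (i%:Z - 1) + 1, 3 * j%:Z + 1) by congr pair; lia.
  by rewrite Mbar_1; apply: memv_span; rewrite !inE (B _ _ (subrK 1 i%:Z) erefl) eqxx.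
- have -> : (3 * (i%:Z - j%:Z - (-1)) + (3 * j%:Z - 2), 3 * j%:Z - 2)
    = (3 * i%:Z + 1, 3 * (j%:Z - 1) + 1) by congr pair; lia.
  by rewrite Mbar_1; apply: memv_span; rewrite !inE (B _ _ erefl (subrK 1 j%:Z)) eqxx orbT.
Qed.

Variables (G : groupType) (abG : forall g h : G, (g * h = h * g)%g).
Variables (s : seq G) (P : G -> 'End(M)).
Hypotheses (gr : is_ggrading s P) (mon : monomial_grading P).

Lemma monomial_grading_standard (B : G -> {vspace M}) :
  (forall g x, x \in B g <-> P g x = x) -> is_standard_grading B.
Proof.
move=> hB; split=> //.
have [ge hge] : exists ge : slot -> G, forall e, P (ge e) (bas e 0 0) = bas e 0 0.
  have p1 : (0 < N1)%N by rewrite expn_gt0.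
  have p2 : (0 < N2)%N by rewrite expn_gt0.
  have [[gO hO] [g1 h1]] := (mon cO p1 p2, mon cD1 p1 p2); have [g2 h2] := mon cD2 p1 p2.
  have [[g3 h3] [g4 h4]] := (mon cE1 p1 p2, mon cE2 p1 p2).
  exists (fun e => match e with cO => gO | cD1 => g1 | cD2 => g2 | cE1 => g3 | cE2 => g4 end).
  by case.
(* In the standard Z^2-grading [d_1] and 1 have degrees [(-1, 0)] and [(0, -1)], whence the
   signs. *)
pose phi (a : int * int) : G := nf abG ge (- a.1) (- a.2).
have deg e i j : (i < N1)%N -> (j < N2)%N -> P (phi (slot_deg e i j)) (bas e i j) = bas e i j.
  move=> lti ltj; have [g hg] := mon e lti ltj.
  rewrite -[RHS]hg (degree_bas char5 n1_gt0 n2_gt0 abG gr hge lti ltj hg).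
  by congr (P _ _); rewrite /phi /slot_deg /=; congr nf; lia.
exists phi; split=> [a b|g x].
  by rewrite [RHS](nfD abG) /phi -!opprD.
have fix_deg y a : has_degree y a -> P (phi a) y = y.
  case=> _ ya; apply/fixedSpaceP; apply: subvP ya; apply: mem_GammaM => e i j lti ltj <-.
  by apply/fixedSpaceP; apply: deg.
rewrite hB; split=> [<-|[r hr xr]].
  apply: (@bas_span F n1 n2 (fun y => in_span _ (P g y))).
  - by rewrite linear0; exists [::]; rewrite ?mem0v.
  - move=> y z [r hr yr] [t ht zt]; exists (r ++ t).
      by move=> w; rewrite mem_cat => /orP[/hr|/ht].
    by rewrite linearD /= span_cat memv_add.
  - by move=> c y [r hr yr]; exists r => //; rewrite linearZ /= memvZ.
  move=> e i j /mc_in/andP[lti ltj].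
  have [eg|ne] := eqVneq g (phi (slot_deg e i j)); last first.
    by rewrite (grad_other gr ne (deg e i j lti ltj)); exists [::]; rewrite ?mem0v.
  exists [:: bas e i j]; last by rewrite eg deg // memv_span ?mem_head.
  by move=> y; rewrite inE => /eqP->; exists (slot_deg e i j) => //; apply: bas_degree.
apply/fixedSpaceP; apply: subvP xr; apply/span_subvP => y /hr[a ha <-].
by apply/fixedSpaceP; apply: fix_deg.
Qed.

End Standard.

Theorem theorem1 (F : closedFieldType) (char5 : 5%N \in [pchar F])
    (n1 n2 : nat) (n1_gt0 : (0 < n1)%N) (n2_gt0 : (0 < n2)%N)
    (G : groupType) (L : G -> {vspace Melikyan F n1 n2})
    (gradL : is_grading mbr L)
    (genL : generates (supp L))
    (no5 : forall g : G, ~ has_order g 5) :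
  exists S : G -> {vspace Melikyan F n1 n2},
    is_standard_grading S /\ isomorphic_gradings mbr L S.
Proof.
have [s [P [gr hP]]] := grading_projections gradL.
have supp_nz g : supp L g -> exists2 x, x != 0 & P g x = x.
  rewrite /supp -vpick0 => nz; exists (vpick (L g)) => //.
  by apply/hP; apply: memv_pick.
have abG : forall g h : G, (g * h = h * g)%g.
  apply: (generated_abelian (mbr_bilinear n1 n2 char5) (mbrC char5) (mbr_jacobi char5) gr
    (melikyan_simple char5 n1_gt0 n2_gt0)).
  by move=> H sH hH; apply: genL => // g /supp_nz/hH.
have sep : chars_separate F G.
  apply: (chars_separate_of_generated (s := s) abG char5 no5) => H sH hH.
  by apply: genL => // g /supp_nz[x x0 ex]; apply: hH; apply: (grad_mem gr (x := x)); rewrite ex.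
have [u [u' [pu mon]]] := normalizable_all char5 abG sep n1_gt0 n2_gt0 gr.
exists (fun g => (u' @: L g)%VS); split; last first.
  by exists u'; split=> //; apply: aut_pairP (aut_pair_inv pu).
have gr' := grad_conj gr (aut_pair_inv pu).
apply: (monomial_grading_standard char5 n1_gt0 n2_gt0 abG gr' mon) => g x.
have [c c' _] := pu; rewrite !comp_lfunE; split=> [/memv_imgP[y yL ->]|ex].
  by rewrite c'; have /hP-> := yL.
by rewrite -ex; apply: memv_img; apply/hP; apply: (grad_id gr).
Qed.
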